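(* Let $(A,I_0,\eta)$ be a divided power ring and $R$ a finite type $A$-algebra such that $\eta$ extends to $I_0R$. Fix a closed immersion $j:\Spec(R)\hookrightarrow\Spec(P)$ over $A$ into a smooth affine $A$-scheme admitting an étale $A$-map $q:\Spec(P)\to\mathbf{A}^d_A$. There is an equivalence of categories (depending on $j$) from the category of crystals on $\mathrm{Cris}(R/A)$ to the category of pairs $(M,\nabla)$ with $M=\varprojlim M_n$ arising from an inverse system $(M_n)_{n\ge1}$ of $D_n$-modules satisfying $M_{n+1}\otimes_{D_{n+1}}D_n\simeq M_n$ for all $n$, and $\nabla$ a pd quasi-nilpotent integrable cartesian connection on $M$.
   Context: Divided powers. For an ideal $K$ with divided powers $\delta$, $K^{[n]}$ is the ideal generated by products $\delta_{i_1}(x_1)\cdots\delta_{i_k}(x_k)$ with $x_j\in K$, $\sum_j i_j\ge n$. For an $A$-algebra $B$ and ideal $K\subset B$ with divided powers $\delta$, $\delta$ is compatible with $\eta$ if there is a divided power structure on $K+I_0B$ extending $\delta$ and $\eta$. $D_{C,\eta}(K)$ denotes the divided power envelope of $C$ with respect to an ideal $K$ compatible with $\eta$ (initial among maps from $(C,K)$ to a ring with an ideal carrying divided powers compatible with $\eta$), with canonical ideal $K_D$. Divided power differentials: $\Omega^1_{B/A,\delta}$ is the target of the universal $A$-linear derivation $\mathrm{d}$ on $B$ with $\mathrm{d}(\delta_n(x))=\delta_{n-1}(x)\mathrm{d}x$ for $x$ in the divided power ideal; $\Omega^i$ is its $i$th exterior power. Crystals. $\mathrm{Cris}(R/A)$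 is the category of divided power rings $(B,I,\delta)$ over $A$, compatible with $\eta$, with a given $A$-algebra surjection $B\to R$ with kernel $I$, such that $mI^{[n]}=0$ for some $m,n\ge1$; morphisms are the evident ones over $A$ and $R$. $\mathscr{O}^{\rm cris}_{R/A}$ is the functor $(B,I,\delta)\mapsto B$. A crystal is an $\mathscr{O}^{\rm cris}_{R/A}$-module $\mathscr{F}$ (no topology is involved) such that $B'\otimes_B\mathscr{F}(B,I,\delta)\to\mathscr{F}(B',I',\delta')$ is an isomorphism for every morphism $(B,I,\delta)\to(B',I',\delta')$ in $\mathrm{Cris}(R/A)$. Connections. Let $J=\ker(P\to R)$, $\gamma$ the divided powers on $J_D\subset D_{P,\eta}(J)$, $D_n=D_{P,\eta}(J)/n!J_D^{[n]}$, and $\widehat{D}=\varprojlim D_n$ with its inverse limit topology. Put $\widehat{\Omega}^i_{\widehat{D}/A,\gamma}=\varprojlim_n \Omega^i_{D_{P,\eta}(J)/A,\gamma}/n!J_D^{[n]}\Omega^i_{D_{P,\eta}(J)/A,\gamma}=\widehat{D}\otimes_P\Omega^i_{P/A}$. The étale map $q$ gives coordinates $t_1,\dots,t_d\in P$, and $\widehat{\Omega}^1_{\widehat{D}/A,\gamma}$ is free over $\widehat{D}$ on $\mathrm{d}t_1,\dots,\mathrm{d}t_d$. For $(M_n)$ as in the claim, $M=\varprojlim M_n$ is a topological $\widehat{D}$-module. A connection on $M$ is a continuous $A$-linear map $\nabla:M\to M\otimes_{\widehat{D}}\widehat{\Omega}^1_{\widehat{D}/A,\gamma}=\bigoplus_jM\,\mathrm{d}t_j$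 with $\nabla(fm)=m\otimes\mathrm{d}f+f\nabla(m)$ for $f\in\widehat D$. It is cartesian if it is the inverse limit of a compatible system of $A$-linear connections $\nabla_n:M_n\to M_n\otimes_{D_n}\Omega^1_{D_n/A,\gamma}$; equivalently, each composite $M\to M\otimes\widehat{\Omega}^1_{\widehat D/A,\gamma}\to M_n\otimes_{D_n}\Omega^1_{D_n/A,\gamma}$ factors through $M\to M_n$. Extending $\nabla$ by the Leibniz rule to maps $\nabla^i:M\otimes\widehat{\Omega}^i_{\widehat D/A,\gamma}\to M\otimes\widehat{\Omega}^{i+1}_{\widehat D/A,\gamma}$, $\nabla$ is integrable if $\nabla^1\circ\nabla^0=0$. Writing $\nabla(m)=\sum_j\theta_j(m)\otimes\mathrm{d}t_j$ with $A$-linear $\theta_j:M\to M$, a cartesian $\nabla$ is pd quasi-nilpotent if for each $m\in M$, $n\ge1$ and $j$, the image of $\theta_j^k(m)$ in $M_n$ lies in $n!M_n$ for all sufficiently large $k$ (depending on $m$ and $n$). A morphism $(M,\nabla)\to(M',\nabla')$ is a $\widehat{D}$-linear map arising from a compatible system of $D_n$-linear maps $f_n:M_n\to M'_n$ compatible with $\nabla_n$ and $\nabla'_n$ for every $n$. *)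

(* Defs.v *)
From HB Require Import structures.
From mathcomp Require Import all_boot all_order all_algebra.
From mathcomp Require Import boolp.

Set Implicit Arguments.
Unset Strict Implicit.
Unset Printing Implicit Defensive.

Import GRing.Theory.
Import Quotient.
Local Open Scope ring_scope.
Local Open Scope quotient_scope.

Section Span.
Variables (B : pzRingType) (V : lmodType B).

Inductive span (S : V -> Prop) : V -> Prop :=
| span_gen v : S v -> span S v
| span0 : span S 0
| spanD u v : span S u -> span S v -> span S (u + v)
| spanZ b v : span S v -> span S (b *: v).

Definition spanb (S : V -> Prop) : {pred V} := fun v => `[< span S v >].

Variable S : V -> Prop.

Lemma spanb_zmod : zmod_closed (spanb S).
Proof.
split=> [|u v /asboolP Su /asboolP Sv]; first by apply/asboolP; apply: span0.
by apply/asboolP; rewrite -scaleN1r; apply: spanD => //; apply: spanZ.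
Qed.

HB.instance Definition _ := GRing.isZmodClosed.Build V (spanb S) spanb_zmod.

Definition zquot := {quot (spanb S : zmodClosed V)}.
HB.instance Definition _ := GRing.Zmodule.on zquot.
Definition zpi (v : V) : zquot := \pi_({quot (spanb S : zmodClosed V)}) v.
Definition zrepr (x : zquot) : V := repr (x : {quot (spanb S : zmodClosed V)}).

Lemma zreprK : cancel zrepr zpi. Proof. exact: reprK. Qed.

Lemma zpiP u v : (zpi u = zpi v) <-> span S (u - v).
Proof.
split=> [/eqP|H]; first by rewrite -idealrBE => /asboolP.
by apply/eqP; rewrite -idealrBE; apply/asboolP.
Qed.

Lemma zpi_repr v : span S (zrepr (zpi v) - v).
Proof. by apply/zpiP; rewrite zreprK. Qed.

Lemma zpiD u v : zpi (u + v) = zpi u + zpi v. Proof. exact: raddfD. Qed.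
Lemma zpiN u : zpi (- u) = - zpi u. Proof. exact: raddfN. Qed.
Lemma zpi0 : zpi 0 = 0. Proof. exact: raddf0. Qed.
End Span.

Section QuotientRing.
Variables (B : comPzRingType) (S : B -> Prop).

Definition ideal_gen : B -> Prop := @span B B^o S.
Definition qring := @zquot B B^o S.
HB.instance Definition _ := GRing.Zmodule.on qring.
Definition qpi (b : B) : qring := @zpi B B^o S b.
Definition qrepr (x : qring) : B := @zrepr B B^o S x.

Lemma qreprK : cancel qrepr qpi. Proof. exact: zreprK. Qed.
Lemma qpiP u v : (qpi u = qpi v) <-> ideal_gen (u - v).
Proof. exact: zpiP. Qed.
Lemma qpi_surj (x : qring) : exists b, x = qpi b.
Proof. by exists (qrepr x); rewrite qreprK. Qed.

Lemma qpiD u v : qpi (u + v) = qpi u + qpi v. Proof. exact: zpiD. Qed.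

Let mul (x y : qring) := qpi (qrepr x * qrepr y).
Let mulE u v : mul (qpi u) (qpi v) = qpi (u * v).
Proof.
apply/qpiP.
have -> : qrepr (qpi u) * qrepr (qpi v) - u * v =
    qrepr (qpi u) * (qrepr (qpi v) - v) + v * (qrepr (qpi u) - u).
  by rewrite !mulrBr addrA (mulrC v) subrK (mulrC v u).
by apply: spanD; apply: (@spanZ _ B^o); apply/qpiP; rewrite qreprK.
Qed.

Let mulA : associative mul.
Proof.
move=> x y z; have [a ->] := qpi_surj x; have [b ->] := qpi_surj y.
by have [c ->] := qpi_surj z; rewrite !mulE mulrA.
Qed.
Let mulC : commutative mul.
Proof. by move=> x y; rewrite /mul mulrC. Qed.
Let mul1 : left_id (qpi 1) mul.
Proof. by move=> x; have [a ->] := qpi_surj x; rewrite mulE mul1r. Qed.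
Let mulDl : left_distributive mul +%R.
Proof.
move=> x y z; have [a ->] := qpi_surj x; have [b ->] := qpi_surj y.
by have [c ->] := qpi_surj z; rewrite -qpiD !mulE mulrDl qpiD.
Qed.
HB.instance Definition _ :=
  GRing.Zmodule_isComPzRing.Build qring mulA mulC mul1 mulDl.

Lemma qpiM u v : qpi (u * v) = qpi u * qpi v.
Proof. by rewrite -mulE. Qed.
Fact qpi_zmod : zmod_morphism qpi.
Proof. by move=> u v; apply: (@raddfB _ _ (\pi_({quot (spanb (V := B^o) S : zmodClosed _)}))). Qed.
HB.instance Definition _ := GRing.isZmodMorphism.Build B qring qpi qpi_zmod.
HB.instance Definition _ := GRing.isMonoidMorphism.Build B qring qpi
  (conj (erefl : qpi 1 = 1) qpiM).
End QuotientRing.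

Section QuotientModule.
Variables (B : comPzRingType) (S : B -> Prop) (V : lmodType B).

(* [qmod] is the quotient of [V] by [K V], where [K] is the ideal generated by
   [S], with its structure of module over [B / K]. *)
Definition smul_set : V -> Prop := fun v => exists b w, S b /\ v = b *: w.
Definition qmod := zquot smul_set.
HB.instance Definition _ := GRing.Zmodule.on qmod.
Definition mpi (v : V) : qmod := zpi smul_set v.
Definition mrepr (x : qmod) : V := zrepr (x : zquot smul_set).

Lemma mreprK : cancel mrepr mpi. Proof. exact: zreprK. Qed.
Lemma mpiP u v : (mpi u = mpi v) <-> span smul_set (u - v).
Proof. exact: zpiP. Qed.
Lemma mpi_surj (x : qmod) : exists v, x = mpi v.
Proof. by exists (mrepr x); rewrite mreprK. Qed.
Lemma mpiD u v : mpi (u + v) = mpi u + mpi v. Proof. exact: zpiD. Qed.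

Lemma span_smul b v : ideal_gen S b -> span smul_set (b *: v).
Proof.
elim=> [c Sc||c d _ IHc _ IHd|c d _ IH].
- by apply: span_gen; exists c, v.
- by rewrite scale0r; apply: span0.
- by rewrite scalerDl; apply: spanD.
- by rewrite [c *: d]/(c * d) -scalerA; apply: spanZ.
Qed.

Let scale (x : qring S) (y : qmod) : qmod := mpi (qrepr x *: mrepr y).
Let scaleE b v : scale (qpi S b) (mpi v) = mpi (b *: v).
Proof.
apply/mpiP; set b' := qrepr _; set v' := mrepr _.
have -> : b' *: v' - b *: v = b' *: (v' - v) + (b' - b) *: v.
  by rewrite scalerBr scalerBl addrA subrK.
apply: spanD; first by apply: spanZ; apply/mpiP; rewrite mreprK.
by apply: span_smul; apply/qpiP; rewrite qreprK.
Qed.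

Let scaleA a b v : scale a (scale b v) = scale (a * b) v.
Proof.
have [x ->] := qpi_surj a; have [y ->] := qpi_surj b; have [w ->] := mpi_surj v.
by rewrite -qpiM !scaleE scalerA.
Qed.
Let scale1 : left_id 1 scale.
Proof. by move=> v; have [w ->] := mpi_surj v; rewrite scaleE scale1r. Qed.
Let scaleDr : right_distributive scale +%R.
Proof.
move=> a u v; have [x ->] := qpi_surj a; have [y ->] := mpi_surj u.
by have [w ->] := mpi_surj v; rewrite -mpiD !scaleE scalerDr mpiD.
Qed.
Let scaleDl v : {morph scale^~ v : a b / a + b}.
Proof.
move=> a b; have [x ->] := qpi_surj a; have [y ->] := qpi_surj b.
by have [w ->] := mpi_surj v; rewrite -qpiD !scaleE scalerDl mpiD.
Qed.
HB.instance Definition _ :=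
  GRing.Zmodule_isLmodule.Build (qring S) qmod scaleA scale1 scaleDr scaleDl.

Lemma mpiZ b v : mpi (b *: v) = qpi S b *: mpi v.
Proof. by rewrite -scaleE. Qed.
End QuotientModule.

Section Presentation.
Variables (B : comPzRingType) (X : choiceType) (rel : seq (B * X) -> Prop).

(* The module generated by [X] subject to the relations [rel]: a list of pairs
   [(b, x)] stands for the linear combination of the generators [x] with
   coefficients [b]. *)
Inductive pres_eq : seq (B * X) -> seq (B * X) -> Prop :=
| pres_refl s : pres_eq s s
| pres_sym s t : pres_eq s t -> pres_eq t s
| pres_trans s t u : pres_eq s t -> pres_eq t u -> pres_eq s u
| pres_cat s s' t t' : pres_eq s s' -> pres_eq t t' ->
    pres_eq (s ++ t) (s' ++ t')
| pres_comm s t : pres_eq (s ++ t) (t ++ s)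
| pres_add b c x : pres_eq [:: (b + c, x)] [:: (b, x); (c, x)]
| pres_zero x : pres_eq [:: (0, x)] [::]
| pres_rel b s : rel s -> pres_eq [seq (b * p.1, p.2) | p <- s] [::].

Definition pres_eqb s t := `[< pres_eq s t >].
Lemma pres_eqb_equiv : equiv_class_of pres_eqb.
Proof.
split=> [s|s t|t s u]; first exact/asboolP/pres_refl.
- by apply/asboolP/asboolP; apply: pres_sym.
- by move=> /asboolP ? /asboolP ?; apply/asboolP; apply: (pres_trans (t := t)).
Qed.
Canonical pres_equiv := EquivRelPack pres_eqb_equiv.
Canonical pres_encModRel := defaultEncModRel pres_eqb.

Definition pres := {eq_quot pres_eqb}.
HB.instance Definition _ := Choice.on pres.
Definition ppi (s : seq (B * X)) : pres := \pi_({eq_quot pres_eqb}) s.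
Definition prepr (x : pres) : seq (B * X) := repr (x : {eq_quot pres_eqb}).
Lemma preprK : cancel prepr ppi. Proof. exact: reprK. Qed.
Lemma ppiP s t : ppi s = ppi t <-> pres_eq s t.
Proof. by split=> [/eqmodP/asboolP|H] //; apply/eqmodP/asboolP. Qed.
Lemma ppi_surj x : exists s, x = ppi s.
Proof. by exists (prepr x); rewrite preprK. Qed.
Lemma prepr_eq s : pres_eq (prepr (ppi s)) s.
Proof. by apply/ppiP; rewrite preprK. Qed.

Definition fscale (b : B) (s : seq (B * X)) := [seq (b * p.1, p.2) | p <- s].
Lemma fscale_eq b s t : pres_eq s t -> pres_eq (fscale b s) (fscale b t).
Proof.
elim=> {s t} => [s|s t _|s t u _ + _|s s' t t' _ + _|s t|c d x|x|c s rs].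
- exact: pres_refl.
- exact: pres_sym.
- exact: pres_trans.
- by rewrite /fscale !map_cat => *; apply: pres_cat.
- by rewrite /fscale !map_cat; apply: pres_comm.
- by rewrite /fscale /= mulrDr; apply: pres_add.
- by rewrite /fscale /= mulr0; apply: pres_zero.
- have -> : fscale b (fscale c s) = fscale (b * c) s.
    by rewrite /fscale -map_comp; apply: eq_map => p /=; rewrite mulrA.
  exact: pres_rel.
Qed.

Let add (x y : pres) : pres := ppi (prepr x ++ prepr y).
Let scale (b : B) (x : pres) : pres := ppi (fscale b (prepr x)).
Let opp (x : pres) : pres := scale (-1) x.
Let addE s t : add (ppi s) (ppi t) = ppi (s ++ t).
Proof. by apply/ppiP/pres_cat; apply: prepr_eq. Qed.
Let scaleE b s : scale b (ppi s) = ppi (fscale b s).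
Proof. by apply/ppiP/fscale_eq/prepr_eq. Qed.

Let addA : associative add.
Proof.
move=> x y z; have [a ->] := ppi_surj x; have [b ->] := ppi_surj y.
by have [c ->] := ppi_surj z; rewrite !addE catA.
Qed.
Let addC : commutative add.
Proof.
move=> x y; have [a ->] := ppi_surj x; have [b ->] := ppi_surj y.
by rewrite !addE; apply/ppiP/pres_comm.
Qed.
Let add0 : left_id (ppi [::]) add.
Proof. by move=> x; have [a ->] := ppi_surj x; rewrite addE. Qed.

Let fscaleDl b c s : pres_eq (fscale (b + c) s) (fscale b s ++ fscale c s).
Proof.
elim: s => [|[d x] s IH]; first exact: pres_refl.
rewrite -cat1s /fscale !map_cat -!/(fscale _ _).
apply: (pres_trans (t := (fscale b [:: (d, x)] ++ fscale c [:: (d, x)])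
                          ++ (fscale b s ++ fscale c s))).
  by apply: pres_cat => //; rewrite /= mulrDl; apply: pres_add.
rewrite -!catA; apply: pres_cat; first exact: pres_refl.
rewrite !catA; apply: pres_cat; [exact: pres_comm | exact: pres_refl].
Qed.
Let fscale0 s : pres_eq (fscale 0 s) [::].
Proof.
elim: s => [|[d x] s IH]; first exact: pres_refl.
rewrite -cat1s /fscale !map_cat; apply: (pres_cat (s' := [::])) => //=.
by rewrite mul0r; apply: pres_zero.
Qed.
Let fscale1 s : fscale 1 s = s.
Proof. by rewrite /fscale -[RHS]map_id; apply: eq_map => -[b x] /=; rewrite mul1r. Qed.
Let addN : left_inverse (ppi [::]) opp add.
Proof.
move=> x; have [a ->] := ppi_surj x; rewrite /opp scaleE addE; apply/ppiP.
apply: pres_trans (fscale0 a).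
by have := fscaleDl (-1) 1 a; rewrite addNr fscale1; apply: pres_sym.
Qed.
HB.instance Definition _ := GRing.isZmodule.Build pres addA addC add0 addN.

Let scaleA a b v : scale a (scale b v) = scale (a * b) v.
Proof.
have [s ->] := ppi_surj v; rewrite !scaleE /fscale -map_comp.
by congr ppi; apply: eq_map => p /=; rewrite mulrA.
Qed.
Let scale1 : left_id 1 scale.
Proof. by move=> v; have [s ->] := ppi_surj v; rewrite scaleE fscale1. Qed.
Let scaleDr : right_distributive scale +%R.
Proof.
move=> a u v; have [s ->] := ppi_surj u; have [t ->] := ppi_surj v.
by rewrite [_ + _]addE !scaleE [RHS]addE /fscale map_cat.
Qed.
Let scaleDl v : {morph scale^~ v : a b / a + b}.
Proof.
move=> a b; have [s ->] := ppi_surj v; rewrite !scaleE [RHS]addE.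
exact/ppiP/fscaleDl.
Qed.
HB.instance Definition _ :=
  GRing.Zmodule_isLmodule.Build B pres scaleA scale1 scaleDr scaleDl.

Definition pgen (x : X) : pres := ppi [:: (1, x)].

Lemma ppiE s : ppi s = \sum_(p <- s) p.1 *: pgen p.2.
Proof.
elim: s => [|[b x] s IH]; first by rewrite big_nil.
rewrite big_cons -IH -cat1s -[LHS]addE; congr (_ + _).
by rewrite [RHS]scaleE /fscale /= mulr1.
Qed.

Lemma pres_ind (P : pres -> Prop) : P 0 -> (forall u v, P u -> P v -> P (u + v)) ->
  (forall b x, P (b *: pgen x)) -> forall u, P u.
Proof.
move=> P0 PD Pg u; have [s ->] := ppi_surj u; rewrite ppiE.
by apply: big_ind.
Qed.

(* The additive map on [pres] that sends [b *: pgen x] to [h b x]. *)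
Definition plift (N : zmodType) (h : B -> X -> N) (u : pres) : N :=
  \sum_(p <- prepr u) h p.1 p.2.

Section Lift.
Variables (N : zmodType) (h : B -> X -> N).
Hypothesis hD : forall b c x, h (b + c) x = h b x + h c x.
Hypothesis hrel : forall b s, rel s -> \sum_(p <- s) h (b * p.1) p.2 = 0.

Lemma plift_ppi s : plift h (ppi s) = \sum_(p <- s) h p.1 p.2.
Proof.
suff E t t' : pres_eq t t' -> \sum_(p <- t) h p.1 p.2 = \sum_(p <- t') h p.1 p.2.
  exact/E/prepr_eq.
elim=> {s t t'} [s|s t _|s t u _ + _|s s' t t' _ + _|s t|c d x|x|c s rs].
- by [].
- by move->.
- by move=> -> ->.
- by rewrite !big_cat /= => -> ->.
- by rewrite !big_cat /= addrC.
- by rewrite !(big_cons, big_nil) /= hD !addr0.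
- rewrite !(big_cons, big_nil) addr0 /=; apply: (addrI (h 0 x)).
  by rewrite -hD !addr0.
- by rewrite big_map big_nil /= hrel.
Qed.

Lemma pliftD u v : plift h (u + v) = plift h u + plift h v.
Proof.
have [s ->] := ppi_surj u; have [t ->] := ppi_surj v.
by rewrite [_ + _]addE !plift_ppi big_cat.
Qed.

Lemma plift_gen b x : plift h (b *: pgen x) = h b x.
Proof. by rewrite [_ *: _]scaleE /fscale plift_ppi /= big_seq1 /= mulr1. Qed.
End Lift.

Lemma pres_relE s : rel s -> \sum_(p <- s) p.1 *: pgen p.2 = 0 :> pres.
Proof.
move=> rs; rewrite -ppiE; apply/ppiP.
by rewrite -(fscale1 s); apply: pres_rel.
Qed.
End Presentation.
Definition additive_map (U V : zmodType) (f : U -> V) :=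
  {morph f : x y / x + y}.

Definition semilinear (B C : pzRingType) (rho : B -> C) (M : lmodType B)
    (N : lmodType C) (f : M -> N) :=
  additive_map f /\ forall b x, f (b *: x) = rho b *: f x.

Lemma additive_map0 (U V : zmodType) (f : U -> V) : additive_map f -> f 0 = 0.
Proof. by move=> fD; apply: (addrI (f 0)); rewrite -fD !addr0. Qed.

Lemma additive_mapN (U V : zmodType) (f : U -> V) u :
  additive_map f -> f (- u) = - f u.
Proof. by move=> fD; apply: (addrI (f u)); rewrite -fD !subrr additive_map0. Qed.

Section Tensor.
Variables (B C : comPzRingType) (phi : {rmorphism B -> C}).
Variables (N : lmodType C) (M : lmodType B).

(* The tensor product of [N] and [M] over [B], as a module over [C]. *)
Inductive tens_rel : seq (C * (N * M)) -> Prop :=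
| tens_relDl n n' m :
    tens_rel [:: (1, (n + n', m)); (- 1, (n, m)); (- 1, (n', m))]
| tens_relDr n m m' :
    tens_rel [:: (1, (n, m + m')); (- 1, (n, m)); (- 1, (n, m'))]
| tens_relZ c n m : tens_rel [:: (1, (c *: n, m)); (- c, (n, m))]
| tens_rel_bal b n m :
    tens_rel [:: (1, (phi b *: n, m)); (- 1, (n, b *: m))].

Definition tens := pres tens_rel.
HB.instance Definition _ := GRing.Lmodule.on tens.
Definition tmk (n : N) (m : M) : tens := pgen tens_rel (n, m).

Lemma tmkDl n n' m : tmk (n + n') m = tmk n m + tmk n' m.
Proof.
have := pres_relE (tens_relDl n n' m).
by rewrite !big_cons big_nil /= scale1r !scaleN1r addr0 -opprD => /subr0_eq.
Qed.
Lemma tmkDr n m m' : tmk n (m + m') = tmk n m + tmk n m'.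
Proof.
have := pres_relE (tens_relDr n m m').
by rewrite !big_cons big_nil /= scale1r !scaleN1r addr0 -opprD => /subr0_eq.
Qed.
Lemma tmkZl c n m : tmk (c *: n) m = c *: tmk n m.
Proof.
have := pres_relE (tens_relZ c n m).
by rewrite !big_cons big_nil /= scale1r scaleNr addr0 => /subr0_eq.
Qed.
Lemma tmk_bal b n m : tmk (phi b *: n) m = tmk n (b *: m).
Proof.
have := pres_relE (tens_rel_bal b n m).
by rewrite !big_cons big_nil /= scale1r scaleN1r addr0 => /subr0_eq.
Qed.

Lemma tens_ind (P : tens -> Prop) : P 0 ->
  (forall u v, P u -> P v -> P (u + v)) -> (forall n m, P (tmk n m)) ->
  forall u, P u.
Proof.
move=> P0 PD Pg; apply: pres_ind => // c [n m].
by rewrite -[_ *: _]tmkZl.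
Qed.

(* The additive map on the tensor product induced by a biadditive and
   [B]-balanced map [g]. *)
Definition tlift (Q : zmodType) (g : N -> M -> Q) : tens -> Q :=
  plift (rel := tens_rel) (fun c p => g (c *: p.1) p.2).

Section Lift.
Variables (Q : zmodType) (g : N -> M -> Q).
Hypothesis gDl : forall n n' m, g (n + n') m = g n m + g n' m.
Hypothesis gDr : forall n m m', g n (m + m') = g n m + g n m'.
Hypothesis g_bal : forall b n m, g (phi b *: n) m = g n (b *: m).

Let hD b c p : g ((b + c) *: p.1) p.2 = g (b *: p.1) p.2 + g (c *: p.1) p.2.
Proof. by rewrite scalerDl gDl. Qed.
Let gN n m : g (- n) m = - g n m.
Proof. by rewrite -(@additive_mapN _ _ (g^~ m)). Qed.
Let hrel c s : tens_rel s -> \sum_(p <- s) g ((c * p.1) *: p.2.1) p.2.2 = 0.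
Proof.
case=> [n n' m|n m m'|d n m|b n m];
  rewrite !big_cons big_nil /= mulr1 ?mulrN ?mulr1 !scaleNr !gN addr0.
- by rewrite scalerDr gDl -opprD subrr.
- by rewrite gDr -opprD subrr.
- by rewrite scalerA subrr.
- by rewrite scalerA mulrC -scalerA g_bal subrr.
Qed.

Lemma tliftD : additive_map (tlift g).
Proof. exact: (pliftD (h := fun c p => g (c *: p.1) p.2) hD hrel). Qed.

Lemma tlift_mk n m : tlift g (tmk n m) = g n m.
Proof.
rewrite -[tmk n m]scale1r.
by rewrite [LHS](plift_gen (h := fun c p => g (c *: p.1) p.2) hD hrel) scale1r.
Qed.
End Lift.
End Tensor.

Notation "M '⊗[' B ] N" := (@tens B B idfun M N)
  (at level 40, B at level 200, N at next level, format "M  '⊗[' B ]  N").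
Notation "m '⊗' n" := (tmk idfun m n) (at level 40, n at next level).

Section TensorMap.
Variables (B C : comPzRingType) (rho : {rmorphism B -> C}).
Variables (M N : lmodType B) (M' N' : lmodType C).

Definition tmap (f : M -> M') (g : N -> N') : M ⊗[B] N -> M' ⊗[C] N' :=
  tlift (fun m n => f m ⊗ g n).

Variables (f : M -> M') (g : N -> N').
Hypotheses (fS : semilinear rho f) (gS : semilinear rho g).
Let gDl m m' n : f (m + m') ⊗ g n = f m ⊗ g n + f m' ⊗ g n.
Proof. by rewrite fS.1 tmkDl. Qed.
Let gDr m n n' : f m ⊗ g (n + n') = f m ⊗ g n + f m ⊗ g n'.
Proof. by rewrite gS.1 tmkDr. Qed.
Let g_bal b m n : f (idfun b *: m) ⊗ g n = f m ⊗ g (b *: n).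
Proof. by rewrite fS.2 gS.2 -tmk_bal. Qed.

Lemma tmapD : additive_map (tmap f g).
Proof. exact: (tliftD gDl gDr g_bal). Qed.
Lemma tmap_mk m n : tmap f g (m ⊗ n) = f m ⊗ g n.
Proof. exact: (tlift_mk gDl gDr g_bal). Qed.
Lemma tmapS : semilinear rho (tmap f g).
Proof.
split=> [|b]; first exact: tmapD.
elim/tens_ind => [|u v IHu IHv|m n].
- by rewrite scaler0 !(additive_map0 tmapD) scaler0.
- by rewrite scalerDr !tmapD IHu IHv scalerDr.
- by rewrite -tmkZl !tmap_mk fS.2 tmkZl.
Qed.
End TensorMap.

Lemma tens_ext (B : comPzRingType) (M N : lmodType B) (Q : zmodType)
    (F G : M ⊗[B] N -> Q) : additive_map F -> additive_map G ->
  (forall m n, F (m ⊗ n) = G (m ⊗ n)) -> forall u, F u = G u.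
Proof.
move=> FD GD FG; elim/tens_ind => [|u v IHu IHv|m n].
- by rewrite !additive_map0.
- by rewrite FD GD IHu IHv.
- exact: FG.
Qed.

(* [M'] is the extension of scalars of [M] along [phi], via [f]. *)
Definition is_base_change (B C : comPzRingType) (phi : {rmorphism B -> C})
    (M : lmodType B) (M' : lmodType C) (f : M -> M') :=
  exists psi : {linear tens phi C^o M -> M'},
    (forall c m, psi (tmk phi c m) = c *: f m) /\ bijective psi.

Section ExteriorSquare.
Variables (B : comPzRingType) (V : lmodType B).

Inductive ext2_rel : seq (B * (V * V)) -> Prop :=
| ext2_relDl v v' w :
    ext2_rel [:: (1, (v + v', w)); (- 1, (v, w)); (- 1, (v', w))]
| ext2_relDr v w w' :
    ext2_rel [:: (1, (v, w + w')); (- 1, (v, w)); (- 1, (v, w'))]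
| ext2_relZl b v w : ext2_rel [:: (1, (b *: v, w)); (- b, (v, w))]
| ext2_relZr b v w : ext2_rel [:: (1, (v, b *: w)); (- b, (v, w))]
| ext2_rel_alt v : ext2_rel [:: (1, (v, v))].

Definition ext2 := pres ext2_rel.
HB.instance Definition _ := GRing.Lmodule.on ext2.
Definition wedge (v w : V) : ext2 := pgen ext2_rel (v, w).

Lemma wedgeDl v v' w : wedge (v + v') w = wedge v w + wedge v' w.
Proof.
have := pres_relE (ext2_relDl v v' w).
by rewrite !big_cons big_nil /= scale1r !scaleN1r addr0 -opprD => /subr0_eq.
Qed.
Lemma wedgeDr v w w' : wedge v (w + w') = wedge v w + wedge v w'.
Proof.
have := pres_relE (ext2_relDr v w w').
by rewrite !big_cons big_nil /= scale1r !scaleN1r addr0 -opprD => /subr0_eq.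
Qed.
Lemma wedgeZl b v w : wedge (b *: v) w = b *: wedge v w.
Proof.
have := pres_relE (ext2_relZl b v w).
by rewrite !big_cons big_nil /= scale1r scaleNr addr0 => /subr0_eq.
Qed.
Lemma wedgeZr b v w : wedge v (b *: w) = b *: wedge v w.
Proof.
have := pres_relE (ext2_relZr b v w).
by rewrite !big_cons big_nil /= scale1r scaleNr addr0 => /subr0_eq.
Qed.
Lemma wedge_alt v : wedge v v = 0.
Proof.
have := pres_relE (ext2_rel_alt v).
by rewrite !big_cons big_nil /= scale1r addr0.
Qed.
End ExteriorSquare.

Section InverseLimit.

Record ring_tower := RingTower {
  rt_ring :> nat -> comPzRingType;
  rt_map : forall n, {rmorphism rt_ring n.+1 -> rt_ring n} }.

Record mod_tower (T : ring_tower) := ModTower {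
  mt_mod :> forall n, lmodType (T n);
  mt_map : forall n, mt_mod n.+1 -> mt_mod n;
  mt_mapS : forall n, semilinear (rt_map T n) (@mt_map n) }.
#[global] Arguments mt_map {T} m n.
#[global] Arguments mt_mapS {T} m n.

Section Ring.
Variable T : ring_tower.
Definition lim_ring :=
  {x : forall n, T n | forall n, rt_map T n (x n.+1) = x n}.
HB.instance Definition _ := gen_eqMixin lim_ring.
HB.instance Definition _ := gen_choiceMixin lim_ring.
Definition rproj n (x : lim_ring) : T n := sval x n.
Definition mk_lim_ring (x : forall n, T n)
    (hx : forall n, rt_map T n (x n.+1) = x n) : lim_ring := exist _ x hx.

Lemma rproj_inj x y : (forall n, rproj n x = rproj n y) -> x = y.
Proof.
case: x y => [x hx] [y hy] H; apply: eq_exist.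
exact: functional_extensionality_dep.
Qed.
Lemma rproj_map n x : rt_map T n (rproj n.+1 x) = rproj n x.
Proof. exact: (svalP x). Qed.

Let add_lim (x y : lim_ring) n : rt_map T n (rproj n.+1 x + rproj n.+1 y) = rproj n x + rproj n y.
Proof. by rewrite rmorphD /= !rproj_map. Qed.
Let add (x y : lim_ring) : lim_ring :=
  exist _ (fun n => rproj n x + rproj n y) (add_lim x y).
Let opp_lim (x : lim_ring) n : rt_map T n (- rproj n.+1 x) = - rproj n x.
Proof. by rewrite rmorphN /= rproj_map. Qed.
Let opp (x : lim_ring) : lim_ring :=
  exist _ (fun n => - rproj n x) (opp_lim x).
Let mul_lim (x y : lim_ring) n : rt_map T n (rproj n.+1 x * rproj n.+1 y) = rproj n x * rproj n y.
Proof. by rewrite rmorphM /= !rproj_map. Qed.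
Let mul (x y : lim_ring) : lim_ring :=
  exist _ (fun n => rproj n x * rproj n y) (mul_lim x y).
Let zero_lim n : rt_map T n (0) = 0.
Proof. by rewrite rmorph0. Qed.
Let zero : lim_ring :=
  exist _ (fun n => 0) (zero_lim).
Let one_lim n : rt_map T n (1) = 1.
Proof. by rewrite rmorph1. Qed.
Let one : lim_ring :=
  exist _ (fun n => 1) (one_lim).

Let addA : associative add.
Proof. by move=> x y z; apply: rproj_inj => n; apply: addrA. Qed.
Let addC : commutative add.
Proof. by move=> x y; apply: rproj_inj => n; apply: addrC. Qed.
Let add0 : left_id zero add.
Proof. by move=> x; apply: rproj_inj => n; apply: add0r. Qed.
Let addN : left_inverse zero opp add.
Proof. by move=> x; apply: rproj_inj => n; apply: addNr. Qed.
HB.instance Definition _ := GRing.isZmodule.Build lim_ring addA addC add0 addN.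
Let mulA : associative mul.
Proof. by move=> x y z; apply: rproj_inj => n; apply: mulrA. Qed.
Let mulC : commutative mul.
Proof. by move=> x y; apply: rproj_inj => n; apply: mulrC. Qed.
Let mul1 : left_id one mul.
Proof. by move=> x; apply: rproj_inj => n; apply: mul1r. Qed.
Let mulDl : left_distributive mul +%R.
Proof. by move=> x y z; apply: rproj_inj => n; apply: mulrDl. Qed.
HB.instance Definition _ :=
  GRing.Zmodule_isComPzRing.Build lim_ring mulA mulC mul1 mulDl.

Fact rproj_zmod n : zmod_morphism (rproj n). Proof. by []. Qed.
Fact rproj_monoid n : monoid_morphism (rproj n). Proof. by []. Qed.
HB.instance Definition _ n :=
  GRing.isZmodMorphism.Build lim_ring (T n) (rproj n) (rproj_zmod n).
HB.instance Definition _ n :=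
  GRing.isMonoidMorphism.Build lim_ring (T n) (rproj n) (rproj_monoid n).
End Ring.

Section Module.
Variables (T : ring_tower) (M : mod_tower T).
Definition lim_mod :=
  {x : forall n, M n | forall n, mt_map M n (x n.+1) = x n}.
HB.instance Definition _ := gen_eqMixin lim_mod.
HB.instance Definition _ := gen_choiceMixin lim_mod.
Definition mproj n (x : lim_mod) : M n := sval x n.
Definition mk_lim_mod (x : forall n, M n)
    (hx : forall n, mt_map M n (x n.+1) = x n) : lim_mod := exist _ x hx.

Lemma mproj_inj x y : (forall n, mproj n x = mproj n y) -> x = y.
Proof.
case: x y => [x hx] [y hy] H; apply: eq_exist.
exact: functional_extensionality_dep.
Qed.
Lemma mproj_map n x : mt_map M n (mproj n.+1 x) = mproj n x.
Proof. exact: (svalP x). Qed.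

Let add_lim (x y : lim_mod) n : mt_map M n (mproj n.+1 x + mproj n.+1 y) = mproj n x + mproj n y.
Proof. by rewrite (mt_mapS M n).1 !mproj_map. Qed.
Let add (x y : lim_mod) : lim_mod :=
  exist _ (fun n => mproj n x + mproj n y) (add_lim x y).
Let opp_lim (x : lim_mod) n : mt_map M n (- mproj n.+1 x) = - mproj n x.
Proof. by rewrite (additive_mapN _ (mt_mapS M n).1) mproj_map. Qed.
Let opp (x : lim_mod) : lim_mod :=
  exist _ (fun n => - mproj n x) (opp_lim x).
Let zero_lim n : mt_map M n (0) = 0.
Proof. by rewrite (additive_map0 (mt_mapS M n).1). Qed.
Let zero : lim_mod :=
  exist _ (fun n => 0) (zero_lim).
Let scale_lim (a : lim_ring T) (x : lim_mod) n : mt_map M n (rproj n.+1 a *: mproj n.+1 x) = rproj n a *: mproj n x.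
Proof. by rewrite (mt_mapS M n).2 mproj_map rproj_map. Qed.
Let scale (a : lim_ring T) (x : lim_mod) : lim_mod :=
  exist _ (fun n => rproj n a *: mproj n x) (scale_lim a x).

Let addA : associative add.
Proof. by move=> x y z; apply: mproj_inj => n; apply: addrA. Qed.
Let addC : commutative add.
Proof. by move=> x y; apply: mproj_inj => n; apply: addrC. Qed.
Let add0 : left_id zero add.
Proof. by move=> x; apply: mproj_inj => n; apply: add0r. Qed.
Let addN : left_inverse zero opp add.
Proof. by move=> x; apply: mproj_inj => n; apply: addNr. Qed.
HB.instance Definition _ := GRing.isZmodule.Build lim_mod addA addC add0 addN.
Let scaleA a b v : scale a (scale b v) = scale (a * b) v.
Proof. by apply: mproj_inj => n; apply: scalerA. Qed.
Let scale1 : left_id 1 scale.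
Proof. by move=> v; apply: mproj_inj => n; apply: scale1r. Qed.
Let scaleDr : right_distributive scale +%R.
Proof. by move=> a u v; apply: mproj_inj => n; apply: scalerDr. Qed.
Let scaleDl v : {morph scale^~ v : a b / a + b}.
Proof. by move=> a b; apply: mproj_inj => n; apply: scalerDl. Qed.
HB.instance Definition _ :=
  GRing.Zmodule_isLmodule.Build (lim_ring T) lim_mod scaleA scale1 scaleDr scaleDl.

Lemma mprojS n : semilinear (@rproj T n) (mproj n). Proof. by []. Qed.
End Module.
End InverseLimit.
Section DividedPowers.

Definition is_ideal (B : comPzRingType) (I : B -> Prop) :=
  [/\ I 0, forall x y, I x -> I y -> I (x + y) & forall b x, I x -> I (b * x)].

(* The divided power operations are total functions, meaningful on [I] only. *)
Record is_pd (B : comPzRingType) (I : B -> Prop) (delta : nat -> B -> B) := IsPD {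
  pd_isideal : is_ideal I;
  pd_stable : forall n x, I x -> (0 < n)%N -> I (delta n x);
  pd_0 : forall x, I x -> delta 0%N x = 1;
  pd_1 : forall x, I x -> delta 1%N x = x;
  pd_D : forall n x y, I x -> I y ->
    delta n (x + y) = \sum_(i < n.+1) delta i x * delta (n - i)%N y;
  pd_Z : forall n b x, I x -> delta n (b * x) = b ^+ n * delta n x;
  pd_M : forall m n x, I x ->
    delta m x * delta n x = 'C(m + n, m)%:R * delta (m + n)%N x;
  pd_comp : forall m n x, I x -> (0 < m)%N ->
    delta n (delta m x) =
      ((n * m)`! %/ (n`! * m`! ^ n))%:R * delta (n * m)%N x }.

Record pdring := PDRing {
  pd_ring :> comPzRingType;
  pd_ideal : pd_ring -> Prop;
  pd_pow : nat -> pd_ring -> pd_ring;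
  pd_ax : is_pd pd_ideal pd_pow }.

Definition pd_morph (B C : pdring) (h : B -> C) :=
  forall x : B, pd_ideal x ->
    pd_ideal (h x) /\ forall n, h (pd_pow n x) = pd_pow n (h x).

Definition pd_prod (B : comPzRingType) (delta : nat -> B -> B) (s : seq (nat * B)) :=
  \prod_(p <- s) delta p.1 p.2.

(* The ideal $K^{[n]}$. *)
Definition pd_power (B : comPzRingType) (K : B -> Prop) (delta : nat -> B -> B)
    (n : nat) : B -> Prop :=
  ideal_gen (fun y => exists s : seq (nat * B),
    [/\ forall p, p \in s -> K p.2, (n <= \sum_(p <- s) p.1)%N
      & y = pd_prod delta s]).

Definition ext_ideal (A : pdring) (B : comPzRingType) (iB : A -> B) : B -> Prop :=
  ideal_gen (fun y => exists2 a, pd_ideal a & y = iB a).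

Definition pd_extends (A : pdring) (B : comPzRingType) (iB : A -> B)
    (eps : nat -> B -> B) :=
  forall n a, pd_ideal a -> eps n (iB a) = iB (pd_pow n a).

Definition pd_extends_to (A : pdring) (B : comPzRingType) (iB : A -> B) :=
  exists2 eps, is_pd (ext_ideal iB) eps & pd_extends iB eps.

Definition pd_compatible (A B : pdring) (iB : A -> B) :=
  exists eps, [/\
    is_pd (ideal_gen (fun y => pd_ideal y \/ ext_ideal iB y)) eps,
    (forall n x, pd_ideal x -> eps n x = pd_pow n x) & pd_extends iB eps].

Definition is_pd_envelope (A : pdring) (C : comPzRingType) (iC : {rmorphism A -> C})
    (K : C -> Prop) (D : pdring) (iD : {rmorphism C -> D}) :=
  [/\ forall x, K x -> pd_ideal (iD x), pd_compatible (iD \o iC)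
    & forall (E : pdring) (g : {rmorphism C -> E}),
        (forall x, K x -> pd_ideal (g x)) -> pd_compatible (g \o iC) ->
        exists h : {rmorphism D -> E},
          [/\ pd_morph h, h \o iD =1 g
            & forall h' : {rmorphism D -> E},
                pd_morph h' -> h' \o iD =1 g -> h' =1 h]].

End DividedPowers.

Section Algebras.

(* The polynomial algebra on [X], characterised by its universal property (the
   library's polynomials require a nonzero coefficient ring). *)
Definition is_poly_alg (A T : comPzRingType) (iT : {rmorphism A -> T})
    (n : nat) (X : 'I_n -> T) :=
  forall (B : comPzRingType) (iB : {rmorphism A -> B}) (x : 'I_n -> B),
    exists g : {rmorphism T -> B},
      [/\ g \o iT =1 iB, forall i, g (X i) = x i
        & forall g' : {rmorphism T -> B},
            g' \o iT =1 iB -> (forall i, g' (X i) = x i) -> g' =1 g].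

Definition surjective (U V : Type) (f : U -> V) := forall y, exists x, f x = y.

Definition finite_type (A B : comPzRingType) (iB : {rmorphism A -> B}) :=
  exists (n : nat) (T : comPzRingType) (iT : {rmorphism A -> T}) (X : 'I_n -> T)
    (g : {rmorphism T -> B}),
    [/\ is_poly_alg iT X, g \o iT =1 iB & surjective g].

Definition finitely_presented (A B : comPzRingType) (iB : {rmorphism A -> B}) :=
  exists (n : nat) (T : comPzRingType) (iT : {rmorphism A -> T}) (X : 'I_n -> T)
    (g : {rmorphism T -> B}),
    [/\ is_poly_alg iT X, g \o iT =1 iB, surjective g
      & exists s : seq T, forall x, g x = 0 <-> ideal_gen (fun y => y \in s) x].

Definition square_zero_ext (E E' : comPzRingType) (p : E -> E') :=
  surjective p /\ forall x y, p x = 0 -> p y = 0 -> x * y = 0.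

Definition formally_smooth (A B : comPzRingType) (iB : {rmorphism A -> B}) :=
  forall (E E' : comPzRingType) (p : {rmorphism E -> E'}), square_zero_ext p ->
  forall (iE : {rmorphism A -> E}) (g : {rmorphism B -> E'}),
    g \o iB =1 p \o iE ->
    exists h : {rmorphism B -> E}, h \o iB =1 iE /\ p \o h =1 g.

Definition formally_unramified (A B : comPzRingType) (iB : {rmorphism A -> B}) :=
  forall (E E' : comPzRingType) (p : {rmorphism E -> E'}), square_zero_ext p ->
  forall h h' : {rmorphism B -> E},
    h \o iB =1 h' \o iB -> p \o h =1 p \o h' -> h =1 h'.

Definition smooth (A B : comPzRingType) (iB : {rmorphism A -> B}) :=
  finitely_presented iB /\ formally_smooth iB.

Definition etale (A B : comPzRingType) (iB : {rmorphism A -> B}) :=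
  smooth iB /\ formally_unramified iB.

End Algebras.

Section PDPowerTheory.
Variable D : pdring.
Local Notation J := (@pd_ideal D).
Local Notation gam := (@pd_pow D).
Local Notation Jn := (pd_power J gam).
Let ax := pd_ax D.
Let J0 : J 0 := let: And3 h _ _ := pd_isideal ax in h.
Let JD x y : J x -> J y -> J (x + y).
Proof. by case: (pd_isideal ax) => _ h _; apply: h. Qed.
Let JM b x : J x -> J (b * x).
Proof. by case: (pd_isideal ax) => _ _; apply. Qed.

Lemma ideal_genM (B : comPzRingType) (S : B -> Prop) b x :
  ideal_gen S x -> ideal_gen S (b * x).
Proof. exact: (@spanZ _ B^o). Qed.

Lemma ideal_genMn (B : comPzRingType) (S : B -> Prop) n x :
  ideal_gen S x -> ideal_gen S (x *+ n).
Proof. by move=> Sx; rewrite -mulr_natl; apply: ideal_genM. Qed.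

Lemma pd_prodS s : pd_prod gam s = if s is p :: t then gam p.1 p.2 * pd_prod gam t else 1.
Proof. by case: s => [|p t]; rewrite /pd_prod ?big_nil // big_cons. Qed.

Lemma pd_prod_power n s : (forall p, p \in s -> J p.2) ->
  (n <= \sum_(p <- s) p.1)%N -> Jn n (pd_prod gam s).
Proof. by move=> Js le_ns; apply: span_gen; exists s. Qed.

Lemma pd_power_le m n x : (m <= n)%N -> Jn n x -> Jn m x.
Proof.
move=> le_mn; elim=> [y [s [Js le_ns ->]]||y z _ Iy _ Iz|b y _ Iy].
- by apply: pd_prod_power => //; apply: leq_trans le_ns.
- exact: span0.
- exact: spanD.
- exact: spanZ.
Qed.

Lemma pd_power_mul i m x y : J x -> Jn m y -> Jn (i + m) (gam i x * y).
Proof.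
move=> Jx; elim=> [z [s [Js le_ns ->]]||z t _ Iz _ It|b z _ Iz].
- have := pd_prodS ((i, x) :: s) => /= <-; apply: pd_prod_power => [p|].
    by rewrite inE => /predU1P[->|/Js].
  by rewrite big_cons leq_add2l.
- by rewrite mulr0; apply: span0.
- by rewrite mulrDr; apply: spanD.
- by rewrite [b *: z]/(b * z) mulrCA; apply: ideal_genM.
Qed.

Lemma pd_power_sub n x : (0 < n)%N -> Jn n x -> J x.
Proof.
move=> n_gt0; elim=> [_ [s [Js le_ns ->]]||y z _ Iy _ Iz|b y _ Iy]; first 1 last.
- exact: J0.
- exact: JD.
- exact: JM.
have {le_ns n_gt0} := leq_trans n_gt0 le_ns.
elim: s Js => [|[i y] s IH] Js; rewrite ?big_nil // big_cons pd_prodS /=.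
have Jy : J y by apply: (Js (i, y)); rewrite inE eqxx.
have Js' p : p \in s -> J p.2 by move=> sp; apply: Js; rewrite inE sp orbT.
move: {Js} i => [|i] /= i_gt0; first by rewrite (pd_0 ax) // mul1r; apply: IH.
by rewrite mulrC; apply: JM; apply: (pd_stable ax).
Qed.

Lemma pd_pow_0 k : (0 < k)%N -> gam k 0 = 0.
Proof.
by move=> k0; have := pd_Z ax k 0 J0; rewrite mul0r expr0n gtn_eqF // mul0r.
Qed.

Lemma pd_power_stable n k x : (0 < n)%N -> (0 < k)%N -> Jn n x -> Jn n (gam k x).
Proof.
move=> n0 k0 Ix; move: k k0.
elim: Ix => [_ [s [Js le_ns ->]]||y z Iy IHy Iz IHz|b y Iy IHy] k k0.
- elim: s Js n n0 le_ns => [|[i y] s IH] Js n n0; rewrite ?big_nil ?big_cons.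
    by rewrite leqn0 => /eqP n00; rewrite n00 in n0.
  move=> /= le_ns; rewrite pd_prodS /=.
  have Jy : J y by apply: (Js (i, y)); rewrite inE eqxx.
  have Js' p : p \in s -> J p.2 by move=> sp; apply: Js; rewrite inE sp orbT.
  move: le_ns {Js}; case: i => [|i] le_ns; first by rewrite (pd_0 ax) // mul1r; apply: IH.
  rewrite mulrC (pd_Z ax) ?(pd_comp ax) //; last exact: (pd_stable ax).
  case: k k0 {IH} => // k _; rewrite exprSr -!mulrA; apply: ideal_genM.
  rewrite mulrCA; apply: ideal_genM; rewrite mulrC.
  apply: (pd_power_le le_ns); apply: (@pd_power_le _ (k.+1 * i.+1 + \sum_(p <- s) p.1)).
    by rewrite leq_add2r mulSn leq_addr.
  by apply: pd_power_mul => //; apply: pd_prod_power.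
- by rewrite pd_pow_0 //; apply: span0.
- have Jy : J y by apply: pd_power_sub Iy.
  have Jz : J z by apply: pd_power_sub Iz.
  rewrite (pd_D ax) //; apply: big_ind => [||i _]; [exact: span0|by move=> u v; apply: spanD|].
  case: i => -[|i] lt_ik /=.
    by rewrite subn0; apply: ideal_genM; apply: IHz.
  by rewrite mulrC; apply: ideal_genM; apply: IHy.
- have Jy : J y by apply: pd_power_sub Iy.
  by rewrite [b *: y]/(b * y) (pd_Z ax) //; apply: ideal_genM; apply: IHy.
Qed.

(* The ideal $n! J^{[n]}$ and the ring $D_n$ are [npd n] and [qring (npd n)]. *)
Definition npd (n : nat) : D -> Prop := fun y => exists2 x, Jn n x & y = x *+ n`!.

Lemma npdP n y : ideal_gen (npd n) y <-> npd n y.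
Proof.
split=> [|ny]; last exact: span_gen.
elim=> [z //||u v _ [x Ix ->] _ [z Iz ->]|b v _ [x Ix ->]].
- by exists 0; [exact: span0 | rewrite mul0rn].
- by exists (x + z); [exact: spanD | rewrite mulrnDl].
- by exists (b * x); [exact: ideal_genM | exact: mulrnAr].
Qed.

Lemma npdS n y : npd n.+1 y -> npd n y.
Proof.
case=> x Ix ->; exists (x *+ n.+1); last by rewrite -mulrnA factS.
by apply: ideal_genMn; apply: pd_power_le Ix.
Qed.

Lemma npd_sub n y : npd n.+1 y -> J y.
Proof. by case=> x /pd_power_sub Jx ->; rewrite -mulr_natl; apply/JM/Jx. Qed.

Lemma npd_stable n k y : (0 < k)%N -> npd n.+1 y -> npd n.+1 (gam k y).
Proof.
move=> k0 [x Ix ->]; have Jx := pd_power_sub (ltn0Sn n) Ix.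
rewrite -mulr_natl (pd_Z ax) //; case: k k0 => // k _.
exists ((n.+1)`!%:R ^+ k * gam k.+1 x).
  by apply: ideal_genM; apply: pd_power_stable.
by rewrite exprS -mulrA mulr_natl.
Qed.
End PDPowerTheory.
Arguments npd D n _ : clear implicits.

Section PDQuotient.
Variables (D : pdring) (n : nat).
Local Notation J := (@pd_ideal D).
Local Notation gam := (@pd_pow D).
Local Notation Dn := (qring (npd D n.+1)).
Local Notation pi := (qpi (npd D n.+1)).
Let ax := pd_ax D.

(* The divided powers induced by [D] on the image of its ideal in the quotient
   of [D] by $(n+1)! J^{[n+1]}$ ; they do not depend on the chosen lifts. *)
Definition qpd_ideal : Dn -> Prop := fun y => exists2 x, J x & y = pi x.
Definition qpd_pow (k : nat) (y : Dn) : Dn :=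
  if pselect (qpd_ideal y) is left h then pi (gam k (s2val (cid2 h))) else 0.

Lemma qpd_powE k x : J x -> qpd_pow k (pi x) = pi (gam k x).
Proof.
move=> Jx; rewrite /qpd_pow; case: pselect => [h|[]]; last by exists x.
case: (cid2 h) => /= z Jz; rewrite qpiP npdP => npd_xz.
have -> : x = z + (x - z) by rewrite addrCA subrr addr0.
rewrite (pd_D ax) //; last exact: npd_sub npd_xz.
rewrite big_ord_recr /= subnn (pd_0 ax) ?mulr1; last exact: npd_sub npd_xz.
rewrite -[LHS]add0r rmorphD /=; congr (_ + _); rewrite rmorph_sum /=.
rewrite big1 // => i _; rewrite -(rmorph0 (qpi (npd D n.+1))); apply/qpiP.
rewrite subr0; apply: ideal_genM; apply/npdP; apply: npd_stable => //.
by rewrite subn_gt0.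
Qed.

Lemma qpd_is_pd : is_pd qpd_ideal qpd_pow.
Proof.
case: (pd_isideal ax) => J0 JD JM; split.
- split=> [|_ _ [x Jx ->] [y Jy ->]|b _ [x Jx ->]].
  + by exists 0; rewrite ?rmorph0.
  + by exists (x + y); [exact: JD | rewrite rmorphD].
  + have [c ->] := qpi_surj b.
    by exists (c * x); [exact: JM | rewrite rmorphM].
- move=> k _ [x Jx ->] k0; rewrite qpd_powE //.
  by exists (gam k x) => //; apply: (pd_stable ax).
- by move=> _ [x Jx ->]; rewrite qpd_powE // (pd_0 ax) ?rmorph1.
- by move=> _ [x Jx ->]; rewrite qpd_powE // (pd_1 ax).
- move=> k _ _ [x Jx ->] [y Jy ->]; rewrite -rmorphD qpd_powE; last exact: JD.
  rewrite (pd_D ax) // rmorph_sum; apply: eq_bigr => i _.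
  by rewrite !qpd_powE // rmorphM.
- move=> k b _ [x Jx ->]; have [c ->] := qpi_surj b.
  rewrite -rmorphM !qpd_powE //; last exact: JM.
  by rewrite (pd_Z ax) // rmorphM rmorphXn.
- move=> k l _ [x Jx ->]; rewrite !qpd_powE // -rmorphM (pd_M ax) //.
  by rewrite rmorphM rmorph_nat.
- move=> k l _ [x Jx ->] k0; rewrite !qpd_powE //; last exact: (pd_stable ax).
  by rewrite (pd_comp ax) // rmorphM rmorph_nat.
Qed.

Definition qpd : pdring := PDRing qpd_is_pd.
End PDQuotient.
Section Differentials.
Variables (A : comPzRingType) (B : pdring) (iB : A -> B).

Inductive omega_rel : seq (B * B) -> Prop :=
| omega_relD x y : omega_rel [:: (1, x + y); (- 1, x); (- 1, y)]
| omega_relM x y : omega_rel [:: (1, x * y); (- x, y); (- y, x)]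
| omega_relA a : omega_rel [:: (1, iB a)]
| omega_rel_pd n x : pd_ideal x ->
    omega_rel [:: (1, pd_pow n.+1 x); (- pd_pow n x, x)].

Definition omega := pres omega_rel.
HB.instance Definition _ := GRing.Lmodule.on omega.
Definition du (x : B) : omega := pgen omega_rel x.

Lemma duD x y : du (x + y) = du x + du y.
Proof.
have := pres_relE (omega_relD x y).
by rewrite !big_cons big_nil /= scale1r !scaleN1r addr0 -opprD => /subr0_eq.
Qed.
Lemma duM x y : du (x * y) = x *: du y + y *: du x.
Proof.
have := pres_relE (omega_relM x y).
by rewrite !big_cons big_nil /= scale1r !scaleNr addr0 -opprD => /subr0_eq.
Qed.
Lemma duA a : du (iB a) = 0.
Proof.
have := pres_relE (omega_relA a).
by rewrite !big_cons big_nil /= scale1r addr0.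
Qed.
Lemma du_pd n x : pd_ideal x -> du (pd_pow n.+1 x) = pd_pow n x *: du x.
Proof.
move=> /(omega_rel_pd n)/pres_relE.
by rewrite !big_cons big_nil /= scale1r scaleNr addr0 => /subr0_eq.
Qed.
Lemma du1 : du 1 = 0.
Proof.
have := duM 1 1; rewrite mulr1 !scale1r => /(congr1 (fun z => z - du 1)).
by rewrite subrr addrK.
Qed.

(* The exterior differential, $b\,dx \mapsto db \wedge dx$. *)
Definition du1_map : omega -> ext2 omega :=
  plift (rel := omega_rel) (fun b x => wedge (du b) (du x)).

Let hD b c x : wedge (du (b + c)) (du x) = wedge (du b) (du x) + wedge (du c) (du x).
Proof. by rewrite duD wedgeDl. Qed.
Let wN v w : wedge (- v) w = - wedge v w :> ext2 omega.
Proof. by rewrite -scaleN1r wedgeZl scaleN1r. Qed.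
Let wC v w : wedge v w = - wedge w v :> ext2 omega.
Proof.
apply/eqP; rewrite -addr_eq0; apply/eqP.
by have := wedge_alt (v + w); rewrite wedgeDl !wedgeDr !wedge_alt add0r addr0.
Qed.
Let duN x : du (- x) = - du x. Proof. exact: (additive_mapN _ duD). Qed.
Let hrel b s : omega_rel s ->
  \sum_(p <- s) wedge (du (b * p.1)) (du p.2) = 0.
Proof.
case=> [x y|x y|a|n x Ix]; rewrite !big_cons big_nil /= addr0 ?mulr1 ?mulrN ?mulr1 ?duN ?wN.
- by rewrite duD wedgeDr -opprD subrr.
- rewrite !duM !wedgeDl !wedgeDr !wedgeZl !wedgeZr (wC (du y) (du x)) scalerN.
  by rewrite -opprD addrACA subrr add0r subrr.
- by rewrite duA -(scale0r (0 : omega)) wedgeZr scale0r.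
- rewrite du_pd // duM wedgeDl !wedgeZl !wedgeZr opprD addrCA subrr addr0.
  case: n => [|n]; last by rewrite du_pd // wedgeZl wedge_alt !scaler0 oppr0.
  rewrite (pd_0 (pd_ax B)) // du1 -(scale0r (0 : omega)) wedgeZl.
  by rewrite scale0r scaler0 oppr0.
Qed.

Lemma du1_mapD : additive_map du1_map. Proof. exact: pliftD hD hrel. Qed.
Lemma du1_map_gen b x : du1_map (b *: du x) = wedge (du b) (du x).
Proof. exact: (plift_gen hD hrel). Qed.
Lemma du1_mapZ b w : du1_map (b *: w) = wedge (du b) w + b *: du1_map w.
Proof.
elim/pres_ind: w => [|u v IHu IHv|c x].
- rewrite scaler0 (additive_map0 du1_mapD) scaler0.
  by rewrite -[X in wedge _ X](scale0r (0 : omega)) wedgeZr scale0r addr0.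
- by rewrite scalerDr !du1_mapD IHu IHv wedgeDr scalerDr addrACA.
- rewrite scalerA !du1_map_gen duM wedgeDl !wedgeZl wedgeZr addrC.
  by [].
Qed.
End Differentials.

Section DifferentialsMap.
Variables (A : comPzRingType) (B C : pdring) (iB : A -> B) (iC : A -> C).
Variable h : {rmorphism B -> C}.

Definition omega_map : omega iB -> omega iC :=
  plift (rel := omega_rel iB) (fun b x => h b *: du iC (h x)).

Hypotheses (hA : h \o iB =1 iC) (hpd : pd_morph h).

Let hD b c x : h (b + c) *: du iC (h x) = h b *: du iC (h x) + h c *: du iC (h x).
Proof. by rewrite rmorphD scalerDl. Qed.
Let hrel b s : omega_rel iB s ->
  \sum_(p <- s) h (b * p.1) *: du iC (h p.2) = 0.
Proof.
move=> rs.
suff E : \sum_(p <- s) h p.1 *: du iC (h p.2) = 0.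
  have := congr1 (fun z => h b *: z) E; rewrite scaler0 scaler_sumr; apply: etrans.
  by apply: eq_bigr => p _; rewrite rmorphM scalerA.
case: rs => [x y|x y|a|n x Ix]; rewrite !big_cons big_nil /= addr0 ?rmorphN ?rmorph1 scale1r.
- by rewrite !scaleN1r rmorphD duD -opprD subrr.
- by rewrite !scaleNr rmorphM duM -opprD subrr.
- by rewrite [h _]hA duA.
- have [Ihx hp] := hpd Ix.
  by rewrite !hp du_pd // scaleNr subrr.
Qed.

Lemma omega_mapD : additive_map omega_map. Proof. exact: pliftD hD hrel. Qed.
Lemma omega_map_du x : omega_map (du iB x) = du iC (h x).
Proof.
rewrite -[du iB x]scale1r [LHS](plift_gen hD hrel).
by rewrite rmorph1 scale1r.
Qed.
Lemma omega_mapS : semilinear h omega_map.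
Proof.
split=> [|b]; first exact: omega_mapD.
elim/pres_ind => [|u v IHu IHv|c x].
- by rewrite scaler0 (additive_map0 omega_mapD) scaler0.
- by rewrite scalerDr !omega_mapD IHu IHv scalerDr.
- by rewrite scalerA /omega_map !(plift_gen hD hrel) rmorphM scalerA.
Qed.
End DifferentialsMap.
Arguments omega_map {A B C} iB iC h _.

Section QuotientMap.
Variables (B C : comPzRingType) (U : lmodType B) (W : lmodType C).
Variables (S : U -> Prop) (S' : W -> Prop) (f : U -> W).

Definition zquot_map (x : zquot S) : zquot S' := zpi S' (f (zrepr x)).

Lemma zquot_mapE u : additive_map f ->
  (forall v, span S v -> span S' (f v)) -> zquot_map (zpi S u) = zpi S' (f u).
Proof.
move=> fD fS; apply/zpiP; rewrite -(additive_mapN _ fD) -fD.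
exact/fS/zpi_repr.
Qed.
End QuotientMap.

Section Completion.
Variables (A : comPzRingType) (D : pdring) (iD : {rmorphism A -> D}).
Local Notation J := (@pd_ideal D).
Local Notation nJ := (npd D).
Local Notation Om1 := (omega iD).
Local Notation Om2 := (ext2 Om1).

(* Level [k] of the towers below is the quotient by $(k+1)! J^{[k+1]}$. *)
Definition Dlev (k : nat) := qpd D k.
Definition iDlev (k : nat) : A -> Dlev k := fun a => qpi (nJ k.+1) (iD a).

Lemma nJ_span n y : ideal_gen (nJ n.+1) y -> ideal_gen (nJ n) y.
Proof. by move=> /npdP/npdS ny; apply: span_gen. Qed.

Definition Dtr (k : nat) : Dlev k.+1 -> Dlev k :=
  @zquot_map D D D^o D^o (nJ k.+2) (nJ k.+1) id.

Lemma Dtr_pi k b : Dtr (qpi (nJ k.+2) b) = qpi (nJ k.+1) b.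
Proof. exact: (@zquot_mapE D D D^o D^o _ _ id _ _ (@nJ_span k.+1)). Qed.

Fact Dtr_zmod k : zmod_morphism (@Dtr k).
Proof.
move=> x y; have [a ->] := qpi_surj x; have [b ->] := qpi_surj y.
by rewrite -rmorphB !Dtr_pi rmorphB.
Qed.
Fact Dtr_monoid k : monoid_morphism (@Dtr k).
Proof.
split=> [|x y]; first by rewrite -(rmorph1 (qpi (nJ k.+2))) Dtr_pi rmorph1.
have [a ->] := qpi_surj x; have [b ->] := qpi_surj y.
by rewrite -rmorphM !Dtr_pi rmorphM.
Qed.
HB.instance Definition _ k :=
  GRing.isZmodMorphism.Build (Dlev k.+1) (Dlev k) (@Dtr k) (@Dtr_zmod k).
HB.instance Definition _ k :=
  GRing.isMonoidMorphism.Build (Dlev k.+1) (Dlev k) (@Dtr k) (@Dtr_monoid k).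

Definition Dtower := RingTower (fun k => @Dtr k : {rmorphism _ -> _}).
Definition Dhat := lim_ring Dtower.
HB.instance Definition _ := GRing.ComPzRing.on Dhat.

Definition to_Dhat (b : D) : Dhat :=
  @mk_lim_ring Dtower (fun k => qpi (nJ k.+1) b) (fun k => Dtr_pi k b).
Fact to_Dhat_zmod : zmod_morphism to_Dhat.
Proof. by move=> x y; apply: rproj_inj => k; apply: (rmorphB (qpi (nJ k.+1))). Qed.
Fact to_Dhat_monoid : monoid_morphism to_Dhat.
Proof.
split=> [|x y]; first exact: rproj_inj.
by apply: rproj_inj => k; apply: (rmorphM (qpi (nJ k.+1))).
Qed.
HB.instance Definition _ := GRing.isZmodMorphism.Build D Dhat to_Dhat to_Dhat_zmod.
HB.instance Definition _ := GRing.isMonoidMorphism.Build D Dhat to_Dhat to_Dhat_monoid.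

(* For a [D]-module [V], the tower of the quotients of [V] by
   $(k+1)! J^{[k+1]} V$. *)
Section ModTower.
Variable V : lmodType D.
Local Notation Vn n := (qmod (nJ n) V).
Lemma smul_nJS n v : span (smul_set (nJ n.+1) (V := V)) v ->
  span (smul_set (nJ n) (V := V)) v.
Proof.
elim=> [_ [b [w [nb ->]]]||u w _ IHu _ IHw|b w _ IH].
- by apply: span_gen; exists b, w; split=> //; apply: npdS.
- exact: span0.
- exact: spanD.
- exact: spanZ.
Qed.
Definition Vtr (k : nat) : Vn k.+2 -> Vn k.+1 := zquot_map _ id.
Lemma Vtr_pi k v : @Vtr k (mpi (nJ k.+2) v) = mpi (nJ k.+1) v.
Proof. exact: (zquot_mapE (f := id) _ _ (@smul_nJS k.+1)). Qed.
Lemma VtrS k : semilinear (@Dtr k) (@Vtr k).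
Proof.
split=> [x y|a x]; have [u ->] := mpi_surj x.
  by have [v ->] := mpi_surj y; rewrite -mpiD !Vtr_pi mpiD.
by have [b ->] := qpi_surj a; rewrite -mpiZ !Vtr_pi Dtr_pi mpiZ.
Qed.
Definition Vtower : mod_tower Dtower := @ModTower Dtower (fun k => Vn k.+1) Vtr VtrS.
End ModTower.

Definition OmHat1 := lim_mod (Vtower Om1).
Definition OmHat2 := lim_mod (Vtower Om2).
HB.instance Definition _ := GRing.Lmodule.on OmHat1.
HB.instance Definition _ := GRing.Lmodule.on OmHat2.

Let Jn n := pd_power J (@pd_pow D) n.
Local Notation sm S := (span (smul_set S (V := Om1))).
Local Notation sm2 S := (span (smul_set S (V := Om2))).

Let sm_mul (S T : D -> Prop) b v : (forall x, S x -> T (b * x)) -> sm S v -> sm T (b *: v).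
Proof.
move=> ST; elim=> [_ [c [w [Sc ->]]]||u w _ IHu _ IHw|c w _ IH].
- by apply: span_gen; exists (b * c), w; rewrite scalerA; split=> //; apply: ST.
- by rewrite scaler0; apply: span0.
- by rewrite scalerDr; apply: spanD.
- by rewrite scalerA mulrC -scalerA; apply: spanZ.
Qed.

Let du_prod s m : (forall p, p \in s -> J p.2) -> (m <= (\sum_(p <- s) p.1).-1)%N ->
  sm (Jn m) (du iD (pd_prod (@pd_pow D) s)).
Proof.
elim: s m => [|[i x] s IH] m Js; rewrite pd_prodS ?big_nil ?big_cons /=.
  by move=> _; rewrite du1; apply: span0.
move=> le_m.
have Jx : J x by apply: (Js (i, x)); rewrite inE eqxx.
have Js' p : p \in s -> J p.2 by move=> sp; apply: Js; rewrite inE sp orbT.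
have IH' := IH _ Js' (leqnn _).
rewrite duM; apply: spanD.
  apply: (sm_mul (S := Jn (\sum_(p <- s) p.1).-1)) => // y Jy.
  apply: (@pd_power_le _ _ (i + (\sum_(p <- s) p.1).-1)).
    by apply: leq_trans le_m _; case: (\sum_(p <- s) p.1)%N => [|k]; rewrite ?addn0 ?leq_pred // addnS.
  exact: pd_power_mul.
case: i le_m {Js} => [|i] le_m.
  by rewrite (pd_0 (pd_ax D)) // du1 scaler0; apply: span0.
rewrite du_pd // scalerA; apply: span_gen; exists (pd_prod (@pd_pow D) s * pd_pow i x), (du iD x).
split=> //; rewrite mulrC; apply: (pd_power_le (n := i + \sum_(p <- s) p.1)) => //.
by apply: pd_power_mul => //; apply: pd_prod_power.
Qed.

Let du_Jn n y : Jn n.+1 y -> sm (Jn n) (du iD y).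
Proof.
elim=> [_ [s [Js le_ns ->]]||u v _ IHu _ IHv|b v Iv IHv].
- by apply: du_prod => //; rewrite -ltnS (leq_trans le_ns) // leqSpred.
- by rewrite (additive_map0 (duD iD)); apply: span0.
- by rewrite duD; apply: spanD.
- rewrite [b *: v]/(b * v) duM; apply: spanD; first exact: spanZ.
  by apply: span_gen; exists v, (du iD b); split=> //; apply: pd_power_le Iv.
Qed.

Lemma du_nJ n y : ideal_gen (nJ n.+1) y -> sm (nJ n) (du iD y).
Proof.
move=> /npdP [x Ix ->].
have -> : du iD (x *+ (n.+1)`!) = (n.+1)`!%:R *: du iD x.
  by elim: _`! => [|m IH]; rewrite ?scale0r ?(additive_map0 (duD iD)) // mulrS duD IH
    mulrS scalerDl scale1r.
apply: sm_mul (du_Jn Ix) => z Iz; exists (z *+ n.+1); first exact: ideal_genMn.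
by rewrite mulr_natl -mulrnA factS.
Qed.

Let span_sm2 n v : ideal_gen (nJ n) v -> forall w, sm2 (nJ n) (v *: w).
Proof. by move=> nv w; apply: span_smul. Qed.

Let wedge_sm n v w : sm (nJ n) v -> sm2 (nJ n) (wedge v w).
Proof.
elim=> [_ [c [u [Sc ->]]]||u u' _ IHu _ IHu'|c u _ IH].
- by rewrite wedgeZl; apply: span_sm2; apply: span_gen.
- by rewrite -(scale0r (0 : Om1)) wedgeZl scale0r; apply: span0.
- by rewrite wedgeDl; apply: spanD.
- by rewrite wedgeZl; apply: spanZ.
Qed.
Let wedge_sm' n v w : sm (nJ n) v -> sm2 (nJ n) (wedge w v).
Proof.
elim=> [_ [c [u [Sc ->]]]||u u' _ IHu _ IHu'|c u _ IH].
- by rewrite wedgeZr; apply: span_sm2; apply: span_gen.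
- by rewrite -[X in wedge _ X](scale0r (0 : Om1)) wedgeZr scale0r; apply: span0.
- by rewrite wedgeDr; apply: spanD.
- by rewrite wedgeZr; apply: spanZ.
Qed.

Lemma du1_nJ n v : sm (nJ n.+1) v -> sm2 (nJ n) (du1_map v).
Proof.
elim=> [_ [c [u [Sc ->]]]||u u' _ IHu _ IHu'|c u Iu IH].
- rewrite du1_mapZ; apply: spanD.
    by apply/wedge_sm/du_nJ/span_gen.
  by apply/span_sm2/span_gen/npdS.
- by rewrite (additive_map0 (@du1_mapD _ _ _)); apply: span0.
- by rewrite du1_mapD; apply: spanD.
- rewrite du1_mapZ; apply: spanD; last exact: spanZ.
  by apply: wedge_sm'; apply: smul_nJS.
Qed.

Definition dlev (k : nat) : Dlev k.+1 -> qmod (nJ k.+1) Om1 :=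
  @zquot_map D D D^o Om1 (nJ k.+2) (smul_set (nJ k.+1) (V := Om1)) (du iD).
Lemma dlev_pi k b : @dlev k (qpi (nJ k.+2) b) = mpi (nJ k.+1) (du iD b).
Proof. exact: (@zquot_mapE D D D^o Om1 _ _ _ _ (duD iD) (@du_nJ k.+1)). Qed.

Definition d1lev (k : nat) : qmod (nJ k.+2) Om1 -> qmod (nJ k.+1) Om2 :=
  zquot_map _ (@du1_map _ _ iD).
Lemma d1lev_pi k w : @d1lev k (mpi (nJ k.+2) w) = mpi (nJ k.+1) (du1_map w).
Proof. exact: (zquot_mapE _ (@du1_mapD _ _ _) (@du1_nJ k.+1)). Qed.

Lemma dhat_subproof (f : Dhat) k :
  mt_map (Vtower Om1) k (dlev (rproj k.+2 f)) = dlev (rproj k.+1 f).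
Proof.
rewrite -(rproj_map k.+1 f); have [b ->] := qpi_surj (rproj k.+2 f).
by rewrite /= Dtr_pi !dlev_pi Vtr_pi.
Qed.
(* The derivation of the completion; a lift to level [k + 1] determines its
   value at level [k]. *)
Definition dhat (f : Dhat) : OmHat1 := mk_lim_mod (dhat_subproof f).

Lemma dhat1_subproof (w : OmHat1) k :
  mt_map (Vtower Om2) k (d1lev (mproj k.+2 w)) = d1lev (mproj k.+1 w).
Proof.
rewrite -(mproj_map k.+1 w); have [b ->] := mpi_surj (mproj k.+2 w).
by rewrite /= Vtr_pi !d1lev_pi Vtr_pi.
Qed.
Definition dhat1 (w : OmHat1) : OmHat2 := mk_lim_mod (dhat1_subproof w).

Definition wedge_lev n (v w : qmod (nJ n) Om1) : qmod (nJ n) Om2 :=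
  mpi (nJ n) (wedge (mrepr v) (mrepr w)).
Lemma wedge_lev_pi n v w :
  wedge_lev (mpi (nJ n) v) (mpi (nJ n) w) = mpi (nJ n) (wedge v w).
Proof.
apply/mpiP; set v' := mrepr _; set w' := mrepr _.
have -> : wedge v' w' - wedge v w = wedge (v' - v) w' + wedge v (w' - w).
  rewrite wedgeDl wedgeDr -!(scaleN1r v) -!(scaleN1r w) wedgeZl wedgeZr !scaleN1r.
  by rewrite addrA subrK.
apply: spanD; [apply: wedge_sm|apply: wedge_sm']; apply/mpiP; rewrite mreprK //.
Qed.
Lemma hwedge_subproof (v w : OmHat1) k :
  mt_map (Vtower Om2) k (wedge_lev (mproj k.+1 v) (mproj k.+1 w))
  = wedge_lev (mproj k v) (mproj k w).
Proof.
rewrite -(mproj_map k v) -(mproj_map k w).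
have [a ->] := mpi_surj (mproj k.+1 v); have [b ->] := mpi_surj (mproj k.+1 w).
by rewrite wedge_lev_pi ![mt_map _ _ _]Vtr_pi wedge_lev_pi.
Qed.
Definition hwedge (v w : OmHat1) : OmHat2 := mk_lim_mod (hwedge_subproof v w).

Definition OmLev (k : nat) := omega (@iDlev k).
HB.instance Definition _ k := GRing.Lmodule.on (OmLev k).

Definition OmLev_tr (k : nat) : OmLev k.+1 -> OmLev k :=
  omega_map (@iDlev k.+1) (@iDlev k) (@Dtr k : {rmorphism _ -> _}).

(* The map from the completed differentials of [D] to the divided power
   differentials of the [k]-th quotient. *)
Definition OmHat_lev (k : nat) (w : OmHat1) : OmLev k :=
  omega_map iD (@iDlev k) (qpi (nJ k.+1) : {rmorphism D -> Dlev k})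
    (mrepr (mproj k w)).

Lemma qpi_pd_morph k : pd_morph (qpi (nJ k.+1) : D -> Dlev k).
Proof. by move=> x Jx; split=> [|n]; [exists x | rewrite /= qpd_powE]. Qed.
Lemma Dtr_pd_morph k : pd_morph (@Dtr k).
Proof.
move=> _ [x Jx ->]; split=> [|n]; first by exists x; rewrite ?Dtr_pi.
by rewrite /= qpd_powE // !Dtr_pi qpd_powE.
Qed.

Lemma OmLev_trS k : semilinear (@Dtr k) (@OmLev_tr k).
Proof.
by apply: omega_mapS; [move=> a; apply: Dtr_pi | apply: Dtr_pd_morph].
Qed.

Lemma OmHat_levE k v (w : OmHat1) : mproj k w = mpi (nJ k.+1) v ->
  OmHat_lev k w = omega_map iD (@iDlev k) (qpi (nJ k.+1) : {rmorphism D -> Dlev k}) v.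
Proof.
set F := omega_map _ _ _.
have FS : semilinear (qpi (nJ k.+1) : D -> Dlev k) F.
  by apply: omega_mapS => //; apply: qpi_pd_morph.
move=> E; rewrite /OmHat_lev E -/F; apply/subr0_eq.
rewrite -(additive_mapN _ FS.1) -FS.1.
have : sm (nJ k.+1) (mrepr (mpi (nJ k.+1) v) - v) by apply/mpiP; rewrite mreprK.
elim=> [_ [b [u [nb ->]]]||u u' _ IHu _ IHu'|b u _ IH].
- rewrite FS.2.
  have -> : qpi (nJ k.+1) b = 0 :> Dlev k.
    by rewrite -(rmorph0 (qpi (nJ k.+1))); apply/qpiP; rewrite subr0; apply: span_gen.
  by rewrite scale0r.
- exact: additive_map0 FS.1.
- by rewrite FS.1 IHu IHu' addr0.
- by rewrite FS.2 IH scaler0.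
Qed.

Lemma OmHat_levS k : semilinear (@rproj (Dtower) k) (@OmHat_lev k).
Proof.
set F := omega_map iD (@iDlev k) (qpi (nJ k.+1) : {rmorphism D -> Dlev k}).
have FS : semilinear (qpi (nJ k.+1) : D -> Dlev k) F.
  by apply: omega_mapS => //; apply: qpi_pd_morph.
split=> [v w|f w].
  have [a Ea] := mpi_surj (mproj k v); have [b Eb] := mpi_surj (mproj k w).
  rewrite (OmHat_levE Ea) (OmHat_levE Eb) -FS.1; apply: OmHat_levE.
  by rewrite mpiD -Ea -Eb.
have [a Ea] := mpi_surj (mproj k w); have [b Eb] := qpi_surj (rproj k f).
rewrite (OmHat_levE Ea) Eb -FS.2; apply: OmHat_levE.
by rewrite mpiZ -Ea -Eb.
Qed.

Lemma hwedgeDl u v w : hwedge (u + v) w = hwedge u w + hwedge v w.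
Proof.
apply: mproj_inj => k; rewrite -[LHS]/(wedge_lev (mproj k (u + v)) (mproj k w)).
have [a Ea] := mpi_surj (mproj k u); have [b Eb] := mpi_surj (mproj k v).
have [c Ec] := mpi_surj (mproj k w).
have Eab : mproj k (u + v) = mpi (nJ k.+1) (a + b) by rewrite mpiD -Ea -Eb.
rewrite -[RHS]/(wedge_lev (mproj k u) (mproj k w) + wedge_lev (mproj k v) (mproj k w)).
by rewrite Eab Ea Eb Ec !wedge_lev_pi wedgeDl mpiD.
Qed.
Lemma hwedgeDr u v w : hwedge w (u + v) = hwedge w u + hwedge w v.
Proof.
apply: mproj_inj => k; rewrite -[LHS]/(wedge_lev (mproj k w) (mproj k (u + v))).
have [a Ea] := mpi_surj (mproj k u); have [b Eb] := mpi_surj (mproj k v).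
have [c Ec] := mpi_surj (mproj k w).
have Eab : mproj k (u + v) = mpi (nJ k.+1) (a + b) by rewrite mpiD -Ea -Eb.
rewrite -[RHS]/(wedge_lev (mproj k w) (mproj k u) + wedge_lev (mproj k w) (mproj k v)).
by rewrite Eab Ea Eb Ec !wedge_lev_pi wedgeDr mpiD.
Qed.
Lemma hwedgeZl (f : Dhat) v w : hwedge (f *: v) w = f *: hwedge v w.
Proof.
apply: mproj_inj => k; rewrite -[LHS]/(wedge_lev (mproj k (f *: v)) (mproj k w)).
have [a Ea] := mpi_surj (mproj k v); have [c Ec] := mpi_surj (mproj k w).
have [b Eb] := qpi_surj (rproj k f).
have Eab : mproj k (f *: v) = mpi (nJ k.+1) (b *: a) by rewrite mpiZ -Ea -Eb.
rewrite -[RHS]/(rproj k f *: wedge_lev (mproj k v) (mproj k w)).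
by rewrite Eab Ea Eb Ec !wedge_lev_pi wedgeZl mpiZ.
Qed.
Lemma hwedgeZr (f : Dhat) v w : hwedge v (f *: w) = f *: hwedge v w.
Proof.
apply: mproj_inj => k; rewrite -[LHS]/(wedge_lev (mproj k v) (mproj k (f *: w))).
have [a Ea] := mpi_surj (mproj k v); have [c Ec] := mpi_surj (mproj k w).
have [b Eb] := qpi_surj (rproj k f).
have Eab : mproj k (f *: w) = mpi (nJ k.+1) (b *: c) by rewrite mpiZ -Ec -Eb.
rewrite -[RHS]/(rproj k f *: wedge_lev (mproj k v) (mproj k w)).
by rewrite Eab Ea Eb Ec !wedge_lev_pi wedgeZr mpiZ.
Qed.

Lemma dhat1D : additive_map dhat1.
Proof.
move=> v w; apply: mproj_inj => k.
have [a Ea] := mpi_surj (mproj k.+1 v); have [b Eb] := mpi_surj (mproj k.+1 w).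
have Eab : mproj k.+1 (v + w) = mpi (nJ k.+2) (a + b) by rewrite mpiD -Ea -Eb.
rewrite -[RHS]/(d1lev (mproj k.+1 v) + d1lev (mproj k.+1 w)).
rewrite -[LHS]/(d1lev (mproj k.+1 (v + w))).
by rewrite Eab Ea Eb !d1lev_pi du1_mapD mpiD.
Qed.
Lemma dhat1Z (f : Dhat) w : dhat1 (f *: w) = hwedge (dhat f) w + f *: dhat1 w.
Proof.
apply: mproj_inj => k.
have [a Ea] := mpi_surj (mproj k.+1 w); have [b Eb] := qpi_surj (rproj k.+1 f).
have Eab : mproj k.+1 (f *: w) = mpi (nJ k.+2) (b *: a) by rewrite mpiZ -Ea -Eb.
rewrite -[RHS]/(wedge_lev (dlev (rproj k.+1 f)) (mproj k w)
                + rproj k f *: d1lev (mproj k.+1 w)).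
rewrite -[LHS]/(d1lev (mproj k.+1 (f *: w))) -(mproj_map k w) -(rproj_map k f).
rewrite Eab Ea Eb [rt_map _ _ _]Dtr_pi [mt_map _ _ _]Vtr_pi !d1lev_pi dlev_pi.
by rewrite wedge_lev_pi -mpiZ -mpiD du1_mapZ.
Qed.
Lemma dhat_nat (b : D) k : mproj k (dhat (to_Dhat b)) = mpi (nJ k.+1) (du iD b).
Proof. exact: dlev_pi. Qed.
End Completion.
Section Categories.

Record category := Category {
  ob :> Type;
  hom : ob -> ob -> Type;
  idm : forall X, hom X X;
  compm : forall X Y Z, hom Y Z -> hom X Y -> hom X Z;
  compm1 : forall X Y (f : hom X Y), compm f (idm X) = f;
  comp1m : forall X Y (f : hom X Y), compm (idm Y) f = f;
  compmA : forall X Y Z W (f : hom Z W) (g : hom Y Z) (h : hom X Y),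
    compm f (compm g h) = compm (compm f g) h }.

Record functor (C D : category) := Functor {
  fob :> C -> D;
  fmap : forall X Y : C, hom X Y -> hom (fob X) (fob Y);
  fmap_id : forall X, fmap (idm X) = idm (fob X);
  fmap_comp : forall (X Y Z : C) (f : hom Y Z) (g : hom X Y),
    fmap (compm f g) = compm (fmap f) (fmap g) }.

Definition id_functor (C : category) : functor C C :=
  @Functor C C id (fun _ _ f => f) (fun _ => erefl) (fun _ _ _ _ _ => erefl).

Section Composition.
Variables (C D E : category) (G : functor D E) (F : functor C D).
Let comp_id X : fmap G (fmap F (idm X)) = idm (G (F X)).
Proof. by rewrite !fmap_id. Qed.
Let comp_comp X Y Z (f : hom Y Z) (g : hom X Y) :
  fmap G (fmap F (compm f g)) = compm (fmap G (fmap F f)) (fmap G (fmap F g)).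
Proof. by rewrite !fmap_comp. Qed.
Definition comp_functor : functor C E :=
  @Functor C E (fun X => G (F X)) (fun _ _ f => fmap G (fmap F f)) comp_id comp_comp.
End Composition.

Definition is_iso (C : category) (X Y : C) (f : hom X Y) :=
  exists g : hom Y X, compm g f = idm X /\ compm f g = idm Y.

Definition nat_isomorphic (C D : category) (F G : functor C D) :=
  exists eta : forall X : C, hom (F X) (G X),
    (forall (X Y : C) (f : hom X Y),
       compm (eta Y) (fmap F f) = compm (fmap G f) (eta X)) /\
    forall X, is_iso (eta X).

Definition is_equivalence (C D : category) (F : functor C D) :=
  exists G : functor D C,
    nat_isomorphic (comp_functor G F) (id_functor C) /\
    nat_isomorphic (comp_functor F G) (id_functor D).

End Categories.

Section Crystals.
Variables (A : pdring) (R : comPzRingType) (iR : {rmorphism A -> R}).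

Record cris_ob := CrisOb {
  co_ring :> pdring;
  co_alg : {rmorphism A -> co_ring};
  co_proj : {rmorphism co_ring -> R};
  co_compatible : pd_compatible co_alg;
  co_projA : co_proj \o co_alg =1 iR;
  co_surj : surjective co_proj;
  co_ker : forall x : co_ring, pd_ideal x <-> co_proj x = 0;
  co_nilp : exists m n : nat, [/\ (0 < m)%N, (0 < n)%N
    & forall x : co_ring,
        pd_power (@pd_ideal co_ring) (@pd_pow co_ring) n x -> x *+ m = 0] }.

Record cris_hom (X Y : cris_ob) := CrisHom {
  ch_map :> {rmorphism X -> Y};
  ch_alg : ch_map \o co_alg X =1 co_alg Y;
  ch_proj : co_proj Y \o ch_map =1 co_proj X;
  ch_pd : pd_morph ch_map }.

Definition cris_id (X : cris_ob) : cris_hom X X.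
Proof. by refine (@CrisHom X X idfun _ _ _). Defined.

Definition cris_comp (X Y Z : cris_ob) (f : cris_hom Y Z) (g : cris_hom X Y) :
  cris_hom X Z.
Proof.
refine (@CrisHom X Z (ch_map f \o ch_map g) _ _ _).
- by move=> a; rewrite /= [ch_map g _](ch_alg g) [LHS](ch_alg f).
- by move=> x; rewrite /= [LHS](ch_proj f) [LHS](ch_proj g).
- move=> x Ix; have [Igx gx] := ch_pd g Ix; have [Ifx fx] := ch_pd f Igx.
  by split=> // n; rewrite /= gx fx.
Defined.

Record cris_module := CrisModule {
  cm_mod :> forall X : cris_ob, lmodType X;
  cm_map : forall X Y, cris_hom X Y -> cm_mod X -> cm_mod Y;
  cm_mapS : forall X Y (f : cris_hom X Y), semilinear (ch_map f) (cm_map f);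
  cm_map_id : forall X (x : cm_mod X), cm_map (cris_id X) x = x;
  cm_map_comp : forall X Y Z (f : cris_hom Y Z) (g : cris_hom X Y) (x : cm_mod X),
    cm_map (cris_comp f g) x = cm_map f (cm_map g x) }.
Arguments cm_map c {X Y} f _.

Record crystal := Crystal {
  cr_mod :> cris_module;
  cr_base_change : forall X Y (f : cris_hom X Y),
    is_base_change (ch_map f) (cm_map cr_mod f) }.

Definition is_crystal_hom (F G : crystal) (phi : forall X, F X -> G X) :=
  (forall X, semilinear idfun (phi X)) /\
  forall X Y (f : cris_hom X Y) (x : F X),
    phi Y (cm_map F f x) = cm_map G f (phi X x).

Definition crystal_hom (F G : crystal) := {phi | @is_crystal_hom F G phi}.

Definition crystal_id (F : crystal) : crystal_hom F F.
Proof. by exists (fun _ => id). Defined.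

Definition crystal_comp (F G H : crystal) (phi : crystal_hom G H)
  (psi : crystal_hom F G) : crystal_hom F H.
Proof.
exists (fun X x => sval phi X (sval psi X x)).
case: phi psi => [phi [phiS phiN]] [psi [psiS psiN]] /=; split.
  by move=> X; split=> [x y|b x]; rewrite ?(psiS X).1 ?(phiS X).1 ?(psiS X).2 ?(phiS X).2.
by move=> X Y f x; rewrite psiN phiN.
Defined.

Lemma crystal_comp1 F G (f : crystal_hom F G) : crystal_comp f (crystal_id F) = f.
Proof. by case: f => f h; apply: eq_exist. Qed.
Lemma crystal_1comp F G (f : crystal_hom F G) : crystal_comp (crystal_id G) f = f.
Proof. by case: f => f h; apply: eq_exist. Qed.
Lemma crystal_compA F G H K (f : crystal_hom H K) (g : crystal_hom G H)
  (h : crystal_hom F G) :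
  crystal_comp f (crystal_comp g h) = crystal_comp (crystal_comp f g) h.
Proof. exact: eq_exist. Qed.

Definition crystal_cat : category :=
  Category crystal_comp1 crystal_1comp crystal_compA.
End Crystals.

Section Connections.
Variables (A : comPzRingType) (D : pdring) (iD : {rmorphism A -> D}).
(* The images in [D] of the coordinates. *)
Variables (d : nat) (t : 'I_d -> D).
Local Notation Dh := (Dhat D).
Local Notation Oh1 := (OmHat1 iD).
Local Notation Oh2 := (OmHat2 iD).

Definition is_conn (B : comPzRingType) (iB : A -> B) (Om : lmodType B)
    (der : B -> Om) (M : lmodType B) (nabla : M -> M ⊗[B] Om) :=
  [/\ additive_map nabla, forall a m, nabla (iB a *: m) = iB a *: nabla m
    & forall f m, nabla (f *: m) = m ⊗ der f + f *: nabla m].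

Section OnTower.
Variable M : mod_tower (Dtower D).
Local Notation Mh := (lim_mod M).
Variable nabla : Mh -> Mh ⊗[Dh] Oh1.

(* A basis of neighbourhoods of zero in [lim M] is given by the kernels of the
   projections to the [M k], and in its tensor product with [Oh1], which is a
   finite direct sum of copies of [lim M], by the kernels of the projections to
   the tensor products of [M k] with the [k]-th level of [Oh1]. *)
Definition conn_continuous :=
  forall (m : Mh) (k : nat), exists l : nat, forall m' : Mh,
    mproj l m' = mproj l m ->
    tmap (mproj k) (mproj k) (nabla m') =
    tmap (mproj k) (mproj k) (nabla m)
      :> M k ⊗[Dlev D k] qmod (npd D k.+1) (omega iD).

Definition is_connection :=
  is_conn (to_Dhat (D := D) \o iD) (dhat iD) nabla /\ conn_continuous.

Definition tower_connection := forall k : nat, M k -> M k ⊗[Dlev D k] OmLev iD k.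

Definition is_limit_connection (nab : tower_connection) :=
  [/\ forall k, is_conn (iDlev iD k) (du (iDlev iD k)) (nab k),
      forall k m, nab k (mt_map M k m) =
        tmap (mt_map M k) (@OmLev_tr _ _ iD k) (nab k.+1 m)
    & forall k m, nab k (mproj k m) =
        tmap (mproj k) (@OmHat_lev _ _ iD k) (nabla m)].

Definition conn_cartesian := exists nab, is_limit_connection nab.

Definition nabla1 : Mh ⊗[Dh] Oh1 -> Mh ⊗[Dh] Oh2 :=
  tlift (fun (m : Mh) (w : Oh1) =>
    m ⊗ dhat1 w + tmap (idfun : Mh -> Mh) (fun v => hwedge v w) (nabla m)).

Lemma nabla1_mk m w : is_connection -> nabla1 (m ⊗ w) =
  m ⊗ dhat1 w + tmap (idfun : Mh -> Mh) (fun v => hwedge v w) (nabla m).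
Proof.
case=> -[nD _ nL] _.
have idS : semilinear (idfun : Dh -> Dh) (idfun : Mh -> Mh) by [].
have wS (w' : Oh1) : semilinear (idfun : Dh -> Dh) (fun v : Oh1 => hwedge v w' : Oh2).
  by split=> [u v|f v]; rewrite ?hwedgeDl ?hwedgeZl.
apply: tlift_mk => [m1 m2 w'|m' w1 w2|f m' w'].
- by rewrite tmkDl nD (tmapD idS (wS w')) addrACA.
- rewrite dhat1D tmkDr -!addrA; congr (_ + _).
  rewrite addrCA; congr (_ + _); move: (nabla m').
  apply: tens_ext => [||m3 v]; first exact: (tmapD idS (wS _)).
    by move=> u v; rewrite (tmapD idS (wS w1)) (tmapD idS (wS w2)) addrACA.
  by rewrite !(tmap_mk idS (wS _)) hwedgeDr tmkDr.
- rewrite nL (tmapD idS (wS w')) (tmap_mk idS (wS w')) (tmapS idS (wS w')).2.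
  rewrite dhat1Z tmkDr -tmk_bal addrA -[RHS]addrA [_ + _ ⊗ _]addrC [RHS]addrA.
  have E : tmap (idfun : Mh -> Mh) (fun v => hwedge v (f *: w')) (nabla m') =
    f *: tmap (idfun : Mh -> Mh) (fun v => hwedge v w') (nabla m').
    move: (nabla m'); apply: tens_ext => [||m3 v]; first exact: (tmapD idS (wS _)).
      by move=> u v; rewrite (tmapD idS (wS w')) scalerDr.
    by rewrite !(tmap_mk idS (wS _)) hwedgeZr -tmk_bal tmkZl.
  by rewrite E -!addrA.
Qed.

Definition conn_integrable := forall m, nabla1 (nabla m) = 0.

Definition pd_quasi_nilpotent :=
  exists theta : 'I_d -> Mh -> Mh,
    (forall m, nabla m = \sum_(j < d) theta j m ⊗ dhat iD (to_Dhat (t j))) /\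
    forall (m : Mh) (k : nat) (j : 'I_d), exists N : nat,
      forall l, (N <= l)%N ->
        exists y : M k, mproj k (iter l (theta j) m) = y *+ (k.+1)`!.
End OnTower.

Record conn_module := ConnModule {
  cn_mod :> mod_tower (Dtower D);
  cn_base_change : forall k, is_base_change (rt_map (Dtower D) k) (mt_map cn_mod k);
  cn_nabla : lim_mod cn_mod -> lim_mod cn_mod ⊗[Dh] Oh1;
  cn_connection : is_connection cn_nabla;
  cn_cartesian : conn_cartesian cn_nabla;
  cn_integrable : conn_integrable cn_nabla;
  cn_nilpotent : pd_quasi_nilpotent cn_nabla }.

Definition cn_nabla_lev (M : conn_module) : tower_connection M :=
  projT1 (cid (cn_cartesian M)).
Arguments cn_nabla_lev M k _ : clear implicits.

Definition is_conn_hom (M M' : conn_module) (f : lim_mod M -> lim_mod M') :=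
  semilinear idfun f /\
  exists fn : forall k, M k -> M' k,
    [/\ forall k, semilinear idfun (fn k),
        forall k x, mt_map M' k (fn k.+1 x) = fn k (mt_map M k x),
        forall k x, mproj k (f x) = fn k (mproj k x)
      & forall k x, cn_nabla_lev M' k (fn k x) =
          tmap (fn k) (idfun : OmLev iD k -> OmLev iD k) (cn_nabla_lev M k x)].

Definition conn_hom (M M' : conn_module) := {f | @is_conn_hom M M' f}.

Definition conn_id (M : conn_module) : conn_hom M M.
Proof.
exists id; split=> //; exists (fun _ => id); split=> // k x.
set u := cn_nabla_lev _ _ _; move: u.
have idS : semilinear (idfun : Dlev D k -> Dlev D k) (idfun : OmLev iD k -> _) by [].
have idS' : semilinear (idfun : Dlev D k -> Dlev D k) (id : M k -> _) by [].
apply: tens_ext => //; first exact: (tmapD idS' idS).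
by move=> m n; rewrite (tmap_mk idS' idS).
Defined.

Definition conn_comp (M M' M'' : conn_module) (f : conn_hom M' M'')
  (g : conn_hom M M') : conn_hom M M''.
Proof.
exists (fun x => sval f (sval g x)).
case: f g => [f [fS [fn [fnS fnT fnP fnN]]]] [g [gS [gn [gnS gnT gnP gnN]]]] /=.
split; first by split=> [x y|b x]; rewrite ?gS.1 ?fS.1 ?gS.2 ?fS.2.
have cS k : semilinear idfun (fun x => fn k (gn k x)).
  by split=> [x y|b x]; rewrite ?(gnS k).1 ?(fnS k).1 ?(gnS k).2 ?(fnS k).2.
exists (fun k x => fn k (gn k x)); split=> // k x.
- by rewrite fnT gnT.
- by rewrite fnP gnP.
rewrite fnN gnN; set u := cn_nabla_lev _ _ _; move: u.
have idS : semilinear (idfun : Dlev D k -> Dlev D k) (idfun : OmLev iD k -> _) by [].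
apply: tens_ext => [u v||m n].
- by rewrite (tmapD (gnS k) idS) (tmapD (fnS k) idS).
- exact: (tmapD (cS k) idS).
- by rewrite (tmap_mk (gnS k) idS) (tmap_mk (fnS k) idS) (tmap_mk (cS k) idS).
Defined.

Lemma conn_comp1 M M' (f : conn_hom M M') : conn_comp f (conn_id M) = f.
Proof. by case: f => f h; apply: eq_exist. Qed.
Lemma conn_1comp M M' (f : conn_hom M M') : conn_comp (conn_id M') f = f.
Proof. by case: f => f h; apply: eq_exist. Qed.
Lemma conn_compA M M' M'' N (f : conn_hom M'' N) (g : conn_hom M' M'')
  (h : conn_hom M M') :
  conn_comp f (conn_comp g h) = conn_comp (conn_comp f g) h.
Proof. exact: eq_exist. Qed.

Definition conn_cat : category := Category conn_comp1 conn_1comp conn_compA.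
End Connections.

(* Main.v *)
(* Call a map from the envelope [D] to an object [B] of [Cris(R/A)] a point of
   [B].  Since [q] is etale and the kernel of [B -> R] is nil, a point is the same
   as a lift to [B] of the images in [R] of the coordinates, so every [B] has
   points, and each of them factors through some [D_n].  Evaluating a crystal [F]
   on the [D_n] gives a tower with limit [M], and each point [u] of [B] identifies
   [F B] with the base change of [M] along [u].

   The points [x |-> x + eps d_j x] of the dual numbers over [D_n] define commuting
   operators [theta_j] on [M].  If [u] and [v] are points of [B] that differ only
   in the [j]-th coordinate, then
     [u_* m = \sum_l delta_l(u t_j - v t_j) v_* (theta_j^l m)];
   this comes from a divided power polynomial ring over [D], where both sides are
   determined by their derivatives in the variable.  The finiteness of the
   expansion there gives the quasi-nilpotence of [theta_j].  Conversely, these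
   Taylor operators form a cocycle: they commute and turn addition of increments
   into composition.  Hence for a module with connection, base change along one
   chosen point for each object, glued by the Taylor operators, is a crystal. *)
From HB Require Import structures.
From mathcomp Require Import all_boot all_order all_algebra.
From mathcomp Require Import boolp zify ring.
Require Import Defs.

Set Implicit Arguments.
Unset Strict Implicit.
Unset Printing Implicit Defensive.
Import GRing.Theory.
Local Open Scope ring_scope.

(** The equivalence needs only the data in [chart]; etaleness and the envelope enter through
    [env_chart]. The obstacle in the Taylor formula is loss of level. The divided power polynomial
    ring over [D] need not lie in the site, so it is seen through its levels [U K], and
    differentiating an element of [F (U K)] lands at a lower level. A given coefficient is
    identified exactly once [K] is large, with a bound depending on the coefficient; all
    coefficients together are identified only modulo $(k+1)!$. Both suffice: for [l > k] the factor
    [delta_l] absorbs $(k+1)!$, because $(k+1)! I^{[k+1]}$ vanishes in an object of depth [k]. The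
    same split into small and large exponents makes the Taylor operators finite. The operators
    [theta] are defined on the limit and are only continuous there, so base change is phrased for
    the limit: [adm0] and [slin] describe the maps out of it that are continuous and linear along a
    point. Divided power series are encoded as sequences with the shift as derivative, so that the
    divided power axioms follow by comparing constant terms and derivatives. *)

Section AdditiveMaps.
Variables (U V : zmodType) (f : U -> V).
Hypothesis fD : additive_map f.

Lemma additive_mapB x y : f (x - y) = f x - f y.
Proof. by rewrite fD additive_mapN. Qed.

Lemma additive_map_sum (I : Type) (r : seq I) (P : pred I) F :
  f (\sum_(i <- r | P i) F i) = \sum_(i <- r | P i) f (F i).
Proof. exact: (big_morph f fD (additive_map0 fD)). Qed.

Lemma additive_mapMn x n : f (x *+ n) = f x *+ n.
Proof.
by elim: n => [|n IH]; rewrite ?mulr0n ?additive_map0 // !mulrS fD IH.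
Qed.
End AdditiveMaps.

Lemma rmorph_ext (B C : pzSemiRingType) (f g : {rmorphism B -> C}) : f =1 g -> f = g.
Proof.
case: f g => f [[f1] [f2]] [g [[g1] [g2]]] /= /funext fg.
by subst g; rewrite (Prop_irrelevance f1 g1) (Prop_irrelevance f2 g2).
Qed.

(** * Extension of scalars and its kernel along a surjection *)

Section BaseChange.
Variables (B C : comPzRingType) (phi : {rmorphism B -> C}).
Variables (M : lmodType B) (M' : lmodType C) (f : M -> M').
Hypothesis bc : is_base_change phi f.

Lemma bc_ind (P : M' -> Prop) : P 0 -> (forall x y, P x -> P y -> P (x + y)) ->
  (forall c m, P (c *: f m)) -> forall x, P x.
Proof.
case: bc => psi [psiE [psi' psiK psi'K]] P0 PD Pf x; rewrite -(psi'K x).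
elim/tens_ind: (psi' x) => [|u v Pu Pv|c m]; rewrite ?raddf0 ?raddfD ?psiE //.
exact: PD.
Qed.

Lemma bcS : semilinear phi f.
Proof.
case: bc => psi [psiE _].
have fE m : f m = psi (tmk phi (1 : C^o) m) by rewrite psiE scale1r.
split=> [x y|b x]; rewrite !fE; first by rewrite tmkDr raddfD.
by rewrite -tmk_bal tmkZl linearZ.
Qed.

Lemma bc_lift (Q : zmodType) (g : C -> M -> Q) :
  (forall m, additive_map (g^~ m)) -> (forall c, additive_map (g c)) ->
  (forall b c m, g (phi b * c) m = g c (b *: m)) ->
  exists2 h : M' -> Q, additive_map h & forall c m, h (c *: f m) = g c m.
Proof.
case: bc => psi [psiE [psi' psiK psi'K]] gDl gDr gb.
have gDl' (n n' : C^o) m : g (n + n') m = g n m + g n' m by apply: gDl.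
exists (fun x => tlift (phi := phi) (N := C^o) g (psi' x)) => [x y|c m].
  rewrite -(tliftD gDl' gDr gb); congr (tlift _ _).
  by apply: (can_inj psiK); rewrite psi'K raddfD /= !psi'K.
by rewrite -psiE psiK (tlift_mk (N := C^o) gDl' gDr gb).
Qed.

Lemma bc_univ (C' : comPzRingType) (chi : {rmorphism C -> C'}) (N : lmodType C')
    (g : M -> N) : additive_map g ->
  (forall b m, g (b *: m) = chi (phi b) *: g m) ->
  exists2 h : M' -> N, semilinear chi h & forall m, h (f m) = g m.
Proof.
move=> gD gZ.
have [m x y|c x y|b c m|h hD hE] := @bc_lift N (fun c m => chi c *: g m).
- by rewrite rmorphD scalerDl.
- by rewrite gD scalerDr.
- by rewrite gZ scalerA -rmorphM mulrC.
exists h => [|m]; last by rewrite -[f m]scale1r hE rmorph1 scale1r.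
split=> // c; apply: bc_ind => [|x y IHx IHy|c' m].
- by rewrite scaler0 (additive_map0 hD) scaler0.
- by rewrite scalerDr !hD IHx IHy scalerDr.
- by rewrite scalerA !hE rmorphM scalerA.
Qed.


Hypothesis phi_surj : surjective phi.

Lemma bc_surj : surjective f.
Proof.
have [fD fZ] := bcS.
apply: bc_ind => [|x y [a <-] [b <-]|c m]; first by exists 0; rewrite additive_map0.
  by exists (a + b); rewrite fD.
by have [b <-] := phi_surj c; exists (b *: m); rewrite fZ.
Qed.

(** For a set-theoretic section [sec] of [phi], the pairing sending [c] and [m] to the class of
    [sec c *: m] modulo [K M], with [K] the kernel of [phi], is biadditive and balanced. It descends
    to [M'] and inverts [f] up to [K M]. *)
Lemma bc_ker (m : M) : f m = 0 -> span (smul_set (V := M) (fun b => phi b = 0)) m.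
Proof.
pose K := smul_set (V := M) (fun b => phi b = 0).
pose sec c := projT1 (cid (phi_surj c)).
have secK c : phi (sec c) = c by rewrite /sec; case: cid.
have spK b x : phi b = 0 -> span K (b *: x) by move=> b0; apply: span_gen; exists b, x.
have [x c c'|c x y|b c x|h hD hE] := @bc_lift (zquot K) (fun c m => zpi K (sec c *: m)).
- rewrite -zpiD; apply/zpiP; rewrite -scalerDl -scalerBl; apply: spK.
  by rewrite rmorphB rmorphD !secK subrr.
- by rewrite scalerDr zpiD.
- apply/zpiP; rewrite scalerA -scalerBl; apply: spK.
  by rewrite rmorphB rmorphM !secK mulrC subrr.
move=> fm0; have := hE 1 m; rewrite scale1r fm0 (additive_map0 hD) => /esym.
rewrite -(zpi0 K) => /zpiP; rewrite subr0 => sm.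
(* [sec 1] need not be [1]; the difference lies in the kernel of [phi]. *)
have -> : m = sec 1 *: m + (1 - sec 1) *: m by rewrite -scalerDl addrC subrK scale1r.
by apply: spanD => //; apply: spK; rewrite rmorphB rmorph1 secK subrr.
Qed.
End BaseChange.

(** Since [f] generates [M'], the candidate inverse [h] is checked to be two-sided on generators
    alone. *)
Lemma is_base_change_intro (B C : comPzRingType) (phi : {rmorphism B -> C})
    (M : lmodType B) (M' : lmodType C) (f : M -> M') : semilinear phi f ->
  (forall P : M' -> Prop, P 0 -> (forall x y, P x -> P y -> P (x + y)) ->
     (forall c m, P (c *: f m)) -> forall x, P x) ->
  (exists2 h : M' -> tens phi C^o M, semilinear idfun h &
     forall m, h (f m) = tmk phi (1 : C^o) m) ->
  is_base_change phi f.
Proof.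
move=> [fD fZ] gen [h hS hE].
pose g (c : C^o) m : M' := c *: f m.
have gDl (n n' : C^o) m : g (n + n') m = g n m + g n' m by rewrite /g scalerDl.
have gDr (n : C^o) m m' : g n (m + m') = g n m + g n m' by rewrite /g fD scalerDr.
have gb b (n : C^o) m : g (phi b *: n) m = g n (b *: m).
  by rewrite /g fZ scalerA mulrC.
pose psi := tlift (phi := phi) g.
have psiD : additive_map psi := tliftD gDl gDr gb.
have psiE c m : psi (tmk phi (c : C^o) m) = c *: f m := tlift_mk gDl gDr gb c m.
have psi_lin : linear psi.
  move=> a x y; rewrite psiD; congr (_ + _); elim/tens_ind: x => [|u v Hu Hv|c m].
  - by rewrite scaler0 (additive_map0 psiD) scaler0.
  - by rewrite scalerDr !psiD scalerDr Hu Hv.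
  - by rewrite -tmkZl !psiE scalerA.
pose psiL : {linear tens phi C^o M -> M'} := HB.pack psi (GRing.isLinear.Build _ _ _ _ psi psi_lin).
exists psiL; split=> //; exists h => [|x].
  elim/tens_ind => [|u v Hu Hv|c m].
  - by rewrite raddf0 (additive_map0 hS.1).
  - by rewrite raddfD hS.1 Hu Hv.
  - by rewrite [psiL _]psiE hS.2 hE -tmkZl /= [_ *: _]mulr1.
move: x; apply: gen => [|x y Hx Hy|c m].
- by rewrite (additive_map0 hS.1) raddf0.
- by rewrite hS.1 [LHS]psiD; congr (_ + _).
- by rewrite hS.2 hE -tmkZl [LHS]psiE; congr (_ *: _); apply: mulr1.
Qed.

(* The sum of a sequence that vanishes eventually; junk value [0] otherwise. *)
Section EventualSum.
Variable N : zmodType.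
Implicit Types F G : nat -> N.

Definition ev0 F := exists L, forall l, (L <= l)%N -> F l = 0.

Definition esum F : N :=
  if pselect (ev0 F) is left h then \sum_(l < projT1 (cid h)) F l else 0.

Lemma esumE F L : (forall l, (L <= l)%N -> F l = 0) -> esum F = \sum_(l < L) F l.
Proof.
move=> FL; rewrite /esum; case: pselect => [h|[]]; last by exists L.
case: (cid h) => L' /= FL'.
suff E a b : (a <= b)%N -> (forall l, (a <= l)%N -> F l = 0) ->
    \sum_(l < b) F l = \sum_(l < a) F l.
  by rewrite -(E L (maxn L L')) ?leq_maxl // -(E L' (maxn L L')) ?leq_maxr.
move=> ab Fa; rewrite -!(big_mkord xpredT F) (big_cat_nat (leq0n a) ab) /=.
rewrite [X in _ + X](_ : _ = 0) ?addr0 // big_nat_cond big1 // => l.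
  by case/andP=> /andP[/Fa].
Qed.

Lemma ev0_bound F L : ev0 F -> exists2 L', (L <= L')%N & forall l, (L' <= l)%N -> F l = 0.
Proof.
move=> [L' FL']; exists (maxn L L'); rewrite ?leq_maxl // => l.
by rewrite geq_max => /andP[_ /FL'].
Qed.

Lemma ev0D F G : ev0 F -> ev0 G -> ev0 (fun l => F l + G l).
Proof.
move=> [L FL] /(ev0_bound L)[L' LL' GL']; exists L' => l lL.
by rewrite FL ?GL' ?addr0 //; apply: leq_trans lL.
Qed.

Lemma esumD F G : ev0 F -> ev0 G -> esum (fun l => F l + G l) = esum F + esum G.
Proof.
move=> [L FL] /(ev0_bound L)[L' LL' GL'].
have FL' l : (L' <= l)%N -> F l = 0 by move=> h; apply: FL; apply: leq_trans h.
rewrite (esumE FL') (esumE GL') (@esumE _ L') ?big_split // => l lL.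
by rewrite FL' ?GL' ?addr0.
Qed.

Lemma esum0 : esum (fun _ => 0) = 0.
Proof. by rewrite (@esumE _ 0%N) ?big_ord0. Qed.

Lemma esumS F : ev0 F -> esum F = F 0%N + esum (fun l => F l.+1).
Proof.
move=> /(ev0_bound 1)[[//|L] _ FL]; rewrite (esumE FL) big_ord_recl.
by rewrite (@esumE (fun l => F l.+1) L) // => l lL; apply: FL.
Qed.

Lemma ev0_shift F : ev0 F -> ev0 (fun l => F l.+1).
Proof. by move=> [L FL]; exists L => l lL; apply: FL; apply: leqW. Qed.
End EventualSum.

Lemma ev0_map (N N' : zmodType) (h : N -> N') F :
  h 0 = 0 -> ev0 F -> ev0 (fun l => h (F l)).
Proof. by move=> h0 [L FL]; exists L => l lL; rewrite FL. Qed.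

Lemma esum_map (N N' : zmodType) (h : N -> N') F :
  additive_map h -> ev0 F -> h (esum F) = esum (fun l => h (F l)).
Proof.
move=> hD [L FL]; rewrite (esumE FL) (additive_map_sum hD) (@esumE _ _ L) // => l lL.
by rewrite FL // additive_map0.
Qed.

(** * Constructions with divided powers *)

(** [(n * m)! / (n! * m!^n)] counts the partitions of a set with [n * m] elements into [n] blocks of
    size [m]; the recursion chooses the block of a distinguished element. It is what one
    differentiation does to the composition axiom of divided powers. *)
Lemma pd_comp_coefS n m : ((n.+1 * m.+1)`! %/ (n.+1`! * m.+1`! ^ n.+1) =
  (n * m.+1)`! %/ (n`! * m.+1`! ^ n) * 'C(m + n * m.+1, m))%N.
Proof.
pose fix c k := if k is l.+1 then (c l * 'C(m + l * m.+1, m))%N else 1%N.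
have cE k : (c k * (k`! * m.+1`! ^ k) = (k * m.+1)`!)%N.
  elim: k => [|k IH] //.
  have NE : (k.+1 * m.+1 = (m + k * m.+1).+1)%N by rewrite mulSn addSn.
  rewrite NE [RHS]factS -(@bin_fact (m + k * m.+1) m) ?leq_addr // addKn -IH -NE /=.
  rewrite [k.+1`!]factS expnS [m.+1`!]factS.
  move: (c k) 'C(_, _) (k`!) (m`!) (_ ^ k)%N => u v w x y; lia.
have dE k : ((k * m.+1)`! %/ (k`! * m.+1`! ^ k) = c k)%N.
  by rewrite -cE mulnK // muln_gt0 fact_gt0 expn_gt0 fact_gt0.
by rewrite !dE.
Qed.

Section PDRingTheory.
Variable B : pdring.
Local Notation J := (@pd_ideal B).
Local Notation gam := (@pd_pow B).
Let ax := pd_ax B.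

Lemma pdi0 : J 0. Proof. by case: (pd_isideal ax). Qed.
Lemma pdiD x y : J x -> J y -> J (x + y).
Proof. by case: (pd_isideal ax) => _ h _; apply: h. Qed.
Lemma pdiM b x : J x -> J (b * x).
Proof. by case: (pd_isideal ax) => _ _; apply. Qed.
Lemma pdiN x : J x -> J (- x).
Proof. by rewrite -mulN1r; apply: pdiM. Qed.
Lemma pdiB x y : J x -> J y -> J (x - y).
Proof. by move=> Jx Jy; apply: pdiD => //; apply: pdiN. Qed.

Lemma pd_powS_mul n x : J x -> x * gam n x = gam n.+1 x *+ n.+1.
Proof.
by move=> Jx; rewrite -{1}(pd_1 ax Jx) (pd_M ax) // add1n bin1 mulr_natl.
Qed.

Lemma pd_pow_expr n x : J x -> x ^+ n = gam n x *+ n`!.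
Proof.
move=> Jx; elim: n => [|n IH]; first by rewrite expr0 (pd_0 ax).
by rewrite exprS IH mulrnAr pd_powS_mul // -mulrnA factS.
Qed.
End PDRingTheory.

(** * Square zero extensions and their divided powers *)

Section SquareZero.
Variables (B : comPzRingType) (N : lmodType B).

(* The square zero extension of [B] by the module [N]. *)
Definition sqz := (B * N)%type.
HB.instance Definition _ := GRing.Zmodule.on sqz.

Let mul (z w : sqz) : sqz := (z.1 * w.1, z.1 *: w.2 + w.1 *: z.2).
Let mulA : associative mul.
Proof.
move=> [a x] [b y] [c z]; rewrite /mul /=; congr (_, _); first exact: mulrA.
by rewrite !scalerDr !scalerA addrA (mulrC c a) (mulrC c b).
Qed.
Let mulC : commutative mul.
Proof. by move=> [a x] [b y]; rewrite /mul /= mulrC addrC. Qed.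
Let mul1 : left_id (1, 0) mul.
Proof. by move=> [a x]; rewrite /mul /= mul1r scale1r scaler0 addr0. Qed.
Let mulDl : left_distributive mul +%R.
Proof.
by move=> [a x] [b y] [c z]; rewrite /mul /= mulrDl scalerDl scalerDr addrACA.
Qed.
HB.instance Definition _ := GRing.Zmodule_isComPzRing.Build sqz mulA mulC mul1 mulDl.


Definition sqz_fst (z : sqz) : B := z.1.
Fact sqz_fst_zmod : zmod_morphism sqz_fst. Proof. by []. Qed.
Fact sqz_fst_monoid : monoid_morphism sqz_fst. Proof. by []. Qed.
HB.instance Definition _ := GRing.isZmodMorphism.Build sqz B sqz_fst sqz_fst_zmod.
HB.instance Definition _ := GRing.isMonoidMorphism.Build sqz B sqz_fst sqz_fst_monoid.

Definition sqz_in (b : B) : sqz := (b, 0).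
Fact sqz_in_zmod : zmod_morphism sqz_in.
Proof. by move=> x y; congr (_, _); rewrite subr0. Qed.
Fact sqz_in_monoid : monoid_morphism sqz_in.
Proof. by split=> // x y; congr (_, _); rewrite /= !scaler0 addr0. Qed.
HB.instance Definition _ := GRing.isZmodMorphism.Build B sqz sqz_in sqz_in_zmod.
HB.instance Definition _ := GRing.isMonoidMorphism.Build B sqz sqz_in sqz_in_monoid.

Lemma sqz_ext (z w : sqz) : z.1 = w.1 -> z.2 = w.2 -> z = w.
Proof. by case: z w => [a x] [b y] /= -> ->. Qed.

Lemma sqz_sum2 (I : Type) (r : seq I) (P : pred I) (F : I -> sqz) :
  (\sum_(i <- r | P i) F i).2 = \sum_(i <- r | P i) (F i).2.
Proof. exact: (big_morph (fun z : sqz => z.2)). Qed.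
Lemma sqz_sum1 (I : Type) (r : seq I) (P : pred I) (F : I -> sqz) :
  (\sum_(i <- r | P i) F i).1 = \sum_(i <- r | P i) (F i).1.
Proof. exact: (big_morph (fun z : sqz => z.1)). Qed.

Lemma sqz_natl n (z : sqz) : n%:R * z = (n%:R * z.1, n%:R *: z.2).
Proof. by rewrite -(rmorph_nat sqz_in); apply: sqz_ext; rewrite /= ?scaler0 ?addr0. Qed.

Lemma sqz_exp n (z : sqz) : z ^+ n.+1 = (z.1 ^+ n.+1, (z.1 ^+ n *+ n.+1) *: z.2).
Proof.
elim: n => [|n IH]; first by case: z => b x; rewrite !expr1 expr0 mulr1n scale1r.
rewrite exprS IH; apply: sqz_ext => /=; first exact/esym/exprS.
rewrite scalerA -scalerDl.
by rewrite mulrnAr -exprS -mulrSr.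
Qed.
End SquareZero.

Section SquareZeroPD.
Variables (B : comPzRingType) (N : lmodType B) (I : B -> Prop) (gam : nat -> B -> B).
Hypothesis ax : is_pd I gam.
Local Notation E := (sqz N).

Definition sqz_ideal (z : E) := I z.1.
(** The addition formula forces this once [delta_l] vanishes on [N] for [l >= 2]: $\delta_n(b + x) =
    \delta_n(b) + \delta_{n-1}(b) x$. *)
Definition sqz_pow (n : nat) (z : E) : E :=
  (gam n z.1, if n is m.+1 then gam m z.1 *: z.2 else 0).

Let BP : pdring := PDRing ax.

Lemma sqz_is_pd : is_pd sqz_ideal sqz_pow.
Proof.
split.
- split; first exact: (@pdi0 BP).
    by move=> x y; apply: (@pdiD BP).
  by move=> b x; apply: (@pdiM BP).
- by move=> n x Ix n0; apply: (pd_stable ax).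
- by move=> x Ix; apply: sqz_ext; rewrite //= (pd_0 ax).
- by move=> x Ix; apply: sqz_ext; rewrite /= ?(pd_1 ax) // (pd_0 ax) // scale1r.
- move=> n x y Ix Iy; have D1 : (x + y).1 = x.1 + y.1 by [].
  have D2 : (x + y).2 = x.2 + y.2 by [].
  apply: sqz_ext; rewrite ?sqz_sum1 ?sqz_sum2 /= ?D1 ?D2.
    by rewrite (pd_D ax).
  case: n => [|n]; first by rewrite big_ord1 /= !scaler0 addr0.
  rewrite (pd_D ax) // big_split /= [X in _ = X + _]big_ord_recr [X in _ = _ + X]big_ord_recl /=.
  rewrite subnn /= !scaler0 addr0 add0r scalerDr addrC !scaler_suml.
  congr (_ + _); apply: eq_bigr => i _.
    by rewrite subSn ?scalerA // -ltnS.
  by rewrite /bump /= add1n subSS scalerA mulrC.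
- move=> [|n] b x Ix; apply: sqz_ext => /=; rewrite ?(pd_Z ax) //.
  + by rewrite scaler0 scaler0 addr0.
  + by rewrite sqz_exp.
  rewrite sqz_exp /= scalerDr !scalerA; congr (_ *: _ + _ *: _).
    by rewrite exprSr mulrAC.
  by rewrite -mulrA (mulrC _ x.1) (@pd_powS_mul BP) // !mulrnAr mulrC.
- move=> m n x Ix; rewrite sqz_natl; apply: sqz_ext; rewrite /= ?(pd_M ax) //.
  case: m n => [|m] [|n] /=; rewrite ?scaler0 ?addr0 ?add0r ?add0n ?addn0 //.
  + by rewrite bin0 scale1r scalerA (pd_0 ax) // mul1r.
  + by rewrite binn scale1r scalerA (pd_0 ax) // mul1r.
  rewrite !scalerA !(pd_M ax) // -scalerDl addSnnS (addnC n.+1) -mulrDl -natrD.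
  by rewrite -(bin_sub (leq_addl m n.+1)) addnK addSn binS.
- move=> m n x Ix m0.
  rewrite sqz_natl; apply: sqz_ext; rewrite /= ?(pd_comp ax) //.
  case: m m0 => // m _; case: n => [|n]; first by rewrite mul0n scaler0.
  (* The component in [N] is a derivative of the composition axiom, so its coefficient is unfolded
     once. *)
  rewrite pd_comp_coefS mulSn addSn /= (pd_comp ax) // !scalerA natrM -!mulrA.
  by rewrite (mulrC (gam (_ * _)%N _)) (pd_M ax).
Qed.

Lemma sqz_pow_in n b : I b -> sqz_pow n (sqz_in N b) = sqz_in N (gam n b).
Proof. by move=> Ib; apply: sqz_ext => //=; case: n => // n; rewrite scaler0. Qed.
End SquareZeroPD.

(** * Divided power series in one variable *)

Section Hurwitz.
Variable B : comPzRingType.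

(* The sequence [a] stands for the divided power series [\sum_l a_l xi^[l]]; the
   shift is the derivative with respect to [xi]. *)
Definition hur := nat -> B.
HB.instance Definition _ := gen_eqMixin hur.
HB.instance Definition _ := gen_choiceMixin hur.

Let add (a b : hur) : hur := fun n => a n + b n.
Let opp (a : hur) : hur := fun n => - a n.
Let addA : associative add. Proof. by move=> a b c; apply: funext => n; apply: addrA. Qed.
Let addC : commutative add. Proof. by move=> a b; apply: funext => n; apply: addrC. Qed.
Let add0 : left_id ((fun=> 0) : hur) add.
Proof. by move=> a; apply: funext => n; apply: add0r. Qed.
Let addN : left_inverse ((fun=> 0) : hur) opp add.
Proof. by move=> a; apply: funext => n; apply: addNr. Qed.
HB.instance Definition _ := GRing.isZmodule.Build hur addA addC add0 addN.

Definition hsh (a : hur) : hur := fun n => a n.+1.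
Lemma hshD : additive_map hsh. Proof. by []. Qed.
Lemma hur_ext (a b : hur) : a 0%N = b 0%N -> hsh a = hsh b -> a = b.
Proof. by move=> E0 E; apply: funext => -[|n] //; move/(congr1 (fun f => f n)): E. Qed.

(** Leibniz' rule read as a recursion; unfolded, it is the binomial convolution by which divided
    power series multiply. In this form [hshM] holds by computation. *)
Fixpoint hmul (n : nat) (a b : hur) : B :=
  if n is m.+1 then hmul m (hsh a) b + hmul m a (hsh b) else a 0%N * b 0%N.
Let mul (a b : hur) : hur := fun n => hmul n a b.

Let hmulC n : commutative (hmul n).
Proof. by elim: n => [|n IH] a b /=; rewrite ?(mulrC (a _)) // addrC !(IH _ (hsh _)) IH. Qed.
Let hmulDl n (a b c : hur) : hmul n (a + b) c = hmul n a c + hmul n b c.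
Proof. by elim: n a b c => [|n IH] a b c /=; rewrite ?mulrDl // hshD !IH addrACA. Qed.
Let mulA : associative mul.
Proof.
move=> a b c; apply: funext => n.
have mulDl x y z : mul (x + y) z = mul x z + mul y z.
  by apply: funext => k; apply: hmulDl.
have mulDr x y z : mul x (y + z) = mul x y + mul x z.
  by apply: funext => k; rewrite /mul hmulC hmulDl ![hmul k _ x]hmulC.
have hshM x y : hsh (mul x y) = mul (hsh x) y + mul x (hsh y) by [].
elim: n a b c => [|n IH] a b c; first exact: mulrA.
rewrite -[LHS]/(mul (hsh a) (mul b c) n + mul a (hsh (mul b c)) n).
rewrite -[RHS]/(mul (hsh (mul a b)) c n + mul (mul a b) (hsh c) n).
rewrite !hshM mulDr mulDl.
by rewrite -[LHS]/(_ n + (_ n + _ n)) -[RHS]/((_ n + _ n) + _ n) !IH addrA.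
Qed.
Let mulC : commutative mul. Proof. by move=> a b; apply: funext => n; apply: hmulC. Qed.
Definition hconst (b : B) : hur := fun n => if n is 0%N then b else 0.
Let hmul0 n a : hmul n 0 a = 0.
Proof. by elim: n a => [|n IH] a /=; rewrite ?mul0r // IH [hsh 0]/(0 : hur) IH addr0. Qed.
Let hmul_const n b a : hmul n (hconst b) a = b * a n.
Proof.
elim: n a => [|n IH] a //=; rewrite IH [hsh (hconst b)](_ : _ = 0) ?hmul0 ?add0r.
  by [].
exact: funext.
Qed.
Let mul1 : left_id (hconst 1) mul.
Proof. by move=> a; apply: funext => n; rewrite /mul hmul_const mul1r. Qed.
Let mulDl : left_distributive mul +%R.
Proof. by move=> a b c; apply: funext => n; apply: hmulDl. Qed.
HB.instance Definition _ := GRing.Zmodule_isComPzRing.Build hur mulA mulC mul1 mulDl.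

Lemma hshM (a b : hur) : hsh (a * b) = hsh a * b + a * hsh b. Proof. by []. Qed.
Lemma hconstM b (a : hur) n : (hconst b * a) n = b * a n. Proof. exact: hmul_const. Qed.

Definition hev0 (a : hur) : B := a 0%N.
Fact hev0_zmod : zmod_morphism hev0. Proof. by []. Qed.
Fact hev0_monoid : monoid_morphism hev0. Proof. by []. Qed.
HB.instance Definition _ := GRing.isZmodMorphism.Build hur B hev0 hev0_zmod.
HB.instance Definition _ := GRing.isMonoidMorphism.Build hur B hev0 hev0_monoid.

Fact hconst_zmod : zmod_morphism hconst.
Proof. by move=> x y; apply: funext => -[|n] //; rewrite -[RHS]/(0 - 0) subr0. Qed.
Fact hconst_monoid : monoid_morphism hconst.
Proof.
by split=> // x y; apply: funext => n; rewrite hconstM; case: n => //= n; rewrite mulr0.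
Qed.
HB.instance Definition _ := GRing.isZmodMorphism.Build B hur hconst hconst_zmod.
HB.instance Definition _ := GRing.isMonoidMorphism.Build B hur hconst hconst_monoid.

Lemma hsh_const b : hsh (hconst b) = 0. Proof. exact: funext. Qed.

Lemma hsh1 : hsh 1 = 0. Proof. exact: hsh_const. Qed.

Definition hxi (l : nat) : hur := fun n => (n == l)%:R.
Lemma hsh_xi l : hsh (hxi l.+1) = hxi l. Proof. by apply: funext. Qed.
Lemma hsh_xi0 : hsh (hxi 0) = 0. Proof. by apply: funext. Qed.

Lemma hshX (a : hur) n : hsh (a ^+ n.+1) = (a ^+ n * hsh a) *+ n.+1.
Proof.
elim: n => [|n IH]; first by rewrite expr0 mul1r.
by rewrite exprS hshM IH mulrC mulrnAr mulrA -exprS -mulrS.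
Qed.
End Hurwitz.

Section HurwitzPD.
Variables (B : comPzRingType) (I : B -> Prop) (gam : nat -> B -> B).
Hypothesis ax : is_pd I gam.
Let BP : pdring := PDRing ax.
Implicit Types a b : hur B.

Definition hur_ideal a := I (a 0%N).
(* The derivative of [delta_(n+1) a] must be [delta_n a] times that of [a]. *)
Fixpoint hur_pow (n : nat) a : hur B :=
  if n is m.+1 then
    fun k => if k is l.+1 then (hur_pow m a * hsh a) l else gam m.+1 (a 0%N)
  else 1.

Lemma hsh_pow n a : hsh (hur_pow n.+1 a) = hur_pow n a * hsh a. Proof. by []. Qed.
Lemma hsh_pow0 a : hsh (hur_pow 0 a) = 0. Proof. exact: hsh_const. Qed.
Lemma hur_pow_ev0 n a : hur_ideal a -> hur_pow n a 0%N = gam n (a 0%N).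
Proof. by case: n => //= Ia; rewrite (pd_0 ax). Qed.

Lemma hur_sum0 (T : Type) (r : seq T) (P : pred T) (F : T -> hur B) :
  (\sum_(i <- r | P i) F i) 0%N = \sum_(i <- r | P i) F i 0%N.
Proof. exact: (big_morph (fun a : hur B => a 0%N)). Qed.

(** The constant terms agree by the axiom in [B], and the derivatives agree by the case of total
    degree [m + n - 1], the binomials combining by Pascal's rule. *)
Let powM m n a : hur_ideal a ->
  hur_pow m a * hur_pow n a = 'C(m + n, m)%:R * hur_pow (m + n) a.
Proof.
move=> Ia; have [N] := ubnP (m + n); elim: N m n => // N IH m n mnN.
have natE k : k%:R = hconst (k%:R : B) by rewrite rmorph_nat.
apply: hur_ext.
  rewrite natE hconstM -[LHS]/(hur_pow m a 0%N * hur_pow n a 0%N).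
  by rewrite !hur_pow_ev0 // (pd_M ax).
rewrite !hshM natE hsh_const mul0r add0r -natE.
case: m n mnN => [|m] [|n] mnN; rewrite ?addn0 ?add0n ?addSn ?hsh_pow0 ?hsh_pow.
- by rewrite mul0r !mulr0 addr0.
- by rewrite mul0r add0r bin0 [hur_pow 0 a]/(1 : hur B) !mul1r.
- by rewrite mulr0 addr0 [hur_pow 0 a]/(1 : hur B) mulr1 binn mul1r.
have mnN' : (m + n.+1 < N)%N by move: mnN; rewrite addSn ltnS.
rewrite mulrAC !mulrA -mulrDl !IH ?addSnnS //.
by rewrite -mulrDl -natrD [X in X%:R]addnC -binS.
Qed.

Let pow1 a : hur_ideal a -> hur_pow 1 a = a.
Proof.
move=> Ia; apply: hur_ext; first by rewrite hur_pow_ev0 // (pd_1 ax).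
by rewrite hsh_pow mul1r.
Qed.

Let powS_mul n a : hur_ideal a -> a * hur_pow n a = hur_pow n.+1 a *+ n.+1.
Proof. by move=> Ia; rewrite -{1}(pow1 Ia) powM // add1n bin1 mulr_natl. Qed.

Lemma hur_ideal_is_ideal : is_ideal hur_ideal.
Proof.
split; first exact: (@pdi0 BP).
  by move=> x y; apply: (@pdiD BP).
by move=> b x; apply: (@pdiM BP).
Qed.

Let powD n a b : hur_ideal a -> hur_ideal b ->
  hur_pow n (a + b) = \sum_(i < n.+1) hur_pow i a * hur_pow (n - i) b.
Proof.
move=> Ia Ib; have Iab : hur_ideal (a + b) by apply: (@pdiD BP).
elim: n => [|n IH]; first by rewrite big_ord1 [LHS]/(1 : hur B) mul1r.
apply: hur_ext.
  rewrite hur_pow_ev0 // hur_sum0 (pd_D ax) //; apply: eq_bigr => i _.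
  by rewrite -!hur_pow_ev0.
rewrite hsh_pow IH (additive_map_sum (@hshD B)).
under [RHS]eq_bigr do rewrite hshM.
rewrite big_split /= hshD mulrDr !mulr_suml; congr (_ + _).
  rewrite [RHS]big_ord_recl /= hsh1 mul0r add0r; apply: eq_bigr => i _.
  by rewrite /bump /= add1n subSS hsh_pow mulrAC.
rewrite [RHS]big_ord_recr /= subnn hsh1 mulr0 addr0; apply: eq_bigr => i _.
by rewrite subSn ?hsh_pow ?mulrA // -ltnS.
Qed.

Let powZ n b a : hur_ideal a -> hur_pow n (b * a) = b ^+ n * hur_pow n a.
Proof.
move=> Ia; have Iba : hur_ideal (b * a) by apply: (@pdiM BP).
elim: n => [|n IH]; first by rewrite expr0 mul1r.
apply: hur_ext.
  rewrite hur_pow_ev0 // -[RHS]/((b ^+ n.+1) 0%N * hur_pow n.+1 a 0%N) hur_pow_ev0 //.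
  by rewrite (rmorphXn (@hev0 B) _ b : (b ^+ n.+1) 0%N = _) -(pd_Z ax).
rewrite hsh_pow IH !hshM hshX hsh_pow mulrDr mulrnAl -mulrnAr -powS_mul // exprSr.
by congr (_ + _); ring.
Qed.

Let pow_comp m n a : hur_ideal a -> (0 < m)%N -> hur_pow n (hur_pow m a) =
  ((n * m)`! %/ (n`! * m`! ^ n))%:R * hur_pow (n * m) a.
Proof.
move=> Ia; case: m => // m _.
have Ima : hur_ideal (hur_pow m.+1 a) by apply: (pd_stable ax).
have natE k : k%:R = hconst (k%:R : B) by rewrite rmorph_nat.
elim: n => [|n IH]; first by rewrite mul0n mulr1.
apply: hur_ext.
  by rewrite natE hconstM !hur_pow_ev0 // (pd_comp ax).
rewrite pd_comp_coefS natE hshM hsh_const mul0r add0r -natE hsh_pow IH.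
rewrite mulSn addSn !hsh_pow natrM -!mulrA; congr (_ * _).
by rewrite !mulrA [X in X * _]mulrC powM.
Qed.

Lemma hur_is_pd : is_pd hur_ideal hur_pow.
Proof.
split=> //; first exact: hur_ideal_is_ideal.
by move=> [|n] a Ia n0 //; apply: (pd_stable ax).
Qed.

Lemma hur_pow_const n (c : B) : I c -> hur_pow n (hconst c) = hconst (gam n c).
Proof.
move=> Ic; case: n => [|n]; first by rewrite (pd_0 ax) ?rmorph1.
by apply: hur_ext; rewrite // hsh_pow !hsh_const mulr0.
Qed.

Lemma hur_pow_xi n : hur_pow n (hxi B 1) = hxi B n.
Proof.
elim: n => [|n IH]; first by apply: funext => -[].
apply: hur_ext; first exact: (@pd_pow_0 BP n.+1).
by rewrite hsh_pow IH hsh_xi hsh_xi [hxi B 0](_ : _ = 1) ?mulr1 //; apply: funext => -[].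
Qed.
End HurwitzPD.

(** * Divided powers on subrings, quotients and split extensions *)

Section PDTransfer.
Variables (B C : comPzRingType) (K : B -> Prop) (eps : nat -> B -> B).
Hypothesis ax : is_pd K eps.
Let BP : pdring := PDRing ax.

Lemma is_pd_sub (v : {rmorphism C -> B}) (L : C -> Prop) : injective v ->
  is_ideal L -> (forall x, L x -> K (v x)) ->
  (forall x n, L x -> (0 < n)%N -> exists2 y, L y & v y = eps n (v x)) ->
  exists2 eps', is_pd L eps' & forall n x, L x -> v (eps' n x) = eps n (v x).
Proof.
move=> v_inj Lid LK Lst.
have E n x : exists y, L x -> v y = eps n (v x) /\ ((0 < n)%N -> L y).
  case: (pselect (L x)) => [Lx|]; last by exists 0.
  case: n => [|n]; first by exists 1; rewrite rmorph1 (pd_0 ax) //; apply: LK.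
  by have [y Ly vy] := Lst x n.+1 Lx isT; exists y.
pose eps' n x := projT1 (cid (E n x)).
have epsE n x : L x -> v (eps' n x) = eps n (v x).
  by rewrite /eps'; case: cid => y /= h /h[].
exists eps' => //; split=> //.
- by move=> n x Lx n0; rewrite /eps'; case: cid => y /= /(_ Lx)[_ /(_ n0)].
- by move=> x Lx; apply: v_inj; rewrite epsE // rmorph1 (pd_0 ax) //; apply: LK.
- by move=> x Lx; apply: v_inj; rewrite epsE // (pd_1 ax) //; apply: LK.
- case: Lid => _ LD _ n x y Lx Ly; apply: v_inj; rewrite epsE; last exact: LD.
  rewrite rmorphD (pd_D ax); [|exact: LK|exact: LK].
  by rewrite rmorph_sum; apply: eq_bigr => i _; rewrite rmorphM !epsE.
- case: Lid => _ _ LM n b x Lx; apply: v_inj; rewrite epsE; last exact: LM.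
  by rewrite rmorphM (pd_Z ax) ?rmorphM ?rmorphXn ?epsE //; apply: LK.
- move=> m n x Lx; apply: v_inj; rewrite !rmorphM !epsE //= (pd_M ax); last exact: LK.
  by rewrite rmorph_nat.
- move=> m n x Lx m0; apply: v_inj; rewrite epsE; last first.
    by rewrite /eps'; case: cid => y /= /(_ Lx)[_ /(_ m0)].
  by rewrite rmorphM !epsE // (pd_comp ax) ?rmorph_nat //; apply: LK.
Qed.

(** Stability is checked on generators only, because the formulas for sums and multiples carry it to
    the whole ideal; the axioms are identities that the injection [v] reflects. *)
Lemma is_pd_sub_gen (v : {rmorphism C -> B}) (S : C -> Prop) : injective v ->
  (forall x, S x -> K (v x)) ->
  (forall x n, S x -> (0 < n)%N -> exists2 y, ideal_gen S y & v y = eps n (v x)) ->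
  exists2 eps', is_pd (ideal_gen S) eps' &
    forall n x, ideal_gen S x -> v (eps' n x) = eps n (v x).
Proof.
move=> v_inj SK Sst.
have SM b x : ideal_gen S x -> ideal_gen S (b * x) by apply: ideal_genM.
have LK x : ideal_gen S x -> K (v x).
  elim=> [y /SK //||y z _ Ky _ Kz|b y _ Ky]; rewrite ?rmorph0 ?rmorphD ?rmorphM.
  - exact: (@pdi0 BP).
  - exact: (@pdiD BP).
  - exact: (@pdiM BP).
apply: is_pd_sub => //.
  by split=> //; [exact: span0 | move=> *; apply: spanD].
move=> x n Lx n0; elim: Lx n n0 => [y Sy n n0||y z Ly IHy Lz IHz|b y Ly IHy].
- exact: Sst.
- move=> n n0; exists 0; first exact: span0.
  by rewrite rmorph0; apply/esym; apply: (@pd_pow_0 BP).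
- move=> n n0; have E i : exists z', v z' = eps i (v z).
    case: i => [|i]; last by have [w _ vw] := IHz i.+1 isT; exists w.
    by exists 1; rewrite rmorph1 (pd_0 ax) //; apply: LK.
  have E' i : exists2 y', v y' = eps i (v y) & (0 < i)%N -> ideal_gen S y'.
    case: i => [|i]; last by have [w Sw vw] := IHy i.+1 isT; exists w.
    by exists 1; rewrite // rmorph1 (pd_0 ax) //; apply: LK.
  have [z' Sz' vz'] := IHz _ n0.
  (* The addition formula with its term of index 0, which is [delta_n z], split off; every other
     term contains some [delta_(i+1) y] and so stays in the ideal. *)
  exists (z' + \sum_(i < n) s2val (cid2 (E' i.+1)) * projT1 (cid (E (n - i.+1)%N))).
    apply: spanD => //; apply: big_ind => [||i _]; [exact: span0|by move=> ? ?; apply: spanD|].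
    by rewrite mulrC; apply: SM; case: cid2 => w /= _; apply.
  rewrite !rmorphD rmorph_sum (pd_D ax); [|exact: LK|exact: LK].
  rewrite big_ord_recl /= subn0 (pd_0 ax) ?mul1r ?vz'; last exact: LK.
  by congr (_ + _); apply: eq_bigr => i _; rewrite rmorphM; case: cid2; case: cid => /= ? -> ? ->.
- move=> n n0; have [w Sw vw] := IHy _ n0; exists (b ^+ n * w); first exact: SM.
  by rewrite !rmorphM rmorphXn vw (pd_Z ax) //; apply: LK.
Qed.

(** The image of [eps n x] is independent of the lift [x]: changing [x] by an element [z] of the
    kernel adds terms containing [eps i z] with [i > 0], which die by hypothesis. *)
Lemma is_pd_quot (phi : {rmorphism B -> C}) : surjective phi ->
  (forall x n, K x -> phi x = 0 -> (0 < n)%N -> phi (eps n x) = 0) ->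
  exists2 eps', is_pd (fun y => exists2 x, K x & y = phi x) eps' &
    forall n x, K x -> eps' n (phi x) = phi (eps n x).
Proof.
move=> phi_surj Kst.
have wd n x y : K x -> K y -> phi x = phi y -> phi (eps n x) = phi (eps n y).
  move=> Kx Ky xy; have Kz : K (x - y) by apply: (@pdiB BP).
  have z0 : phi (x - y) = 0 by rewrite rmorphB xy subrr.
  rewrite -[x](subrK y) addrC (pd_D ax) // rmorph_sum big_ord_recr /= subnn.
  rewrite (pd_0 ax) // mulr1 big1 ?add0r // => i _.
  by rewrite rmorphM [X in _ * X]Kst ?mulr0 // subn_gt0.
pose im y := exists2 x, K x & y = phi x.
pose eps' n y := if pselect (im y) is left h then phi (eps n (s2val (cid2 h))) else 0.
have epsE n x : K x -> eps' n (phi x) = phi (eps n x).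
  move=> Kx; rewrite /eps'; case: pselect => [h|[]]; last by exists x.
  by case: (cid2 h) => /= z Kz /esym; apply: wd.
exists eps' => //; split.
- split; first by exists 0; [exact: (@pdi0 BP) | rewrite rmorph0].
    by move=> _ _ [x Kx ->] [y Ky ->]; exists (x + y); [exact: (@pdiD BP) | rewrite rmorphD].
  move=> b _ [x Kx ->]; have [c <-] := phi_surj b.
  by exists (c * x); [exact: (@pdiM BP) | rewrite rmorphM].
- by move=> n _ [x Kx ->] n0; rewrite epsE //; exists (eps n x) => //; apply: (pd_stable ax).
- by move=> _ [x Kx ->]; rewrite epsE // (pd_0 ax) ?rmorph1.
- by move=> _ [x Kx ->]; rewrite epsE // (pd_1 ax).
- move=> n _ _ [x Kx ->] [y Ky ->]; rewrite -rmorphD epsE; last exact: (@pdiD BP).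
  by rewrite (pd_D ax) // rmorph_sum; apply: eq_bigr => i _; rewrite rmorphM !epsE.
- move=> n b _ [x Kx ->]; have [c <-] := phi_surj b.
  rewrite -rmorphM !epsE //; last exact: (@pdiM BP).
  by rewrite (pd_Z ax) // rmorphM rmorphXn.
- by move=> m n _ [x Kx ->]; rewrite !epsE // -rmorphM (pd_M ax) // rmorphM rmorph_nat.
- move=> m n _ [x Kx ->] m0; rewrite !epsE //; last exact: (pd_stable ax).
  by rewrite (pd_comp ax) // rmorphM rmorph_nat.
Qed.
End PDTransfer.

Definition compat_gen (A B : pdring) (iB : A -> B) : B -> Prop :=
  fun y => pd_ideal y \/ ext_ideal iB y.

Lemma compat_gen_map (A B C : pdring) (h : {rmorphism B -> C}) (iB : A -> B) (iC : A -> C) :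
  (forall x, pd_ideal x -> pd_ideal (h x)) -> h \o iB =1 iC ->
  forall x, ideal_gen (compat_gen iB) x -> ideal_gen (compat_gen iC) (h x).
Proof.
move=> hI hA x; elim=> [y [Iy|]||y z _ Iy _ Iz|b y _ Iy]; rewrite ?rmorph0 ?rmorphD ?rmorphM.
- by apply: span_gen; left; apply: hI.
- elim=> [_ [a Ia ->]||z w _ IHz _ IHw|b z _ IHz]; rewrite ?rmorph0 ?rmorphD ?rmorphM.
  + apply: span_gen; right; apply: span_gen; exists a => //; exact: hA.
  + exact: span0.
  + exact: spanD.
  + exact: ideal_genM.
- exact: span0.
- exact: spanD.
- exact: ideal_genM.
Qed.

Lemma ext_compat_gen (A B : pdring) (iB : A -> B) a : pd_ideal a ->
  ideal_gen (compat_gen iB) (iB a).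
Proof. by move=> Ia; apply: span_gen; right; apply: span_gen; exists a. Qed.

Lemma pd_compatible_sub (A B C : pdring) (iB : {rmorphism A -> B})
    (iC : {rmorphism A -> C}) (v : {rmorphism C -> B}) : injective v ->
  v \o iC =1 iB -> pd_morph v -> pd_compatible iB -> pd_compatible iC.
Proof.
move=> v_inj vA vpd [eps [ax epsI epsA]].
have SK x : compat_gen iC x -> ideal_gen (compat_gen iB) (v x).
  by move=> Sx; apply: (compat_gen_map _ vA); [move=> y /vpd[] | exact: span_gen].
have axC := pd_ax C.
suff [eps' ax' epsE] : exists2 eps', is_pd (ideal_gen (compat_gen iC)) eps' &
    forall n x, ideal_gen (compat_gen iC) x -> v (eps' n x) = eps n (v x).
  exists eps'; split=> // [n x Ix|n a Ia]; apply: v_inj; rewrite epsE.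
  - by have [Ivx ->] := vpd _ Ix; rewrite epsI.
  - by apply: span_gen; left.
  - by rewrite [v (iC a)]vA [v (iC _)]vA epsA.
  - exact: ext_compat_gen.
pose S' (x : C) := pd_ideal x \/ exists2 a, pd_ideal a & x = iC a.
have SE : ideal_gen (compat_gen iC) = ideal_gen S'.
  apply: funext => x; apply/propext; split.
    elim=> [y [Iy|]||y z _ Iy _ Iz|b y _ Iy].
    - by apply: span_gen; left.
    - elim=> [z Sz||z w _ IHz _ IHw|b z _ IHz].
      + by apply: span_gen; right.
      + exact: span0.
      + exact: spanD.
      + exact: spanZ.
    - exact: span0.
    - exact: spanD.
    - exact: spanZ.
  elim=> [y [Iy|[a Ia ->]]||y z _ Iy _ Iz|b y _ Iy].
  - by apply: span_gen; left.
  - exact: ext_compat_gen.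
  - exact: span0.
  - exact: spanD.
  - exact: spanZ.
rewrite SE; apply: (is_pd_sub_gen ax) => // [x [Ix|[a Ia ->]]|x n [Ix|[a Ia ->]] n0].
- by apply: SK; left.
- by apply: SK; right; apply: span_gen; exists a.
- have [Ivx vE] := vpd _ Ix; exists (pd_pow n x); last by rewrite vE epsI.
  by apply: span_gen; left; apply: (pd_stable axC).
- exists (iC (pd_pow n a)); last by rewrite [v (iC a)]vA [v (iC _)]vA epsA.
  by apply: span_gen; right; exists (pd_pow n a) => //; apply: (pd_stable (pd_ax A)).
Qed.

Lemma pd_compatible_quot (A B C : pdring) (iB : {rmorphism A -> B})
    (iC : {rmorphism A -> C}) (phi : {rmorphism B -> C}) : surjective phi ->
  phi \o iB =1 iC -> pd_morph phi ->
  (forall y, pd_ideal y -> exists2 x, pd_ideal x & y = phi x) ->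
  (forall x, phi x = 0 -> pd_ideal x) -> pd_compatible iB -> pd_compatible iC.
Proof.
move=> phi_surj phiA phipd phiI kerI [eps [ax epsI epsA]].
have [x n Kx x0 n0|eps' ax' epsE] := is_pd_quot ax phi_surj.
  have Ix := kerI _ x0; have [_ phiE] := phipd _ Ix.
  by rewrite epsI // phiE x0 pd_pow_0.
exists eps'; split=> [|n y Iy|n a Ia].
- rewrite (_ : ideal_gen _ = fun y => exists2 x, ideal_gen (compat_gen iB) x & y = phi x) //.
  apply: funext => y; apply/propext; split=> [|[x Kx ->]]; last first.
    by apply: (compat_gen_map _ phiA) Kx => z /phipd[].
  elim=> [z [/phiI [x Ix ->]|]||z w _ [x Kx ->] _ [t Kt ->]|b z _ [x Kx ->]].
  + by exists x => //; apply: span_gen; left.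
  + elim=> [_ [a Ia ->]||w t _ [x Kx ->] _ [u Ku ->]|b w _ [x Kx ->]].
    * by exists (iB a); [exact: ext_compat_gen | exact/esym/phiA].
    * by exists 0; [exact: span0 | rewrite rmorph0].
    * by exists (x + u); [exact: spanD | rewrite rmorphD].
    * by have [c <-] := phi_surj b; exists (c * x); [exact: spanZ | apply/esym/rmorphM].
  + by exists 0; [exact: span0 | rewrite rmorph0].
  + by exists (x + t); [exact: spanD | rewrite rmorphD].
  + by have [c <-] := phi_surj b; exists (c * x); [exact: spanZ | apply/esym/rmorphM].
- have [x Ix ->] := phiI _ Iy; rewrite epsE; last by apply: span_gen; left.
  by rewrite epsI //; have [_ ->] := phipd _ Ix.
- rewrite -[iC a]phiA -[iC _]phiA /= epsE ?epsA //; exact: ext_compat_gen.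
Qed.

(** [Q] is a uniform recipe extending divided powers from [B] to the split extension [C]. Applied to
    the structure on $K + I_0 B$ instead of that on $K$, it gives the structure that compatibility
    of [C] asks for. The relevant ideal of [C] is the preimage under [p], because the kernel of [p]
    lies in the divided power ideal. *)
Lemma pd_compatible_split (A B C : pdring) (iB : {rmorphism A -> B})
    (s : {rmorphism B -> C}) (p : {rmorphism C -> B}) (Q : (nat -> B -> B) -> nat -> C -> C) :
  cancel s p -> (forall x, pd_ideal x <-> pd_ideal (p x)) ->
  (forall K eps, is_pd K eps -> is_pd (fun x => K (p x)) (Q eps)) ->
  (forall K eps, is_pd K eps -> forall n b, K b -> Q eps n (s b) = s (eps n b)) ->
  (forall K eps, is_pd K eps -> (forall x, pd_ideal x -> K x) ->
     (forall n x, pd_ideal x -> eps n x = pd_pow n x) ->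
     forall n x, pd_ideal x -> Q eps n x = pd_pow n x) ->
  pd_compatible iB -> pd_compatible (s \o iB).
Proof.
move=> sK pI Qpd Qs QI [eps [ax epsI epsA]]; exists (Q eps); split.
- rewrite (_ : ideal_gen _ = fun x => ideal_gen (compat_gen iB) (p x)); first exact: Qpd.
  apply: funext => x; apply/propext; split=> [|Kx].
    apply: (@compat_gen_map _ _ _ p); first by move=> y /pI.
    by move=> a; rewrite /= sK.
  have -> : x = s (p x) + (x - s (p x)) by rewrite addrC subrK.
  apply: spanD.
    apply: (@compat_gen_map _ _ _ s _ (s \o iB)) Kx => //.
    by move=> y Iy; apply/pI; rewrite sK.
  by apply: span_gen; left; apply/pI; rewrite rmorphB sK subrr; apply: pdi0.
- by move=> n x Ix; apply: (QI _ _ ax) => // y Iy; apply: span_gen; left.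
- by move=> n a Ia; rewrite /= (Qs _ _ ax) ?epsA //; apply: ext_compat_gen.
Qed.

Definition sqz_pd (B : pdring) (N : lmodType B) : pdring := PDRing (sqz_is_pd N (pd_ax B)).

Section SquareZeroMaps.
Variables (B : pdring) (N : lmodType B).

Lemma sqz_in_pd : pd_morph (sqz_in N : B -> sqz_pd N).
Proof. by move=> x Ix; split=> // n; apply/esym; apply: sqz_pow_in. Qed.

Lemma sqz_fst_pd : pd_morph (@sqz_fst _ N : sqz_pd N -> B).
Proof. by []. Qed.

Lemma sqz_compatible (A : pdring) (iB : {rmorphism A -> B}) :
  pd_compatible iB -> pd_compatible (sqz_in N \o iB : A -> sqz_pd N).
Proof.
apply: (@pd_compatible_split A B (sqz_pd N) iB (sqz_in N) (@sqz_fst _ N) (fun eps n => @sqz_pow B N eps n)) => //.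
- by move=> K eps ax; apply: sqz_is_pd.
- by move=> K eps ax n b; apply: sqz_pow_in.
move=> K eps ax JK epsE n x Jx; apply: sqz_ext; rewrite /= ?epsE //.
by case: n => // n; rewrite epsE.
Qed.

Variables (C : pdring) (f : {rmorphism C -> B}) (der : C -> N).
Hypothesis derD : additive_map der.
Hypothesis derM : forall x y, der (x * y) = f x *: der y + f y *: der x.

Definition sqz_pair (x : C) : sqz_pd N := (f x, der x).
Fact sqz_pair_zmod : zmod_morphism sqz_pair.
Proof. by move=> x y; apply: sqz_ext; rewrite /= ?rmorphB ?(additive_mapB derD). Qed.
Fact sqz_pair_monoid : monoid_morphism sqz_pair.
Proof.
split=> [|x y]; last by apply: sqz_ext; rewrite /= ?rmorphM ?derM.
apply: sqz_ext; rewrite /= ?rmorph1 //.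
apply: (addrI (der 1)); rewrite addr0 -[RHS](scale1r (der 1)) -{1 2}(scale1r (der 1)).
by rewrite -{1 2}(rmorph1 f) -derM mulr1 scale1r.
Qed.
Definition sqz_pairR : {rmorphism C -> sqz_pd N} := HB.pack sqz_pair
  (GRing.isZmodMorphism.Build C (sqz_pd N) sqz_pair sqz_pair_zmod)
  (GRing.isMonoidMorphism.Build C (sqz_pd N) sqz_pair sqz_pair_monoid).

Lemma sqz_pair_pd : pd_morph f ->
  (forall n x, pd_ideal x -> der (pd_pow n.+1 x) = pd_pow n (f x) *: der x) ->
  pd_morph sqz_pairR.
Proof.
move=> fpd derpd x Ix; have [Ifx fE] := fpd _ Ix; split=> // n.
apply: sqz_ext => /=; first exact: fE.
case: n => [|n]; last exact: derpd.
rewrite (pd_0 (pd_ax C)) //.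
by have /(congr1 snd) := sqz_pair_monoid.1.
Qed.
End SquareZeroMaps.

(* The ring of dual numbers; [eps] is the image of [1] in the square zero ideal. *)
Definition dual (B : pdring) : pdring := sqz_pd (B^o : lmodType B).
Definition dual_eps (B : pdring) : dual B := (0, 1).
Definition dual_in (B : pdring) : {rmorphism B -> dual B} := sqz_in (B^o : lmodType B).
Definition dual_fst (B : pdring) : {rmorphism dual B -> B} := @sqz_fst B (B^o : lmodType B).

Lemma dualE (B : pdring) (z : dual B) : z = dual_in B z.1 + dual_eps B * dual_in B z.2.
Proof.
case: z => a b; apply: sqz_ext => /=; first by rewrite mul0r addr0.
by rewrite scaler0 add0r [_ *: _]mulr1 add0r.
Qed.

Section DualMap.
Variables (B C : pdring) (h : {rmorphism B -> C}) (hpd : pd_morph h).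
Let der (z : dual B) : C^o := h z.2.
Let derD : additive_map der. Proof. by move=> x y; apply: rmorphD. Qed.
Let derM (x y : dual B) : der (x * y) =
  (h \o dual_fst B) x *: der y + (h \o dual_fst B) y *: der x.
Proof. by rewrite /der /= rmorphD !rmorphM. Qed.
Definition dual_map : {rmorphism dual B -> dual C} := sqz_pairR derD derM.
Lemma dual_map_pd : pd_morph dual_map.
Proof.
apply: sqz_pair_pd => [x /hpd[]//|n x Ix].
by have [_ hE] := hpd Ix; rewrite /der /= rmorphM hE.
Qed.
End DualMap.

Section DualSwap.
Variable B : pdring.
(** Exchanges the two infinitesimals of the iterated dual numbers, where second derivatives appear
    as coefficients of their product. *)
Definition dual_swap_fun (z : dual (dual B)) : dual (dual B) :=
  ((z.1.1, z.2.1), (z.1.2, z.2.2)).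
Fact dual_swap_zmod : zmod_morphism dual_swap_fun.
Proof. by move=> [[a b] [c d]] [[a' b'] [c' d']]. Qed.
Fact dual_swap_monoid : monoid_morphism dual_swap_fun.
Proof.
split=> // [[[a b] [c d]] [[a' b'] [c' d']]].
rewrite /dual_swap_fun /=; congr ((_, _), (_, _)).
change (a * d' + c' * b + (a' * d + c * b') =
  (a * d' + b' * c) + (a' * d + b * c') :> B); ring.
Qed.
HB.instance Definition _ := GRing.isZmodMorphism.Build (dual (dual B)) (dual (dual B))
  dual_swap_fun dual_swap_zmod.
HB.instance Definition _ := GRing.isMonoidMorphism.Build (dual (dual B)) (dual (dual B))
  dual_swap_fun dual_swap_monoid.
Definition dual_swap : {rmorphism dual (dual B) -> dual (dual B)} := dual_swap_fun.
Lemma dual_swap_pd : pd_morph dual_swap.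
Proof.
move=> [[a b] [c d]] /= Ia; split=> // -[|[|n]] //.
  apply: sqz_ext => //; apply: sqz_ext => //=.
  change (pd_pow 0 a * d + c * 0 = pd_pow 0 a * d + b * 0).
  by rewrite !mulr0.
apply: sqz_ext => //; apply: sqz_ext => //=.
change (pd_pow n.+1 a * d + c * (pd_pow n a * b) = pd_pow n.+1 a * d + b * (pd_pow n a * c)).
ring.
Qed.
End DualSwap.

Definition hur_pd (B : pdring) : pdring := PDRing (hur_is_pd (pd_ax B)).

Section FiniteSequences.
Variable B : comPzRingType.

Definition fin_hur : {pred hur B} := fun a => `[< ev0 a >].

Lemma fin_hur_sh a : (hsh a \in fin_hur) = (a \in fin_hur).
Proof.
apply/asboolP/asboolP => [[L aL]|]; last exact: ev0_shift.
by exists L.+1 => -[//|l] /aL.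
Qed.

Lemma fin_hur_subring : subring_closed fin_hur.
Proof.
split; first by apply/asboolP; exists 1%N => -[].
  move=> a b /asboolP fa /asboolP [L bL]; apply/asboolP; apply: ev0D => //.
  by exists L => l lL; rewrite -[LHS]/(- b l) bL ?oppr0.
move=> a b /asboolP [L aL] /asboolP [M bM]; apply/asboolP; exists (L + M)%N => n.
elim: n L M a aL b bM => [|n IH] L M a aL b bM nLM.
  rewrite leqn0 addn_eq0 in nLM; case/andP: nLM => /eqP L0 _.
  by rewrite -[LHS]/(a 0%N * b 0%N) aL ?mul0r // L0.
have fin0 (c : hur B) : (forall l, (0 <= l)%N -> c l = 0) -> c = 0.
  by move=> c0; apply: funext => l; apply: c0.
case: L aL nLM => [|L] aL nLM.
  by rewrite (fin0 a) // mul0r.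
case: M bM nLM => [|M] bM nLM; first by rewrite (fin0 b) // mulr0.
rewrite -[LHS]/((hsh a * b) n + (a * hsh b) n).
have aL' l : (L <= l)%N -> hsh a l = 0 by move=> lL; apply: aL.
have bM' l : (M <= l)%N -> hsh b l = 0 by move=> lM; apply: bM.
by rewrite (IH L M.+1 (hsh a)) ?(IH L.+1 M a _ (hsh b)) ?addr0 //; lia.
Qed.
HB.instance Definition _ := GRing.isSubringClosed.Build (hur B) fin_hur fin_hur_subring.

End FiniteSequences.

Section Subring.
Variables (B : comPzRingType) (S : subringClosed B).
Definition subr := {a : B | a \in S}.
HB.instance Definition _ := SubType.on subr.
HB.instance Definition _ := [Choice of subr by <:].
HB.instance Definition _ :=
  GRing.SubChoice_isSubComPzRing.Build B (S : {pred B}) subr (GRing.subringClosedP S).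
Definition subr_val : {rmorphism subr -> B} := val.
Lemma subr_inj : injective subr_val. Proof. exact: val_inj. Qed.

Section Corestriction.
Variables (C : comPzRingType) (f : {rmorphism C -> B}) (fS : forall x, f x \in S).
Definition subr_fun (x : C) : subr := exist _ (f x) (fS x).
Fact subr_fun_zmod : zmod_morphism subr_fun.
Proof. by move=> x y; apply: subr_inj; rewrite rmorphB /= rmorphB. Qed.
Fact subr_fun_monoid : monoid_morphism subr_fun.
Proof. by split=> [|x y]; apply: subr_inj; rewrite ?rmorph1 ?rmorphM /= ?rmorph1 ?rmorphM. Qed.
Definition subr_in : {rmorphism C -> subr} := HB.pack subr_fun
  (GRing.isZmodMorphism.Build C subr subr_fun subr_fun_zmod)
  (GRing.isMonoidMorphism.Build C subr subr_fun subr_fun_monoid).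
End Corestriction.
End Subring.

Lemma is_pd_subr (B : pdring) (S : subringClosed B) :
  (forall n x, x \in S -> pd_ideal x -> pd_pow n x \in S) ->
  {eps | is_pd (fun x : subr S => pd_ideal (subr_val S x)) eps &
    forall n x, pd_ideal (subr_val S x) -> subr_val S (eps n x) = pd_pow n (subr_val S x)}.
Proof.
move=> Sst; apply: cid2.
apply: (is_pd_sub (pd_ax B) (v := subr_val S) (L := fun x => pd_ideal (subr_val S x))) => //.
- exact: subr_inj.
- split=> [|x y Ix Iy|b x Ix]; rewrite ?rmorph0 ?rmorphD ?rmorphM.
  + exact: pdi0.
  + exact: pdiD.
  + exact: pdiM.
- move=> x n Ix n0; have Sx := valP x.
  exists (exist (fun y : B => y \in S) _ (Sst n _ Sx Ix) : subr S) => //=.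
  exact: (pd_stable (pd_ax B)).
Qed.

Section SubPD.
Variables (B : pdring) (S : subringClosed B).
Hypothesis Sst : forall n x, x \in S -> pd_ideal x -> pd_pow n x \in S.

Definition sub_pd : pdring := PDRing (s2valP (is_pd_subr Sst)).
Lemma sub_pdE n (x : sub_pd) : pd_ideal x ->
  subr_val S (pd_pow n x) = pd_pow n (subr_val S x).
Proof. exact: (s2valP' (is_pd_subr Sst)). Qed.
Lemma sub_pd_val : pd_morph (subr_val S : sub_pd -> B).
Proof. by move=> x Ix; split=> // n; rewrite sub_pdE. Qed.
End SubPD.

(** * Divided power polynomials in one variable *)

Section PolyPD.
Variable B : pdring.

Lemma fin_hur_pow n (a : hur_pd B) : a \in @fin_hur B -> pd_ideal a ->
  pd_pow n a \in @fin_hur B.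
Proof.
move=> fa Ia; elim: n => [|n IH]; first exact: rpred1.
by rewrite -fin_hur_sh [hsh _](@hsh_pow B) rpredM // fin_hur_sh.
Qed.

(* The divided power polynomial ring in one variable [xi] over [B]. *)
Definition ppd : pdring := sub_pd fin_hur_pow.
Definition pv : {rmorphism ppd -> hur_pd B} := subr_val (@fin_hur B).

Fact fin_hconst (b : B) : hconst b \in @fin_hur B.
Proof. by apply/asboolP; exists 1%N => -[]. Qed.
Definition pc : {rmorphism B -> ppd} := subr_in fin_hconst.
Fact fin_hxi l : hxi B l \in @fin_hur B.
Proof. by apply/asboolP; exists l.+1 => n ln; rewrite /hxi gtn_eqF. Qed.
Definition pxi l : ppd := exist _ (hxi B l) (fin_hxi l).
Fact fin_hsh (a : ppd) : hsh (pv a) \in @fin_hur B.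
Proof. by rewrite fin_hur_sh; apply: (valP a). Qed.
Definition psh (a : ppd) : ppd := exist _ (hsh (pv a)) (fin_hsh a).
Definition p0 : {rmorphism ppd -> B} := @hev0 B \o pv.

Lemma pv_inj : injective pv. Proof. exact: subr_inj. Qed.
Lemma pv_pd : pd_morph pv. Proof. exact: sub_pd_val. Qed.
Lemma ppd_idealE (a : ppd) : pd_ideal a <-> pd_ideal (p0 a). Proof. by []. Qed.

Lemma pshD : additive_map psh. Proof. by move=> a b; apply: pv_inj. Qed.
Lemma pshM a b : psh (a * b) = psh a * b + a * psh b.
Proof. by apply: pv_inj. Qed.
Lemma psh_pc b : psh (pc b) = 0.
Proof. by apply: pv_inj; apply: hsh_const. Qed.
Lemma psh_pxiS l : psh (pxi l.+1) = pxi l.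
Proof. by apply: pv_inj; apply: hsh_xi. Qed.
Lemma psh_pxi0 : psh (pxi 0) = 0.
Proof. by apply: pv_inj; apply: hsh_xi0. Qed.
Lemma pxi0 : pxi 0 = 1.
Proof. by apply: pv_inj; apply: funext => -[]. Qed.
Lemma psh_pow n (a : ppd) : pd_ideal a -> psh (pd_pow n.+1 a) = pd_pow n a * psh a.
Proof.
move=> Ia; apply: pv_inj; rewrite -[LHS]/(hsh (pv (pd_pow n.+1 a))) rmorphM.
by have [_ vE] := pv_pd Ia; rewrite !vE.
Qed.
Lemma pxi_ideal l : pd_ideal (pxi l.+1). Proof. exact: pdi0. Qed.
Lemma pxi_pow n : pd_pow n (pxi 1) = pxi n.
Proof.
apply: pv_inj; have [_ ->] := pv_pd (pxi_ideal 0).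
exact: (hur_pow_xi (pd_ax B)).
Qed.
Lemma pxiM l l' : pxi l * pxi l' = pc 'C(l + l', l)%:R * pxi (l + l').
Proof.
rewrite -(pxi_pow l) -(pxi_pow l') (pd_M (pd_ax ppd)) ?pxi_pow ?rmorph_nat //.
exact: pxi_ideal.
Qed.
Lemma p0_pxi l : p0 (pxi l.+1) = 0. Proof. by []. Qed.
Lemma p0_pd : pd_morph p0.
Proof.
move=> a Ia; split=> // n; have [_ vE] := pv_pd Ia.
by rewrite -[LHS]/((pv (pd_pow n a)) 0%N) vE; apply: (hur_pow_ev0 (pd_ax B)).
Qed.
Lemma pc_pd : pd_morph pc.
Proof.
move=> b Ib; split=> // n; apply: pv_inj; have [_ ->] := pv_pd (Ib : pd_ideal (pc b)).
by apply/esym; apply: (hur_pow_const (pd_ax B)).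
Qed.

Lemma ppdE (a : ppd) L : (forall l, (L <= l)%N -> pv a l = 0) ->
  a = \sum_(l < L) pc (pv a l) * pxi l.
Proof.
move=> aL; apply: pv_inj; apply: funext => n; rewrite rmorph_sum.
have sumE : forall (F : 'I_L -> hur B), (\sum_(l < L) F l) n = \sum_(l < L) F l n.
  by move=> F; apply: (big_morph (fun f : hur B => f n)).
rewrite [RHS]sumE.
have xE (l : 'I_L) : pv (pc (pv a l) * pxi l) n = pv a l * (n == l)%:R.
  by rewrite -[LHS]/((hconst (pv a l) * hxi B l) n) hconstM.
under eq_bigr do rewrite xE; case: (leqP L n) => [Ln|nL].
  rewrite aL // big1 // => i _; rewrite gtn_eqF ?mulr0 //.
  by apply: leq_trans Ln.
rewrite (bigD1 (Ordinal nL)) //= eqxx mulr1 big1 ?addr0 // => i ne_i.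
case: eqP => [E|]; last by rewrite mulr0.
by case/eqP: ne_i; apply: val_inj.
Qed.

Lemma pv_fin a : ev0 (pv a). Proof. exact/asboolP/(valP a). Qed.

Lemma ppd_ind (Q : ppd -> Prop) : Q 0 -> (forall a b, Q a -> Q b -> Q (a + b)) ->
  (forall c l, Q (pc c * pxi l)) -> forall a, Q a.
Proof.
move=> Q0 QD Qg a; have [L aL] := pv_fin a; rewrite (ppdE aL).
by apply: big_ind.
Qed.

Lemma ppd_compatible (A : pdring) (iB : {rmorphism A -> B}) :
  pd_compatible iB -> pd_compatible (pc \o iB).
Proof.
move=> iBc; apply: (@pd_compatible_sub A (hur_pd B) ppd (@hconst B \o iB) (pc \o iB) pv) => //.
- exact: pv_inj.
- exact: pv_pd.
apply: (@pd_compatible_split A B (hur_pd B) iB (@hconst B) (@hev0 B) (@hur_pow B)) => //.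
- by move=> K eps ax; apply: hur_is_pd.
- by move=> K eps ax n b Kb; apply: (hur_pow_const ax).
move=> K eps ax JK epsE n x Jx; rewrite /pd_pow /=.
by elim: n => [//|n IH]; apply: funext => -[|k] /=; rewrite ?epsE ?IH.
Qed.

Section Universal.
Variables (E : pdring) (v : {rmorphism B -> E}) (x : E).
Hypotheses (vpd : pd_morph v) (Ix : pd_ideal x).
Let axE := pd_ax E.

Definition peval (a : ppd) : E := esum (fun l => v (pv a l) * pd_pow l x).
Let fin a : ev0 (fun l => v (pv a l) * pd_pow l x).
Proof. by have [L aL] := pv_fin a; exists L => l /aL ->; rewrite rmorph0 mul0r. Qed.
Let pevalD a b : peval (a + b) = peval a + peval b.
Proof.
rewrite -esumD //; congr esum; apply: funext => l.
by rewrite -mulrDl -rmorphD.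
Qed.
Let peval_gen c l : peval (pc c * pxi l) = v c * pd_pow l x.
Proof.
have E' n : pv (pc c * pxi l) n = c * (n == l)%:R.
  by rewrite -[LHS]/((hconst c * hxi B l) n) hconstM.
rewrite /peval (_ : (fun n => _) = fun n => v (c * (n == l)%:R) * pd_pow n x); last first.
  by apply: funext => n; rewrite E'.
rewrite (@esumE _ _ l.+1) => [|n ln]; last first.
  by rewrite gtn_eqF ?mulr0 ?rmorph0 ?mul0r.
rewrite big_ord_recr /= eqxx mulr1 big1 ?add0r // => i _.
by rewrite ltn_eqF ?mulr0 ?rmorph0 ?mul0r.
Qed.
Let pevalM a b : peval (a * b) = peval a * peval b.
Proof.
have peval0 : peval 0 = 0 := additive_map0 pevalD.
elim/ppd_ind: a => [|a a' Ha Ha'|c l]; rewrite ?mul0r ?peval0 ?mul0r //.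
  by rewrite mulrDl !pevalD mulrDl Ha Ha'.
elim/ppd_ind: b => [|b b' Hb Hb'|c' l']; rewrite ?mulr0 ?peval0 ?mulr0 //.
  by rewrite mulrDr !pevalD mulrDr Hb Hb'.
rewrite mulrACA pxiM mulrA -!rmorphM.
rewrite !peval_gen !rmorphM rmorph_nat mulrACA (pd_M axE) // !mulrA.
by [].
Qed.
Fact peval_zmod : zmod_morphism peval.
Proof. exact: additive_mapB pevalD. Qed.
Fact peval_monoid : monoid_morphism peval.
Proof.
split; last exact: pevalM.
have := peval_gen 1 0; rewrite pxi0 !rmorph1 mul1r => ->.
by rewrite mul1r (pd_0 axE).
Qed.
Definition pevalR : {rmorphism ppd -> E} := HB.pack peval
  (GRing.isZmodMorphism.Build ppd E peval peval_zmod)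
  (GRing.isMonoidMorphism.Build ppd E peval peval_monoid).

Lemma peval_pc c : pevalR (pc c) = v c.
Proof. by have := peval_gen c 0; rewrite pxi0 mulr1 (pd_0 axE) // mulr1. Qed.
Lemma peval_pxi l : pevalR (pxi l) = pd_pow l x.
Proof. by have := peval_gen 1 l; rewrite !rmorph1 !mul1r. Qed.

(** The elements at which the map respects divided powers are stable under sums and multiples. They
    include the constants from the ideal of [B] and the [xi^[l]] with [l > 0], and these generate
    the ideal. *)
Lemma peval_pd : pd_morph pevalR.
Proof.
pose G (a : ppd) := [/\ pd_ideal a, pd_ideal (pevalR a) &
  forall n, pevalR (pd_pow n a) = pd_pow n (pevalR a)].
have GD a b : G a -> G b -> G (a + b).
  move=> [Ia Ia' aE] [Ib Ib' bE]; split; rewrite ?rmorphD; try exact: pdiD.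
  move=> n; rewrite (pd_D (pd_ax ppd)) // (pd_D axE) // rmorph_sum.
  by apply: eq_bigr => i _; rewrite rmorphM aE bE.
have GM b a : G a -> G (b * a).
  move=> [Ia Ia' aE]; split; rewrite ?rmorphM; try exact: pdiM.
  by move=> n; rewrite (pd_Z (pd_ax ppd)) // (pd_Z axE) // rmorphM rmorphXn aE.
have Gc c : pd_ideal c -> G (pc c).
  move=> Ic; have [Ipc pcE] := pc_pd Ic; have [Ivc vE] := vpd Ic.
  by split=> // [|n]; rewrite peval_pc // -pcE peval_pc vE.
have Gxi l : G (pxi l.+1).
  have Il := pxi_ideal l; split=> //; rewrite ?peval_pxi.
    exact: (pd_stable axE).
  move=> n; rewrite -(pxi_pow l.+1) (pd_comp (pd_ax ppd) n (pxi_ideal 0)) //.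
  by rewrite pxi_pow (pd_comp axE) // rmorphM rmorph_nat peval_pxi.
have G0 : G 0 by rewrite -(mulr0 (pxi 1)) mulrC; apply: GM.
move=> a Ia; suff [_ ? ?] : G a by [].
have [[|L] aL] := pv_fin a; rewrite (ppdE aL); first by rewrite big_ord0.
apply: big_ind => // -[[|l] /= lL] _; last exact: GM.
by rewrite mulrC; apply: GM; apply: Gc.
Qed.
End Universal.
End PolyPD.

(** * Lifting along nil ideals *)

Lemma rmorph_factor (C P E : comPzRingType) (G : {rmorphism C -> P})
    (phi : {rmorphism C -> E}) : surjective G ->
  (forall x, G x = 0 -> phi x = 0) -> exists h : {rmorphism P -> E}, h \o G =1 phi.
Proof.
move=> Gsurj ker; pose sec y := projT1 (cid (Gsurj y)).
have secK y : G (sec y) = y by rewrite /sec; case: cid.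
pose h y := phi (sec y).
have hE x : h (G x) = phi x.
  by apply/subr0_eq; rewrite -rmorphB; apply: ker; rewrite rmorphB secK subrr.
have h_zmod : zmod_morphism h.
  move=> x y; have [a <-] := Gsurj x; have [b <-] := Gsurj y.
  by rewrite -rmorphB !hE rmorphB.
have h_mon : monoid_morphism h.
  split=> [|x y]; first by rewrite -(rmorph1 G) hE rmorph1.
  have [a <-] := Gsurj x; have [b <-] := Gsurj y.
  by rewrite -rmorphM !hE rmorphM.
pose hR : {rmorphism P -> E} := HB.pack h (GRing.isZmodMorphism.Build P E h h_zmod)
  (GRing.isMonoidMorphism.Build P E h h_mon).
by exists hR => x; apply: hE.
Qed.

Lemma ideal_gen_mono (B C : comPzRingType) (f : {rmorphism B -> C}) (S : B -> Prop)
    (S' : C -> Prop) : (forall x, S x -> ideal_gen S' (f x)) ->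
  forall x, ideal_gen S x -> ideal_gen S' (f x).
Proof.
move=> SS' x; elim=> [y /SS' //||y z _ Iy _ Iz|b y _ Iy]; rewrite ?rmorph0 ?rmorphD ?rmorphM.
- exact: span0.
- exact: spanD.
- exact: ideal_genM.
Qed.

Lemma ideal_gen_ker (B C : comPzRingType) (f : {rmorphism B -> C}) (S : B -> Prop) :
  (forall x, S x -> f x = 0) -> forall x, ideal_gen S x -> f x = 0.
Proof.
move=> S0 x; elim=> [y /S0 //||y z _ Iy _ Iz|b y _ Iy]; rewrite ?rmorph0 ?rmorphD ?rmorphM //.
  by rewrite Iy Iz addr0.
by rewrite Iy mulr0.
Qed.

Lemma qpi0P (B : comPzRingType) (S : B -> Prop) x : (qpi S x = 0) <-> ideal_gen S x.
Proof. by rewrite -(rmorph0 (qpi S)) qpiP subr0. Qed.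

Lemma qpi_surjective (B : comPzRingType) (S : B -> Prop) : surjective (qpi S).
Proof. by move=> y; have [x ->] := qpi_surj y; exists x. Qed.

Definition nilp (B : comPzRingType) (x : B) := exists n, x ^+ n = 0.

Section EtaleLifting.
Variables (T P : comPzRingType) (q : {rmorphism T -> P}).

Definition lifting (E E' : comPzRingType) (p : {rmorphism E -> E'}) :=
  forall (s : {rmorphism T -> E}) (g : {rmorphism P -> E'}), g \o q =1 p \o s ->
  exists h : {rmorphism P -> E}, h \o q =1 s /\ p \o h =1 g.

Definition lift_uniq (E E' : comPzRingType) (p : {rmorphism E -> E'}) :=
  forall h h' : {rmorphism P -> E}, h \o q =1 h' \o q -> p \o h =1 p \o h' -> h =1 h'.

Definition uniq_lifting (E E' : comPzRingType) (p : {rmorphism E -> E'}) :=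
  lifting p /\ lift_uniq p.

Lemma uniq_lifting_comp (E E1 E' : comPzRingType) (p1 : {rmorphism E -> E1})
    (p2 : {rmorphism E1 -> E'}) (p : {rmorphism E -> E'}) : p =1 p2 \o p1 ->
  uniq_lifting p1 -> uniq_lifting p2 -> uniq_lifting p.
Proof.
move=> pE [L1 U1] [L2 U2]; split=> [s g gs|h h' hq hp].
  have [|h2 [h2q ph2]] := L2 (p1 \o s) g; first by move=> x; rewrite gs /= pE.
  have [h1 [h1q ph1]] := L1 s h2 h2q.
  by exists h1; split=> // x; rewrite /= pE /= [p1 _]ph1 [p2 _]ph2.
apply: U1 => //; apply: (U2 (p1 \o h) (p1 \o h')) => x /=.
  by rewrite [h _]hq.
by have := hp x; rewrite /= !pE.
Qed.

Hypothesis q_etale : etale q.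

Lemma uniq_lifting_sqz (E E' : comPzRingType) (p : {rmorphism E -> E'}) :
  square_zero_ext p -> uniq_lifting p.
Proof.
case: q_etale => -[_ sm] unr psq; split; first by move=> s g; apply: sm.
by move=> h h'; apply: unr.
Qed.

(** Factor [p] through the quotient by [x^2]. The second map has square zero kernel, and the kernel
    of the first is generated by [x^2], for which half the exponent suffices. *)
Lemma uniq_lifting_principal k (E E' : comPzRingType) (p : {rmorphism E -> E'}) x :
  surjective p -> (forall y, p y = 0 <-> exists z, y = z * x) -> x ^+ (2 ^ k)%N = 0 ->
  uniq_lifting p.
Proof.
elim: k E E' p x => [|k IH] E E' p x psurj ker x0.
  rewrite expr1 in x0; apply: uniq_lifting_sqz; split=> // a b /ker[z ->] _.
  by rewrite x0 mulr0 mul0r.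
have px : p x = 0 by apply/ker; exists 1; rewrite mul1r.
pose S (y : E) := y = x ^+ 2.
have SP y : ideal_gen S y <-> exists z, y = z * x ^+ 2.
  split=> [|[z ->]]; last by apply: ideal_genM; apply: span_gen.
  elim=> [_ ->||_ _ _ [z ->] _ [w ->]|b _ _ [z ->]].
  - by exists 1; rewrite mul1r.
  - by exists 0; rewrite mul0r.
  - by exists (z + w); rewrite mulrDl.
  - by exists (b * z); rewrite -mulrA.
have [y|p2 p2E] := rmorph_factor (phi := p) (qpi_surjective (S := S)).
  by move/qpi0P/SP=> [z ->]; rewrite !rmorphM px !mulr0.
apply: (@uniq_lifting_comp _ _ _ (qpi S) p2); first by move=> y; rewrite p2E.
  apply: (IH _ _ _ (x ^+ 2)); first exact: qpi_surjective.
    by move=> y; rewrite qpi0P SP.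
  by rewrite -exprM -expnS.
apply: uniq_lifting_sqz; split.
  by move=> y; have [a <-] := psurj y; exists (qpi S a); rewrite -p2E.
move=> a b; have [a' ->] := qpi_surj a; have [b' ->] := qpi_surj b.
rewrite ![p2 _]p2E => /ker[z ->] /ker[w ->]; rewrite -rmorphM; apply/qpi0P/SP.
by exists (z * w); rewrite mulrACA -expr2.
Qed.

(** The nilpotent generators are divided out one at a time. *)
Lemma uniq_lifting_list (E E' : comPzRingType) (s : seq E) (p : {rmorphism E -> E'}) :
  surjective p -> (forall y : E, p y = 0 <-> ideal_gen (fun x => x \in s) y) ->
  (forall x : E, x \in s -> nilp x) -> uniq_lifting p.
Proof.
have [n] := ubnP (size s); elim: n => // n IH in E E' s p *.
case: s => [|x s] /= sn psurj ker nil.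
  apply: uniq_lifting_sqz; split=> // a b /ker a0 _.
  suff -> : a = 0 by rewrite mul0r.
  elim: a0 => // [y z _ -> _ ->|c y _ ->]; rewrite ?addr0 //; exact: mulr0.
pose S (y : E) := y = x.
have px y : y \in x :: s -> p y = 0 by move=> ys; apply/ker/span_gen.
have [y|p2 p2E] := rmorph_factor (phi := p) (qpi_surjective (S := S)).
  move/qpi0P; apply: ideal_gen_ker => z ->; apply: px; exact: mem_head.
apply: (@uniq_lifting_comp _ _ _ (qpi S) p2); first by move=> y; rewrite p2E.
  have [m xn] := nil _ (mem_head _ _).
  apply: (@uniq_lifting_principal m _ _ _ x); first exact: qpi_surjective.
    move=> y; rewrite qpi0P; split=> [|[z ->]]; last by apply: ideal_genM; apply: span_gen.
    elim=> [_ ->||_ _ _ [z ->] _ [w ->]|b _ _ [z ->]].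
    - by exists 1; rewrite mul1r.
    - by exists 0; rewrite mul0r.
    - by exists (z + w); rewrite mulrDl.
    - by exists (b * z); rewrite -mulrA.
  by rewrite -(subnKC (ltnW (ltn_expl m (ltnSn 1)))) exprD xn mul0r.
apply: (IH _ _ (map (qpi S) s)) => [|y|y|y]; first by rewrite size_map.
- by have [a <-] := psurj y; exists (qpi S a); rewrite -p2E.
- split; last first.
    apply: ideal_gen_ker => _ /mapP[z zs ->].
    by rewrite [p2 _]p2E px // inE zs orbT.
  have [a ->] := qpi_surj y; rewrite [p2 _]p2E => /ker.
  apply: (ideal_gen_mono (f := qpi S)) => z; rewrite inE => /predU1P[->|zs].
    by rewrite [X in ideal_gen _ X](_ : _ = 0); [exact: span0 | apply/qpi0P/span_gen].
  by apply: span_gen; apply: map_f zs.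
- move=> /mapP[z zs ->]; have [|m zn] := nil z; first by rewrite inE zs orbT.
  by exists m; rewrite -rmorphXn zn rmorph0.
Qed.

Variables (E E' : comPzRingType) (p : {rmorphism E -> E'}).
Hypothesis ker_nil : forall x : E, p x = 0 -> nilp x.

(** The kernel is nil but need not be nilpotent. The differences of the images of the finitely many
    generators of [P] over [T] generate a finitely generated nil ideal, modulo which [h] and [h']
    agree, and [uniq_lifting_list] applies to that ideal. *)
Lemma etale_uniq : lift_uniq p.
Proof.
move=> h h' hq hp.
case: q_etale => -[[n [T' [iT [Y [G [poly GiT Gsurj _]]]]]] _] _.
pose dif i := h (G (Y i)) - h' (G (Y i)).
pose s := [seq dif i | i : 'I_n].
have sp x : x \in s -> p x = 0.
  by move=> /imageP[i _ ->]; rewrite rmorphB [p (h _)]hp subrr.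
have [_ U] : uniq_lifting (qpi (fun x => x \in s)).
  apply: (@uniq_lifting_list _ _ s); first exact: qpi_surjective.
    exact: qpi0P.
  by move=> x /sp/ker_nil.
apply: U => // x; have [y <-] := Gsurj x; set pi := qpi _.
have [f [_ _ fU]] := poly _ (pi \o h \o q) (fun i => pi (h (G (Y i)))).
rewrite -[LHS]/((pi \o h \o G) y) -[RHS]/((pi \o h' \o G) y).
rewrite (fU (pi \o h \o G)) ?(fU (pi \o h' \o G)) // => [t|i|t] /=.
- by rewrite [G _]GiT [h _]hq.
- apply/esym; apply/qpiP; apply: span_gen; apply/imageP; exists i => //.
- by rewrite [G _]GiT.
Qed.

(** Arbitrary lifts of the generators satisfy the finitely many relations of [P] modulo a finitely
    generated nil ideal. This gives a map to the quotient of [E] by that ideal, lying over [g], and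
    it lifts to [E] by [uniq_lifting_list]. *)
Lemma etale_lift : surjective p -> lifting p.
Proof.
move=> psurj s0 g gq.
case: q_etale => -[[n [T' [iT [Y [G [poly GiT Gsurj [s ker]]]]]]] _] _.
pose b i := projT1 (cid (psurj (g (G (Y i))))).
have bE i : p (b i) = g (G (Y i)) by rewrite /b; case: cid.
have [phi [phiT phiY _]] := poly _ s0 b.
have pphi : p \o phi =1 g \o G.
  have [f [_ _ fU]] := poly _ (p \o s0) (p \o b).
  move=> x; rewrite (fU (p \o phi)) ?(fU (g \o G)) // => [t|i|t|i] /=.
  - by rewrite [G _]GiT; apply: gq.
  - by rewrite bE.
  - by rewrite [phi _]phiT.
  - by rewrite phiY.
pose s' := map phi s.
have s'p x : x \in s' -> p x = 0.
  move=> /mapP[y ys ->]; rewrite [p _]pphi /=; have -> : G y = 0 by apply/ker/span_gen.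
  exact: rmorph0.
set S := (fun x => x \in s') : E -> Prop.
have [x /ker Gx|psi psiE] := rmorph_factor (phi := qpi S \o phi) Gsurj.
  apply/qpi0P; apply: (ideal_gen_mono (f := phi)) Gx => y ys.
  by apply: span_gen; apply: map_f.
have [x /qpi0P|pb pbE] := rmorph_factor (phi := p) (qpi_surjective (S := S)).
  exact: ideal_gen_ker.
have [L _] : uniq_lifting (qpi S).
  apply: (@uniq_lifting_list _ _ s'); first exact: qpi_surjective.
    exact: qpi0P.
  by move=> x /s'p/ker_nil.
have [t|h [hq hpi]] := L s0 psi.
  by rewrite /= -GiT /= [psi _]psiE /= [phi _]phiT.
exists h; split=> // x; have [y <-] := Gsurj x.
by rewrite -[RHS](pphi y) -[LHS]pbE -[RHS]pbE /= [qpi S _]hpi [psi _]psiE.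
Qed.
End EtaleLifting.

(** * Thickenings and charts *)

Lemma pd_power_map (B C : pdring) (h : {rmorphism B -> C}) n x : pd_morph h ->
  pd_power (@pd_ideal B) (@pd_pow B) n x -> pd_power (@pd_ideal C) (@pd_pow C) n (h x).
Proof.
move=> hpd; apply: ideal_gen_mono => _ [s [Is ns ->]]; apply: span_gen.
exists [seq (p.1, h p.2) | p <- s]; split.
- by move=> _ /mapP[p ps ->]; have [] := hpd _ (Is _ ps).
- by rewrite big_map.
rewrite /pd_prod rmorph_prod big_map; apply: eq_big_seq => p ps /=.
by have [_ ->] := hpd _ (Is _ ps).
Qed.

Lemma pd_power_quot (B : pdring) K n (y : qpd B K) :
  pd_power (@pd_ideal (qpd B K)) (@pd_pow (qpd B K)) n y ->
  exists2 x, pd_power (@pd_ideal B) (@pd_pow B) n x & y = qpi (npd B K.+1) x.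
Proof.
elim=> [_ [s [Is ns ->]]||u v _ [x Ix ->] _ [z Iz ->]|b v _ [x Ix ->]].
- suff [s' [Is' ns' E]] : exists s' : seq (nat * B), [/\ forall p, p \in s' -> pd_ideal p.2,
      (\sum_(p <- s') p.1 = \sum_(p <- s) p.1)%N &
      pd_prod (@pd_pow (qpd B K)) s = qpi (npd B K.+1) (pd_prod (@pd_pow B) s')].
    by exists (pd_prod (@pd_pow B) s') => //; apply: pd_prod_power; rewrite ?ns'.
  elim: s Is {ns} => [|[i z] s IH] Is.
    by exists [::]; split; rewrite ?big_nil // /pd_prod !big_nil rmorph1.
  have [|s' [Is' ns' E]] := IH; first by move=> p ps; apply: Is; rewrite inE ps orbT.
  have [x Jx zx] := Is (i, z) (mem_head _ _); exists ((i, x) :: s'); split.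
  + by move=> p; rewrite inE => /predU1P[->|/Is'].
  + by rewrite !big_cons ns'.
  rewrite /pd_prod !big_cons /= -!/(pd_prod _ _) E rmorphM; congr (_ * _).
  by rewrite /= in zx; rewrite zx [LHS]qpd_powE.
- by exists 0; [exact: span0 | rewrite rmorph0].
- by exists (x + z); [exact: spanD | rewrite rmorphD].
- have [c ->] := qpi_surj b; exists (c * x); first exact: ideal_genM.
  by rewrite rmorphM.
Qed.

Section Thick.
Variables (A : pdring) (R : comPzRingType) (iR : {rmorphism A -> R}).

(* An object of the crystalline site without the nilpotence condition. *)
Record thick := Thick {
  th_ring :> pdring;
  th_alg : {rmorphism A -> th_ring};
  th_proj : {rmorphism th_ring -> R};
  th_compatible : pd_compatible th_alg;
  th_projA : th_proj \o th_alg =1 iR;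
  th_surj : surjective th_proj;
  th_ker : forall x : th_ring, pd_ideal x <-> th_proj x = 0 }.

Definition thick_of (B : cris_ob iR) : thick :=
  @Thick B (co_alg B) (co_proj B) (co_compatible B) (@co_projA _ _ _ B) (@co_surj _ _ _ B)
    (@co_ker _ _ _ B).

Record thom (E E' : thick) := THom {
  tm :> {rmorphism E -> E'};
  tm_alg : tm \o th_alg E =1 th_alg E';
  tm_proj : th_proj E' \o tm =1 th_proj E;
  tm_pd : pd_morph tm }.

Definition thom_comp E E' E'' (f : thom E' E'') (g : thom E E') : thom E E''.
Proof.
refine (@THom E E'' (tm f \o tm g) _ _ _).
- by move=> a; rewrite /= [tm g _](tm_alg g) [LHS](tm_alg f).
- by move=> x; rewrite /= [LHS](tm_proj f) [LHS](tm_proj g).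
- move=> x Ix; have [Igx gx] := tm_pd g Ix; have [Ifx fx] := tm_pd f Igx.
  by split=> // n; rewrite /= gx fx.
Defined.

Definition thom_of (X Y : cris_ob iR) (f : cris_hom X Y) : thom (thick_of X) (thick_of Y) :=
  @THom (thick_of X) (thick_of Y) (ch_map f) (ch_alg f) (ch_proj f) (ch_pd f).

Lemma cris_hom_ext (X Y : cris_ob iR) (f g : cris_hom X Y) : f =1 g -> f = g.
Proof.
case: f g => f f1 f2 f3 [g g1 g2 g3] /= /rmorph_ext fg; subst g.
by rewrite (Prop_irrelevance f1 g1) (Prop_irrelevance f2 g2) (Prop_irrelevance f3 g3).
Qed.

Section Level.
Variables (E : thick) (K : nat).
Local Notation pi := (qpi (npd E K.+1)).
Definition lev_ring : pdring := qpd E K.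
Definition lev_pi : {rmorphism E -> lev_ring} := pi.
Lemma lev_pi_surj : surjective lev_pi. Proof. exact: qpi_surjective. Qed.
Lemma lev_pi0 x : lev_pi x = 0 <-> npd E K.+1 x.
Proof. by rewrite -npdP; apply: qpi0P. Qed.
Lemma lev_pi_pd : pd_morph lev_pi.
Proof. by move=> x Jx; split=> [|n]; [exists x | rewrite /= [RHS]qpd_powE]. Qed.

Lemma lev_proj_ex : exists h : {rmorphism lev_ring -> R}, h \o lev_pi =1 th_proj E.
Proof.
apply: rmorph_factor; first exact: lev_pi_surj.
by move=> x /lev_pi0/npd_sub/th_ker.
Qed.
Definition lev_proj := projT1 (cid lev_proj_ex).
Lemma lev_projE x : lev_proj (lev_pi x) = th_proj E x.
Proof. exact: (projT2 (cid lev_proj_ex)). Qed.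

Definition lev : cris_ob iR.
Proof.
refine (@CrisOb A R iR lev_ring (lev_pi \o th_alg E) lev_proj _ _ _ _ _).
- apply: (@pd_compatible_quot A E lev_ring (th_alg E) _ lev_pi) => //.
  + exact: lev_pi_surj.
  + exact: lev_pi_pd.
  + by move=> x /lev_pi0/npd_sub.
  + exact: th_compatible.
- by move=> a; rewrite /= lev_projE; apply: th_projA.
- by move=> y; have [x <-] := th_surj E y; exists (lev_pi x); rewrite lev_projE.
- move=> y; have [x <-] := lev_pi_surj y; rewrite lev_projE -th_ker.
  split=> [[z Jz E']|Jx]; last by exists x.
  have : lev_pi (x - z) = 0 by rewrite rmorphB /= [lev_pi x]E' subrr.
  move/lev_pi0/npd_sub => Jxz; rewrite -(subrK z x); exact: pdiD.
- exists (K.+1)`!, K.+1; split; rewrite ?fact_gt0 // => y /pd_power_quot[x Ix ->].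
  by rewrite -raddfMn; apply/lev_pi0; exists x.
Defined.

Definition lev_thom : thom E (thick_of lev).
Proof.
refine (@THom E (thick_of lev) lev_pi _ _ _) => //.
- exact: lev_projE.
- exact: lev_pi_pd.
Defined.
End Level.

Definition lev_tr (E : thick) K : cris_hom (lev E K.+1) (lev E K).
Proof.
refine (@CrisHom A R iR (lev E K.+1) (lev E K) (@Dtr E K : {rmorphism _ -> _}) _ _ _).
- by move=> a; apply: Dtr_pi.
- move=> y; have [x <-] := lev_pi_surj y; rewrite /= [Dtr _]Dtr_pi.
  by rewrite [LHS](lev_projE K) [RHS](lev_projE K.+1).
- exact: Dtr_pd_morph.
Defined.

(* Every map to [B] factors through the levels from [depth B] on. *)
Definition depth_spec (B : cris_ob iR) (k : nat) :=
  forall K, (k <= K)%N -> forall x : B, npd B K.+1 x -> x = 0.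
Lemma depth_ex B : exists k, depth_spec B k.
Proof.
(* For [K >= m + n], [m] divides [(K+1)!] and $I^{[K+1]} \subset I^{[n]}$. *)
have [m [n [m0 n0 mn]]] := co_nilp B; exists (m + n)%N => K leK _ [x Ix ->].
have mK : (m <= K.+1)%N by apply: leqW; apply: leq_trans leK; apply: leq_addr.
have : (m %| K.+1`!)%N by rewrite dvdn_fact // m0.
case/dvdnP => c ->; rewrite mulnC mulrnA mn ?mul0rn //.
by apply: pd_power_le Ix; apply: leqW; apply: leq_trans leK; apply: leq_addl.
Qed.
Definition depth B := projT1 (cid (depth_ex B)).
Lemma depthP B K x : (depth B <= K)%N -> npd B K.+1 x -> x = 0.
Proof. by move=> leK; apply: (projT2 (cid (depth_ex B)) K leK). Qed.

Lemma thom_npd (E E' : thick) (f : thom E E') K x : npd E K x -> npd E' K (f x).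
Proof.
move=> [y Iy ->]; exists (f y); last by rewrite rmorphMn.
by apply: pd_power_map Iy; apply: tm_pd.
Qed.

Lemma fact_ex (E : thick) (B : cris_ob iR) (f : thom E (thick_of B)) K :
  (depth B <= K)%N -> exists h : cris_hom (lev E K) B, h \o lev_pi E K =1 f.
Proof.
move=> leK; have [x /lev_pi0 nx|h hE] := rmorph_factor (phi := tm f) (@lev_pi_surj E K).
  exact: (depthP leK (thom_npd f nx)).
unshelve eexists.
  refine (@CrisHom _ _ _ (lev E K) B h _ _ _).
  - by move=> a; rewrite /= [LHS]hE; apply: (tm_alg f).
  - move=> y; have [x <-] := lev_pi_surj y.
    by rewrite /= [h _]hE [RHS](lev_projE K); apply: (tm_proj f).
  - move=> _ [x Jx ->]; have [Jfx fE] := tm_pd f Jx.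
    split=> [|n]; first by rewrite [h _]hE.
    by rewrite [pd_pow n _](qpd_powE K n Jx) ![h _]hE.
exact: hE.
Qed.

(** [x^n = n! delta_n x] is killed by [m], and [x^m = m! delta_m x] is a multiple of [m], so
    [x^(n + m) = 0]. *)
Lemma nil_ker (B : cris_ob iR) (x : B) : co_proj B x = 0 -> nilp x.
Proof.
move/co_ker => Ix; have [m [n [m0 n0 mn]]] := co_nilp B.
have xn : x ^+ n *+ m = 0.
  apply: mn; rewrite pd_pow_expr //; apply: ideal_genMn; apply: span_gen.
  exists [:: (n, x)]; rewrite big_seq1 /= /pd_prod big_seq1 /=; split=> // p.
  by rewrite inE => /eqP ->.
exists (n + m)%N; rewrite exprD (pd_pow_expr m Ix).
have : (m %| m`!)%N by rewrite dvdn_fact // m0 leqnn.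
by case/dvdnP => c ->; rewrite mulrnAr mulnC mulrnA -mulrnAl xn mul0r mul0rn.
Qed.

(* The structure of the envelope that the equivalence depends on: maps to objects
   of the site are the same as lifts of the coordinates [ch_t], and the
   differentials are free on them. *)
Record chart := Chart {
  ch_D : thick;
  ch_d : nat;
  ch_t : 'I_ch_d -> ch_D;
  ch_point : forall (B : cris_ob iR) (b : 'I_ch_d -> B),
    (forall i, co_proj B (b i) = th_proj ch_D (ch_t i)) ->
    exists u : thom ch_D (thick_of B), forall i, u (ch_t i) = b i;
  ch_uniq : forall (B : cris_ob iR) (u v : thom ch_D (thick_of B)),
    (forall i, u (ch_t i) = v (ch_t i)) -> u =1 v;
  ch_der : 'I_ch_d -> ch_D -> ch_D;
  ch_derD : forall i, additive_map (ch_der i);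
  ch_derM : forall i x y, ch_der i (x * y) = x * ch_der i y + y * ch_der i x;
  ch_derA : forall i a, ch_der i (th_alg ch_D a) = 0;
  ch_der_pd : forall i n x, pd_ideal x -> ch_der i (pd_pow n.+1 x) = pd_pow n x * ch_der i x;
  ch_der_t : forall i k, ch_der i (ch_t k) = (k == i)%:R;
  ch_omega : forall x, du (th_alg ch_D) x = \sum_i ch_der i x *: du (th_alg ch_D) (ch_t i) }.
End Thick.

(** [R] with its zero ideal is a target for the universal property of the envelope; this yields the
    projection of [D] to [R]. *)
Lemma zero_is_pd (R : comPzRingType) :
  is_pd (fun x : R => x = 0) (fun n _ => (n == 0%N)%:R).
Proof.
split.
- by split=> [|x y -> ->|b x ->]; rewrite ?addr0 ?mulr0.
- by move=> [|n].
- by [].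
- by move=> x ->.
- move=> n x y _ _; rewrite big_ord_recl /= subn0 mul1r big1 ?addr0 // => i _.
  by rewrite mul0r.
- by move=> [|n] b x _ /=; rewrite ?expr0 ?mulr1 ?mulr0.
- by move=> [|m] [|n] x _ /=; rewrite ?mulr1 ?mulr0 ?mul0r ?bin0 ?mul1r.
- move=> m [|n] x _ m0 /=; first by rewrite mul0n mulr1.
  by rewrite muln_eq0 (gtn_eqF m0) mulr0.
Qed.
Definition zero_pd (R : comPzRingType) : pdring := PDRing (zero_is_pd R).

Lemma zero_pd_morph (B : pdring) (R : comPzRingType) (h : {rmorphism B -> R}) :
  (forall x, pd_ideal x -> h x = 0) -> pd_morph (h : B -> zero_pd R).
Proof.
move=> h0 x Ix; split=> [|n]; first exact: h0.
case: n => [|n] /=; first by rewrite (pd_0 (pd_ax B)) // rmorph1.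
by rewrite h0 //; apply: (pd_stable (pd_ax B)).
Qed.

(** * The chart of a divided power envelope *)

Section FromEnvelope.
Variables (A : pdring) (R : comPzRingType) (iR : {rmorphism A -> R}).
Hypothesis eta_R : pd_extends_to iR.
Variables (P : comPzRingType) (iP : {rmorphism A -> P}).
Variables (j : {rmorphism P -> R}) (jA : j \o iP =1 iR) (j_surj : surjective j).
Variables (d : nat) (T : comPzRingType) (iT : {rmorphism A -> T}) (X : 'I_d -> T).
Hypothesis T_poly : is_poly_alg iT X.
Variables (q : {rmorphism T -> P}) (qA : q \o iT =1 iP) (q_etale : etale q).
Variables (D : pdring) (iD : {rmorphism P -> D}).
Hypothesis D_env : is_pd_envelope iP (fun x => j x = 0) iD.

Let iA : {rmorphism A -> D} := iD \o iP.
Let t i := iD (q (X i)).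

Let R0_compatible : pd_compatible (iR : A -> zero_pd R).
Proof.
have [eps ax epsA] := eta_R; exists eps; split=> //.
- rewrite (_ : ideal_gen _ = ext_ideal iR) //; apply: funext => x; apply/propext.
  split=> [|Ix]; last by apply: span_gen; right.
  elim=> [y [->|//]||y z _ Iy _ Iz|b y _ Iy]; [exact: span0|exact: span0|exact: spanD|exact: spanZ].
move=> n x /= ->; have I0 : ext_ideal iR 0 by apply: span0.
case: n => [|n]; first by rewrite (pd_0 ax).
exact: (@pd_pow_0 (PDRing ax) n.+1).
Qed.

Let compat_ext (B : pdring) (f g : A -> B) : f =1 g -> pd_compatible f -> pd_compatible g.
Proof. by move=> /funext ->. Qed.

Let D_compat : pd_compatible iA. Proof. by case: D_env. Qed.
Let iD_ideal x : j x = 0 -> pd_ideal (iD x). Proof. by case: D_env => h _ _; apply: h. Qed.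

Let env_uniq (E : pdring) (iE : {rmorphism A -> E}) (h h' : {rmorphism D -> E}) :
  pd_compatible iE -> h \o iA =1 iE -> pd_morph h -> pd_morph h' ->
  h \o iD =1 h' \o iD -> h =1 h'.
Proof.
move=> cE hA hpd hpd' hh'; case: D_env => _ _ /(_ E (h \o iD)) univ.
have [||hu [_ _ U]] := univ.
- by move=> x /iD_ideal/hpd[].
- by apply: compat_ext cE => a; rewrite -hA.
by move=> x; rewrite (U h) // (U h') // => y; apply/esym/hh'.
Qed.

Let piD_ex : exists h : {rmorphism D -> R}, pd_morph (h : D -> zero_pd R) /\ h \o iD =1 j.
Proof.
case: D_env => _ _ /(_ (zero_pd R) j)[].
- by [].
- exact: compat_ext R0_compatible.
by move=> h [hpd hD _]; exists h.
Qed.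
Let piD := projT1 (cid piD_ex).
Let piD_pd : pd_morph (piD : D -> zero_pd R) := (projT2 (cid piD_ex)).1.
Let piDE : piD \o iD =1 j := (projT2 (cid piD_ex)).2.

Let inP : {pred D} := fun x => `[< exists p, pd_ideal (x - iD p) >].
Let inP_subring : subring_closed inP.
Proof.
split.
- by apply/asboolP; exists 1; rewrite rmorph1 subrr; apply: pdi0.
- move=> x y /asboolP[p xp] /asboolP[r yr]; apply/asboolP; exists (p - r).
  have -> : x - y - iD (p - r) = (x - iD p) - (y - iD r) by rewrite rmorphB; ring.
  exact: pdiB.
- move=> x y /asboolP[p xp] /asboolP[r yr]; apply/asboolP; exists (p * r).
  have -> : x * y - iD (p * r) = x * (y - iD r) + iD r * (x - iD p).
    by rewrite rmorphM !mulrBr addrA (mulrC (iD r)) subrK (mulrC (iD r)).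
  by apply: pdiD; apply: pdiM.
Qed.
Let S : subringClosed D := HB.pack (inP : {pred D})
  (GRing.isSubringClosed.Build D inP inP_subring).
Let S_in x : pd_ideal x -> x \in S.
Proof. by move=> Jx; apply/asboolP; exists 0; rewrite rmorph0 subr0. Qed.
Let S_pow n x : x \in S -> pd_ideal x -> pd_pow n x \in S.
Proof.
move=> _ Jx; case: n => [|n]; first by rewrite (pd_0 (pd_ax D)) // rpred1.
by apply: S_in; apply: (pd_stable (pd_ax D)).
Qed.
Let iD_S p : iD p \in S.
Proof. by apply/asboolP; exists p; rewrite subrr; apply: pdi0. Qed.

(** The subring [iD P + J] is stable under divided powers, so the envelope maps to it; followed by
    the inclusion, this map is the identity of [D] by uniqueness. The decomposition is what makes
    [J] the whole kernel of the projection to [R]. *)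
Lemma env_decomp x : exists p, pd_ideal (x - iD p).
Proof.
pose iS : {rmorphism P -> sub_pd S_pow} := subr_in iD_S.
pose v : {rmorphism sub_pd S_pow -> D} := subr_val S.
case: D_env => _ _ /(_ (sub_pd S_pow) iS)[].
- exact: iD_ideal.
- apply: (@pd_compatible_sub A D (sub_pd S_pow) iA (iS \o iP) v) => //.
  + exact: subr_inj.
  + exact: sub_pd_val.
move=> h [hpd hD _].
have vh : v \o h =1 idfun.
  apply: (env_uniq D_compat) => //.
  - by move=> a; rewrite /= [h _]hD.
  - move=> y Jy; have [Ihy hE] := hpd _ Jy; split=> // n.
    by rewrite /= hE; apply: sub_pdE.
  - by move=> y; rewrite /= [h _]hD.
have /asboolP := valP (h x); rewrite -[val _]/((v \o h) x) vh.
by [].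
Qed.

Let piD_ker x : pd_ideal x <-> piD x = 0.
Proof.
split=> [/piD_pd[]//|x0]; have [p xp] := env_decomp x.
rewrite -[x](subrK (iD p)); apply: pdiD => //; apply: iD_ideal.
rewrite -piDE /= -[LHS]subr0 -x0 -rmorphB -[LHS]opprK -rmorphN opprB.
by have [/= -> _] := piD_pd xp; rewrite oppr0.
Qed.

Definition env_thick : thick iR.
Proof.
refine (@Thick A R iR D iA piD D_compat _ _ piD_ker).
- by move=> a; rewrite -jA; apply: piDE.
- by move=> y; have [x <-] := j_surj y; exists (iD x); apply: piDE.
Defined.

Let poly_uniq (B : comPzRingType) (f g : {rmorphism T -> B}) :
  f \o iT =1 g \o iT -> (forall i, f (X i) = g (X i)) -> f =1 g.
Proof.
move=> fgA fgX; have [h [_ _ U]] := T_poly (g \o iT) (fun i => g (X i)).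
by move=> x; rewrite (U f) // (U g).
Qed.

(** Coordinates give a map from [T], etaleness extends it to [P] along the nil kernel of [p], and
    the envelope extends it to [D]. With [p] the projection of an object to [R] this gives points;
    with [p] the projection from the dual numbers over [D] it gives the derivations. *)
Let point_ext (E : pdring) (iE : {rmorphism A -> E}) (E' : comPzRingType)
    (p : {rmorphism E -> E'}) (g0 : {rmorphism D -> E'}) (b : 'I_d -> E) :
  pd_compatible iE -> surjective p -> (forall x : E, p x = 0 -> nilp x) ->
  g0 \o iA =1 p \o iE -> (forall i, p (b i) = g0 (t i)) ->
  (forall (y : E) (x : D), pd_ideal x -> p y = g0 x -> pd_ideal y) ->
  exists h : {rmorphism D -> E}, [/\ pd_morph h, h \o iA =1 iE,
    forall i, h (t i) = b i & p \o h \o iD =1 g0 \o iD].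
Proof.
move=> cE psurj pnil g0A pb g0I.
have [s [sT sX _]] := T_poly iE b.
have [|h0 [h0q ph0]] := etale_lift q_etale pnil psurj (s := s) (g := g0 \o iD).
  apply: (poly_uniq (f := g0 \o iD \o q) (g := p \o s)) => [a|i] /=.
    by rewrite [q _]qA [s _]sT; apply: g0A.
  by rewrite sX pb.
case: D_env => _ _ /(_ E h0)[].
- move=> x jx; apply: (g0I _ (iD x)); [exact: iD_ideal | exact: ph0].
- by apply: compat_ext cE => a; rewrite /= -qA [RHS]h0q [RHS]sT.
move=> h [hpd hD _]; exists h; split=> // [a|i|x].
- by rewrite /= [LHS]hD -qA [LHS]h0q; apply: sT.
- by rewrite [LHS]hD [LHS]h0q sX.
- by rewrite /= [h _]hD; apply: ph0.
Qed.

Let point_uniq (E : pdring) (iE : {rmorphism A -> E}) (E' : comPzRingType)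
    (p : {rmorphism E -> E'}) (h h' : {rmorphism D -> E}) :
  pd_compatible iE -> (forall x : E, p x = 0 -> nilp x) ->
  pd_morph h -> pd_morph h' -> h \o iA =1 iE -> h' \o iA =1 iE ->
  (forall i, h (t i) = h' (t i)) -> p \o h =1 p \o h' -> h =1 h'.
Proof.
move=> cE pnil hpd hpd' hA hA' ht php; apply: (env_uniq cE) => //.
apply: (etale_uniq q_etale pnil (h := h \o iD) (h' := h' \o iD)); last by move=> x; apply: php.
apply: (poly_uniq (f := h \o iD \o q) (g := h' \o iD \o q)) => // a.
by rewrite /= [q _]qA [LHS]hA [RHS]hA'.
Qed.

Let to_R0 (h h' : {rmorphism D -> R}) : (forall x, pd_ideal x -> h x = 0) ->
  (forall x, pd_ideal x -> h' x = 0) -> h \o iD =1 j -> h' \o iD =1 j -> h =1 h'.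
Proof.
move=> h0 h0' hj hj'; apply: (env_uniq (E := zero_pd R) R0_compatible) => //.
- by move=> a; rewrite -jA; apply: hj.
- exact: zero_pd_morph.
- exact: zero_pd_morph.
- by move=> x; rewrite [LHS]hj [RHS]hj'.
Qed.

Let Dth := env_thick.

Let chart_point (B : cris_ob iR) (b : 'I_d -> B) :
  (forall i, co_proj B (b i) = piD (t i)) ->
  exists u : thom Dth (thick_of B), forall i, u (t i) = b i.
Proof.
move=> bt.
have [||||||h [hpd hA ht hj]] := @point_ext B (co_alg B) R (co_proj B) piD b.
- exact: co_compatible.
- exact: co_surj.
- exact: nil_ker.
- by move=> a; rewrite [RHS]co_projA -jA; apply: piDE.
- exact: bt.
- by move=> y x /piD_ker -> ?; apply/co_ker.
have hproj : co_proj B \o h =1 piD.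
  apply: to_R0.
  - by move=> x /hpd[/co_ker].
  - by move=> x /piD_ker.
  - by move=> x; rewrite hj; apply: piDE.
  - exact: piDE.
by exists (@THom A R iR Dth (thick_of B) h hA hproj hpd).
Qed.

Let chart_uniq (B : cris_ob iR) (u v : thom Dth (thick_of B)) :
  (forall i, u (t i) = v (t i)) -> u =1 v.
Proof.
move=> uv; apply: (@point_uniq B (co_alg B) R (co_proj B) u v) => //.
- exact: co_compatible.
- exact: nil_ker.
- exact: (tm_pd u).
- exact: (tm_pd v).
- exact: (tm_alg u).
- exact: (tm_alg v).
- by move=> x; rewrite [LHS](tm_proj u) [RHS](tm_proj v).
Qed.

Let der_ex i : exists h : {rmorphism D -> dual D}, [/\ pd_morph h,
  h \o iA =1 dual_in D \o iA, forall k, h (t k) = (t k, (k == i)%:R) &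
  forall x, (h x).1 = x].
Proof.
have [||||||h [hpd hA ht hj]] := @point_ext (dual D) (dual_in D \o iA) D (dual_fst D) idfun
  (fun k => (t k, (k == i)%:R)).
- exact: sqz_compatible.
- by move=> x; exists (dual_in D x).
- move=> [a x] /= ->; exists 2; apply: sqz_ext; rewrite /= ?mulr0 ?scale0r ?addr0 //.
- by [].
- by [].
- by move=> y x Jx /= yx; rewrite -yx in Jx.
exists h; split=> //.
apply: (env_uniq D_compat (h := dual_fst D \o h) (h' := idfun)) => //.
- by move=> a; rewrite /= [h _]hA.
- by move=> x /hpd[Ihx hE]; split=> // n; rewrite /= hE.
Qed.

Let der i x := (projT1 (cid (der_ex i)) x).2.
Let derE i : exists h : {rmorphism D -> dual D}, [/\ pd_morph h,
  h \o iA =1 dual_in D \o iA, forall k, h (t k) = (t k, (k == i)%:R) &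
  forall x, h x = (x, der i x)].
Proof.
rewrite /der; case: cid => h [hpd hA ht h1] /=; exists h; split=> // x.
by apply: sqz_ext; rewrite //= h1.
Qed.

Let derD i : additive_map (der i).
Proof.
by move=> x y; have [h [_ _ _ hE]] := derE i; have := rmorphD h x y; rewrite !hE => -[].
Qed.
Let derM i x y : der i (x * y) = x * der i y + y * der i x.
Proof.
by have [h [_ _ _ hE]] := derE i; have := rmorphM h x y; rewrite !hE => -[].
Qed.
Let derA i a : der i (iA a) = 0.
Proof.
by have [h [_ hA _ hE]] := derE i; have := hA a; rewrite /= hE => -[].
Qed.
Let der_pd i n x : pd_ideal x -> der i (pd_pow n.+1 x) = pd_pow n x * der i x.
Proof.
move=> Jx; have [h [hpd _ _ hE]] := derE i; have [_ /(_ n.+1)] := hpd x Jx.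
by rewrite !hE => -[].
Qed.
Let der_t i k : der i (t k) = (k == i)%:R.
Proof. by have [h [_ _ ht hE]] := derE i; have := ht k; rewrite hE => -[]. Qed.

(** The universal derivation and the proposed sum define two maps from [D] to its square zero
    extension by [omega iA]. They have the same coordinates, hence coincide by [point_uniq]. *)
Let omegaE x : du iA x = \sum_i der i x *: du iA (t i).
Proof.
pose der' x := \sum_i der i x *: du iA (t i).
have duM' y z : du iA (y * z) = (idfun : {rmorphism D -> D}) y *: du iA z +
  (idfun : {rmorphism D -> D}) z *: du iA y by rewrite duM.
have derD' : additive_map der'.
  move=> y z; rewrite -big_split; apply: eq_bigr => i _; rewrite derD scalerDl //.
have derM' y z : der' (y * z) = (idfun : {rmorphism D -> D}) y *: der' z +
    (idfun : {rmorphism D -> D}) z *: der' y.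
  rewrite !scaler_sumr -big_split; apply: eq_bigr => i _.
  by rewrite derM scalerDl !scalerA.
pose h : {rmorphism D -> sqz_pd _} := sqz_pairR (duD iA) duM'.
pose h' : {rmorphism D -> sqz_pd _} := sqz_pairR derD' derM'.
suff /(_ x)[] : h =1 h' by [].
apply: (@point_uniq (sqz_pd (omega iA)) (sqz_in (omega iA) \o iA) D (@sqz_fst _ (omega iA))) => //.
- exact: sqz_compatible.
- move=> [a y] /= ->; exists 2; apply: sqz_ext; rewrite /= ?mulr0 ?scale0r ?addr0 //.
- apply: sqz_pair_pd => // n y Jy; exact: du_pd.
- apply: sqz_pair_pd => // n y Jy; rewrite scaler_sumr; apply: eq_bigr => i _.
  by rewrite der_pd // scalerA.
- by move=> a; apply: sqz_ext; rewrite //= duA.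
- move=> a; apply: sqz_ext; rewrite //=; apply: big1 => i _.
  by rewrite derA scale0r.
- move=> k; apply: sqz_ext => //=; rewrite [RHS](bigD1 k) //= der_t eqxx scale1r.
  rewrite big1 ?addr0 // => i ik; rewrite der_t eq_sym (negbTE ik) scale0r //.
Qed.

Definition env_chart : chart iR :=
  @Chart A R iR Dth d t chart_point chart_uniq der derD derM derA der_pd der_t omegaE.
End FromEnvelope.

(** * Evaluation of a crystal at a point *)

Section LimitSurjective.

Definition shift_ring_tower (T : ring_tower) := RingTower (fun n => rt_map T n.+1).
Definition shift_mod_tower (T : ring_tower) (M : mod_tower T) :=
  @ModTower (shift_ring_tower T) (fun n => M n.+1) (fun n => mt_map M n.+1)
    (fun n => mt_mapS M n.+1).

Lemma mproj_surj (T : ring_tower) (M : mod_tower T) k :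
  (forall n, surjective (mt_map M n)) -> surjective (@mproj T M k).
Proof.
elim: k T M => [|k IH] T M Msurj x.
  pose sec n y := projT1 (cid (Msurj n y)).
  have secK n y : mt_map M n (sec n y) = y by rewrite /sec; case: cid.
  pose z n : M n := nat_rect (fun n => M n) x (fun n y => sec n y) n.
  have zE n : mt_map M n (z n.+1) = z n by apply: secK.
  by exists (mk_lim_mod zE).
have [|z zx] := IH (shift_ring_tower T) (shift_mod_tower M) _ x.
  by move=> n; apply: Msurj.
pose y n : M n := if n is l.+1 then mproj l z else mt_map M 0 (mproj 0 z).
have yE n : mt_map M n (y n.+1) = y n.
  by case: n => [//|n]; apply: (mproj_map n z).
by exists (mk_lim_mod yE).
Qed.
End LimitSurjective.

Section Towers.
Variable D : pdring.
Local Notation pi k := (qpi (npd D k.+1)).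

Lemma Dtr_surj k : surjective (@Dtr D k).
Proof. by move=> y; have [x ->] := qpi_surj y; exists (pi k.+1 x); apply: Dtr_pi. Qed.

Section ModTower.
Variable M : mod_tower (Dtower D).
Hypothesis bc : forall k, is_base_change (rt_map (Dtower D) k) (mt_map M k).
Local Notation Mh := (lim_mod M).

Lemma tower_surj k : surjective (mt_map M k).
Proof. by apply: bc_surj (bc k) _; apply: Dtr_surj. Qed.

Lemma lim_surj k : surjective (@mproj _ M k).
Proof. by apply: mproj_surj; apply: tower_surj. Qed.

Definition lim_lift k (x : M k) : Mh := projT1 (cid (lim_surj x)).
Lemma lim_liftK k (x : M k) : mproj k (lim_lift x) = x.
Proof. by rewrite /lim_lift; case: cid. Qed.

Lemma mproj_le k K (m : Mh) : (k <= K)%N -> mproj K m = 0 -> mproj k m = 0.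
Proof.
move=> /subnK <-; elim: (K - k)%N => [//|n IH] m0; apply: IH.
by rewrite -mproj_map [mproj _ m]m0 (additive_map0 (mt_mapS M _).1).
Qed.

Lemma mproj_hat k (a : D) (m : Mh) : mproj k (to_Dhat a *: m) = pi k a *: mproj k m.
Proof. by []. Qed.

(** Climb from [k] to [K]: an expression for the image at one level lifts to the next, and by
    [bc_ker] the error has coefficients in the ideal of that level, which is contained in the ideal
    of level [k]. *)
Lemma ker_span k K (m : Mh) : (k <= K)%N -> mproj k m = 0 ->
  span (smul_set (V := M K) (fun b => exists2 x, npd D k.+1 x & b = pi K x)) (mproj K m).
Proof.
move=> /subnK <- m0; elim: (K - k)%N => [|n IH]; first by rewrite add0n m0; apply: span0.
set L := (n + k)%N in IH *; rewrite addSn -/L.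
have lift (y : M L) :
    span (smul_set (V := M L) (fun b => exists2 x, npd D k.+1 x & b = pi L x)) y ->
    exists2 z, span (smul_set (V := M L.+1)
      (fun b => exists2 x, npd D k.+1 x & b = pi L.+1 x)) z & mt_map M L z = y.
  have [mD mZ] := mt_mapS M L.
  elim=> [_ [b [w [[x nx ->] ->]]]||u v _ [a Sa <-] _ [c Sc <-]|b v _ [a Sa <-]].
  - have [w' <-] := tower_surj w; exists (pi L.+1 x *: w').
      by apply: span_gen; exists (pi L.+1 x), w'; split=> //; exists x.
    by rewrite mZ [rt_map _ _ _]Dtr_pi.
  - by exists 0; [exact: span0 | rewrite additive_map0].
  - by exists (a + c); [exact: spanD | rewrite mD].
  - by have [b' <-] := Dtr_surj b; exists (b' *: a); [exact: spanZ | rewrite mZ].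
have [z Sz zE] := lift _ IH.
rewrite -[mproj _ m](subrK z); apply: spanD => //.
have /(bc_ker (bc L) (@Dtr_surj L)) : mt_map M L (mproj L.+1 m - z) = 0.
  by rewrite (additive_mapB (mt_mapS M L).1) zE mproj_map subrr.
elim=> [_ [b [w [b0 ->]]]||u v _ Iu _ Iv|b v _ Iv].
- have [x xE] := qpi_surj b; apply: span_gen; exists b, w; split=> //; exists x => //.
  move: b0; rewrite xE [rt_map _ _ _]Dtr_pi => /qpi0P/npdP; rewrite /L.
  by elim: {IH lift z Sz zE L w b xE} n => // n IH /npdS.
- exact: span0.
- exact: spanD.
- exact: spanZ.
Qed.

Lemma ker_ind k K (Q : Mh -> Prop) : (k <= K)%N ->
  (forall u v, Q u -> Q v -> Q (u + v)) ->
  (forall x m, npd D k.+1 x -> Q (to_Dhat x *: m)) -> (forall m, mproj K m = 0 -> Q m) ->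
  forall m, mproj k m = 0 -> Q m.
Proof.
move=> kK QD Qx QK m /(ker_span kK) Sm.
(* The scalar [b] is carried along because [span] is stable under scalars while [Q] is not assumed
   to be. *)
suff /(_ 1)[z Qz zE] : forall b, exists2 z, Q z & mproj K z = b *: mproj K m.
  rewrite -(subrK z m); apply: QD => //; apply: QK.
  by rewrite -[LHS]/(mproj K m - mproj K z) zE scale1r subrr.
elim: Sm => [_ [c [w [[x nx ->] ->]]] b||u v _ Hu _ Hv b|c v _ Hv b].
- have [b' ->] := qpi_surj b.
  exists (to_Dhat x *: (to_Dhat b' *: lim_lift w)); first exact: Qx.
  by rewrite !mproj_hat lim_liftK !scalerA mulrC.
- by move=> b; exists 0; [exact: QK | rewrite scaler0].
- have [a Qa aE] := Hu b; have [e Qe eE] := Hv b.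
  by exists (a + e); [exact: QD | rewrite scalerDr -aE -eE].
- by have [a Qa aE] := Hv (b * c); exists a; rewrite // scalerA.
Qed.

Lemma ker_div k K (m : Mh) : mproj k m = 0 -> exists y : M K, mproj K m = y *+ (k.+1)`!.
Proof.
case: (leqP k K) => [kK|/ltnW Kk m0]; last first.
  by exists 0; rewrite mul0rn; apply: mproj_le m0.
move: m; apply: (ker_ind kK) => [u v [a ua] [b vb]|x m [z _ ->]|m ->].
- by exists (a + b); rewrite mulrnDl -ua -vb.
- exists (pi K z *: mproj K m).
  by rewrite mproj_hat rmorphMn /= -mulr_natl -scalerA scaler_nat.
- by exists 0; rewrite mul0rn.
Qed.

(** Additive and continuous for the limit topology on [Mh], with [N] discrete. *)
Definition adm0 (N : zmodType) (g : Mh -> N) :=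
  additive_map g /\ exists k, forall m, mproj k m = 0 -> g m = 0.
Definition slin (B : comPzRingType) (w : D -> B) (N : lmodType B) (g : Mh -> N) :=
  forall a m, g (to_Dhat a *: m) = w a *: g m.

(** Continuity provides some level at which [g] is defined; [ker_ind] replaces it by any level [k]
    whose ideal $(k+1)! J^{[k+1]}$ dies under [w], whatever [g] is. *)
Lemma slin_ker (B : comPzRingType) (w : D -> B) (N : lmodType B) (g : Mh -> N) k :
  adm0 g -> slin w g -> (forall x, npd D k.+1 x -> w x = 0) ->
  forall m, mproj k m = 0 -> g m = 0.
Proof.
move=> [gD [K gK]] gS w0; have kK := leq_maxl k K.
apply: (ker_ind kK) => [u v gu gv|x m /w0 x0|m m0].
- by rewrite gD gu gv addr0.
- by rewrite gS x0 scale0r.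
- by apply: gK; apply: mproj_le m0; apply: leq_maxr.
Qed.
End ModTower.
End Towers.

Section Evaluation.
Variables (A : pdring) (R : comPzRingType) (iR : {rmorphism A -> R}) (C : chart iR).
Local Notation D := (ch_D C).
Local Notation point B := (thom D (thick_of B)).

Section Universal.
Variable M : mod_tower (Dtower D).
Local Notation Mh := (lim_mod M).

(* [e] exhibits [N] as the base change along [u] of the limit of [M]. *)
Record is_univ (B : cris_ob iR) (u : point B) (N : lmodType B) (e : Mh -> N) : Prop := IsUniv {
  un_adm0 : adm0 e;
  un_slin : slin u e;
  un_ind : forall Q : N -> Prop, Q 0 -> (forall x y, Q x -> Q y -> Q (x + y)) ->
    (forall b m, Q (b *: e m)) -> forall x, Q x;
  un_ex : forall (B' : comPzRingType) (chi : {rmorphism B -> B'}) (N' : lmodType B')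
    (g : Mh -> N'), adm0 g -> slin (chi \o u) g ->
    exists2 h : N -> N', semilinear chi h & forall m, h (e m) = g m }.

Lemma un_uniq (B : cris_ob iR) (u : point B) (N : lmodType B) (e : Mh -> N)
    (B' : comPzRingType) (chi : B -> B') (N' : lmodType B') (h h' : N -> N') :
  is_univ u e -> semilinear chi h -> semilinear chi h' -> (forall m, h (e m) = h' (e m)) -> h =1 h'.
Proof.
move=> un hS hS' E; apply: (un_ind un) => [|x y IHx IHy|c m].
- by rewrite (additive_map0 hS.1) (additive_map0 hS'.1).
- by rewrite hS.1 hS'.1 IHx IHy.
- by rewrite hS.2 hS'.2 E.
Qed.

Hypothesis bc : forall k, is_base_change (rt_map (Dtower D) k) (mt_map M k).

(** By [slin_ker] a continuous map that is linear along [u] factors through [M K], where the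
    universal property of extension of scalars applies. *)
Lemma base_change_univ (B : cris_ob iR) (u : point B) K (f : cris_hom (lev D K) B)
    (N : lmodType B) (e : M K -> N) : f \o lev_pi D K =1 u ->
  is_base_change (ch_map f : {rmorphism Dlev D K -> B}) e ->
  is_univ u (e \o (@mproj _ M K) : Mh -> N).
Proof.
move=> fu bce; have [eD eZ] := bcS bce; split.
- split=> [x y|]; first by rewrite /= -eD.
  by exists K => m m0; rewrite /= m0 (additive_map0 eD).
- by move=> a m; rewrite -fu -[RHS]eZ.
- move=> Q Q0 QD Qg; apply: (bc_ind bce) => // b x.
  by rewrite -(lim_liftK bc x); apply: Qg.
move=> B' chi N' g gadm gS; have gD := gadm.1.
have gker m : mproj K m = 0 -> g m = 0.
  apply: (slin_ker bc gadm gS) => x nx.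
  by rewrite /= -fu /= (_ : lev_pi D K x = 0) ?rmorph0 //; apply/lev_pi0.
pose g' (x : M K) := g (lim_lift bc x).
have g'E m : g' (mproj K m) = g m.
  apply/subr0_eq; rewrite -(additive_mapB gD); apply: gker.
  by rewrite -[LHS]/(mproj _ _ - mproj _ m) (lim_liftK bc) subrr.
have [x y|b x|h hS hE] := bc_univ bce (chi := chi) (g := g').
- rewrite -(lim_liftK bc x) -(lim_liftK bc y) -[_ + _ in LHS]/(mproj K (_ + _)).
  by rewrite !g'E gD.
- have [a <-] := lev_pi_surj b; rewrite -(lim_liftK bc x); set y := lim_lift bc x.
  have -> : lev_pi D K a *: mproj K y = mproj K (to_Dhat a *: y) by [].
  by rewrite !g'E gS /= -fu.
by exists h => // m; rewrite /= hE g'E.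
Qed.
End Universal.

Section Crystal.
Variable F : crystal iR.

Definition ctower : mod_tower (Dtower D) :=
  @ModTower (Dtower D) (fun k => F (lev D k)) (fun k => cm_map (lev_tr D k))
    (fun k => cm_mapS F (lev_tr D k)).
Local Notation Mh := (lim_mod ctower).
Local Notation mapF := (@cm_map A R iR F _ _).
Implicit Types m : Mh.

Lemma ctower_bc k : is_base_change (rt_map (Dtower D) k) (mt_map ctower k).
Proof. exact: (cr_base_change F (lev_tr D k)). Qed.

Lemma ctower_map k (m : Mh) : mapF (lev_tr D k) (mproj k.+1 m) = mproj k m.
Proof. exact: (mproj_map k m). Qed.

Section Point.
Variables (B : cris_ob iR) (u : point B).

Definition factor K (leK : (depth B <= K)%N) : cris_hom (lev D K) B := projT1 (cid (fact_ex u leK)).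
Lemma factorE K (leK : (depth B <= K)%N) x : factor leK (lev_pi D K x) = u x.
Proof. by rewrite /factor; case: cid => h /= hE; apply: hE. Qed.

Definition ev (m : Mh) : F B := mapF (factor (leqnn _)) (mproj (depth B) m).

Let up K (h : cris_hom (lev D K) B) m :
  mapF (cris_comp h (lev_tr D K)) (mproj K.+1 m) = mapF h (mproj K m).
Proof. by rewrite cm_map_comp ctower_map. Qed.

Let upE K (h : cris_hom (lev D K) B) : h \o lev_pi D K =1 u ->
  cris_comp h (lev_tr D K) \o lev_pi D K.+1 =1 u.
Proof. by move=> hE x; rewrite -hE /= [Dtr _]Dtr_pi. Qed.

Let same K (h h' : cris_hom (lev D K) B) : h \o lev_pi D K =1 u -> h' \o lev_pi D K =1 u ->
  h = h'.
Proof.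
move=> hE hE'; apply: cris_hom_ext => y; have [x <-] := lev_pi_surj y.
by rewrite [LHS]hE [RHS]hE'.
Qed.

(** Two factorizations of [u], through levels [K] and [K'], are compared at level [K + K'], where
    they coincide because [D] surjects onto its levels. *)
Lemma evE K (h : cris_hom (lev D K) B) m : h \o lev_pi D K =1 u ->
  mapF h (mproj K m) = ev m.
Proof.
move=> hE; rewrite /ev; set h' := factor _.
have hE' : h' \o lev_pi D (depth B) =1 u := factorE (leqnn _).
move: (depth B) h' hE' => K' h' hE'.
suff climb n L (f : cris_hom (lev D L) B) : f \o lev_pi D L =1 u ->
    exists2 g : cris_hom (lev D (n + L)) B, g \o lev_pi D (n + L) =1 u &
      mapF g (mproj (n + L) m) = mapF f (mproj L m).
  have [g gE <-] := climb K' _ h hE; have [g' gE' <-] := climb K _ h' hE'.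
  by move: g' gE'; rewrite addnC => g' gE'; rewrite (same gE gE').
move=> fE; elim: n => [|n [g gE IH]]; first by exists f.
by exists (cris_comp g (lev_tr D _)); [exact: upE | rewrite [LHS]up].
Qed.

Lemma evD : additive_map ev.
Proof. by move=> x y; rewrite /ev -(cm_mapS F _).1. Qed.
Lemma ev_slin : slin u ev.
Proof.
move=> a m; rewrite /ev mproj_hat (cm_mapS F _).2; congr (_ *: _).
exact: factorE.
Qed.
Lemma ev_ker m : mproj (depth B) m = 0 -> ev m = 0.
Proof. by rewrite /ev => ->; apply: (additive_map0 (cm_mapS F _).1). Qed.
Lemma ev_adm0 : adm0 ev.
Proof. by split; [exact: evD | exists (depth B); exact: ev_ker]. Qed.

Lemma ev_univ : is_univ u ev.
Proof. exact: (base_change_univ ctower_bc (factorE (leqnn _)) (cr_base_change F _)). Qed.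
End Point.

Lemma ev_ext (B : cris_ob iR) (u u' : point B) : u =1 u' -> ev u =1 ev u'.
Proof.
move=> uu' m; apply: (@evE B u' _ (factor u (leqnn _)) m) => x.
by rewrite /= factorE uu'.
Qed.

Lemma ev_nat (B B' : cris_ob iR) (chi : cris_hom B B') (u : point B) m :
  mapF chi (ev u m) = ev (thom_comp (thom_of chi) u) m.
Proof.
rewrite -cm_map_comp; apply: evE => x.
by rewrite /= factorE.
Qed.

Lemma ev_lev K m : ev (lev_thom D K) m = mproj K m.
Proof.
by rewrite -(@evE _ _ K (cris_id _)) ?cm_map_id.
Qed.
End Crystal.
End Evaluation.

(** * Derivations and the Taylor formula *)

(** Only the second part of $\delta_i(a + b\epsilon) = \delta_i(a) + \delta_{i-1}(a) b \epsilon$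
    loses a degree, and since $\epsilon^2 = 0$ it enters each term of a product at most once. *)
Lemma dual_power (B : pdring) n (z : dual B) :
  pd_power (@pd_ideal (dual B)) (@pd_pow (dual B)) n z ->
  pd_power (@pd_ideal B) (@pd_pow B) n z.1 /\ pd_power (@pd_ideal B) (@pd_pow B) n.-1 z.2.
Proof.
elim=> [_ [s [Is ns ->]]||u v _ [Iu Iu'] _ [Iv Iv']|b v _ [Iv Iv']].
- have [h1 h2] : let N := (\sum_(p <- s) p.1)%N in
    pd_power (@pd_ideal B) (@pd_pow B) N (pd_prod (@pd_pow (dual B)) s).1 /\
    pd_power (@pd_ideal B) (@pd_pow B) N.-1 (pd_prod (@pd_pow (dual B)) s).2.
    elim: s Is {ns} => [|[i x] s IH] Is.
      rewrite /pd_prod !big_nil; split; last exact: span0.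
      by apply: span_gen; exists [::]; rewrite /pd_prod !big_nil.
    have [|/= h1 h2] := IH; first by move=> p ps; apply: Is; rewrite inE ps orbT.
    have Jx : pd_ideal x.1 by apply: (Is (i, x)); apply: mem_head.
    have -> : pd_prod (@pd_pow (dual B)) ((i, x) :: s) =
        @pd_pow (dual B) i x * pd_prod (@pd_pow (dual B)) s by apply: pd_prodS.
    rewrite !big_cons; set w := pd_prod _ s in h1 h2 *; set N := (\sum_(p <- s) p.1)%N in h1 h2 *.
    split; first exact: pd_power_mul.
    apply: spanD.
      apply: (@pd_power_le _ _ (i + N.-1)); last exact: pd_power_mul.
      by case: (N) => [|l]; rewrite ?addn0 ?leq_pred // addnS.
    case: i {Is} => [|i] /=; first by rewrite scaler0; apply: span0.
    rewrite -[_ *: _]/(w.1 * (pd_pow i x.1 * x.2)) mulrCA mulrA mulrC.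
    by apply: ideal_genM; apply: pd_power_mul.
  split; first exact: pd_power_le h1.
  apply: pd_power_le h2; rewrite -!subn1; exact: leq_sub2r.
- by split; apply: span0.
- by split; apply: spanD.
- split; first exact: ideal_genM.
  apply: spanD; first exact: ideal_genM.
  rewrite [_ *: _]mulrC; apply: ideal_genM; apply: pd_power_le Iv; exact: leq_pred.
Qed.

Section DualObject.
Variables (A : pdring) (R : comPzRingType) (iR : {rmorphism A -> R}).

Definition dual_ob (B : cris_ob iR) : cris_ob iR.
Proof.
refine (@CrisOb A R iR (dual B) (dual_in B \o co_alg B) (co_proj B \o dual_fst B) _ _ _ _ _).
- exact: (sqz_compatible _ (co_compatible B)).
- by move=> a; apply: (@co_projA _ _ _ B).
- by move=> y; have [x <-] := @co_surj _ _ _ B y; exists (dual_in B x).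
- by move=> x; apply: (@co_ker _ _ _ B).
(* [n.+1] instead of [n], because the infinitesimal component loses one degree by [dual_power]. *)
- have [m [n [m0 n0 mn]]] := co_nilp B; exists m, n.+1; split=> // z /dual_power [/= z1 z2].
  have Mn (y : dual B) k : y *+ k = (y.1 *+ k, y.2 *+ k) :> dual B.
    elim: k => [|k IH]; first by rewrite !mulr0n.
    by rewrite !mulrS IH; apply: sqz_ext.
  rewrite [LHS]Mn; congr (_, _); apply: mn => //.
  by apply: pd_power_le z1; apply: leqnSn.
Defined.

Definition dual_inh (B : cris_ob iR) : cris_hom B (dual_ob B).
Proof. by refine (@CrisHom _ _ _ B (dual_ob B) (dual_in B) _ _ (@sqz_in_pd _ _)). Defined.
Definition dual_fsth (B : cris_ob iR) : cris_hom (dual_ob B) B.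
Proof. by refine (@CrisHom _ _ _ (dual_ob B) B (dual_fst B) _ _ (@sqz_fst_pd _ _)). Defined.
Definition dual_maph (B B' : cris_ob iR) (f : cris_hom B B') : cris_hom (dual_ob B) (dual_ob B').
Proof.
refine (@CrisHom _ _ _ (dual_ob B) (dual_ob B') (dual_map (ch_map f)) _ _ _).
- move=> a; apply: sqz_ext; [exact: (ch_alg f)|exact: rmorph0].
- by move=> x; apply: (ch_proj f).
- by apply: dual_map_pd; apply: ch_pd.
Defined.
Definition dual_swaph (B : cris_ob iR) : cris_hom (dual_ob (dual_ob B)) (dual_ob (dual_ob B)).
Proof.
by refine (@CrisHom _ _ _ (dual_ob (dual_ob B)) (dual_ob (dual_ob B)) (dual_swap B) _ _
  (@dual_swap_pd B)).
Defined.

Section Part.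
Variable F : crystal iR.
Local Notation mapF := (@cm_map A R iR F _ _).

(** The crystal property makes [F (dual_ob B)] the sum of [F B] and [eps] times [F B]; this is the
    coefficient of [eps]. *)
Lemma epart_ex (B : cris_ob iR) : exists2 e : F (dual_ob B) -> F B, additive_map e &
  forall (z : dual_ob B) w, e (z *: mapF (dual_inh B) w) = z.2 *: w.
Proof.
have [w x y|z x y|b z w|e eD eE] :=
  bc_lift (cr_base_change F (dual_inh B)) (g := fun (z : dual B) w => z.2 *: w).
- by rewrite -scalerDl.
- by rewrite scalerDr.
- rewrite scalerA; congr (_ *: _).
  by rewrite -[LHS]/(b * z.2 + z.1 * 0) mulr0 addr0 mulrC.
by exists e.
Qed.
Definition epart (B : cris_ob iR) := s2val (cid2 (epart_ex B)).
Lemma epartD (B : cris_ob iR) : additive_map (@epart B). Proof. exact: (s2valP (cid2 (epart_ex B))). Qed.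
Lemma epartE (B : cris_ob iR) (z : dual_ob B) w : epart (z *: mapF (dual_inh B) w) = z.2 *: w.
Proof. exact: (s2valP' (cid2 (epart_ex B))). Qed.

Lemma dual_fstE (B : cris_ob iR) (z : dual_ob B) (w : F B) :
  mapF (dual_fsth B) (z *: mapF (dual_inh B) w) = z.1 *: w.
Proof.
rewrite (cm_mapS F _).2; congr (_ *: _); rewrite -cm_map_comp.
by rewrite (_ : cris_comp _ _ = cris_id B) ?cm_map_id //; apply: cris_hom_ext.
Qed.

Lemma epart_decomp (B : cris_ob iR) (x : F (dual_ob B)) : x = mapF (dual_inh B) (mapF (dual_fsth B) x) +
  (dual_eps B : dual_ob B) *: mapF (dual_inh B) (epart x).
Proof.
have fS := cm_mapS F (dual_fsth B); have iS := cm_mapS F (dual_inh B).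
move: x; apply: (bc_ind (cr_base_change F (dual_inh B))) => [|x y IHx IHy|z w].
- by rewrite (additive_map0 fS.1) (additive_map0 (@epartD B)) (additive_map0 iS.1) scaler0 addr0.
- by rewrite fS.1 epartD !iS.1 scalerDr addrACA -IHx -IHy.
- rewrite epartE dual_fstE !iS.2 scalerA -scalerDl; congr (_ *: _); exact: dualE.
Qed.

Lemma epart_in (B : cris_ob iR) (w : F B) : epart (mapF (dual_inh B) w) = 0.
Proof. by rewrite -[mapF _ _]scale1r epartE scale0r. Qed.
Lemma epart_eps (B : cris_ob iR) (w : F B) : epart ((dual_eps B : dual_ob B) *: mapF (dual_inh B) w) = w.
Proof. by rewrite epartE scale1r. Qed.
Lemma epartZ (B : cris_ob iR) (z : dual_ob B) x :
  epart (z *: x) = z.1 *: epart x + z.2 *: mapF (dual_fsth B) x.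
Proof.
have fS := cm_mapS F (dual_fsth B).
move: x; apply: (bc_ind (cr_base_change F (dual_inh B))) => [|x y IHx IHy|z' w].
- by rewrite scaler0 (additive_map0 (@epartD B)) (additive_map0 fS.1) !scaler0 addr0.
- by rewrite scalerDr !epartD fS.1 !scalerDr IHx IHy addrACA.
- rewrite scalerA !epartE dual_fstE !scalerA -scalerDl; congr (_ *: _).
  by rewrite /= mulrC [_ *: _]mulrC addrC [in RHS]addrC [in RHS](mulrC z.2).
Qed.
Lemma epart_nat (B B' : cris_ob iR) (f : cris_hom B B') x :
  epart (mapF (dual_maph f) x) = mapF f (epart x).
Proof.
have fS := cm_mapS F f; have dS := cm_mapS F (dual_maph f).
move: x; apply: (bc_ind (cr_base_change F (dual_inh B))) => [|x y IHx IHy|z w].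
- by rewrite (additive_map0 dS.1) !(additive_map0 (@epartD _)) (additive_map0 fS.1).
- by rewrite dS.1 !epartD fS.1 IHx IHy.
- rewrite dS.2 epartE fS.2 -cm_map_comp.
  rewrite (_ : cris_comp _ _ = cris_comp (dual_inh B') f) ?cm_map_comp ?epartE //.
  by apply: cris_hom_ext => y; apply: sqz_ext => //; apply: rmorph0.
Qed.

Definition dual_inh2 (B : cris_ob iR) := cris_comp (dual_inh (dual_ob B)) (dual_inh B).

Lemma epart2E (B : cris_ob iR) (c : dual_ob (dual_ob B)) w :
  epart (epart (c *: mapF (dual_inh2 B) w)) = c.2.2 *: w.
Proof. by rewrite cm_map_comp !epartE. Qed.

Lemma dual_swap_in2 (B : cris_ob iR) : cris_comp (dual_swaph B) (dual_inh2 B) = dual_inh2 B.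
Proof. exact: cris_hom_ext. Qed.

Lemma dual2_ind (B : cris_ob iR) (Q : F (dual_ob (dual_ob B)) -> Prop) : Q 0 ->
  (forall x y, Q x -> Q y -> Q (x + y)) ->
  (forall c w, Q (c *: mapF (dual_inh2 B) w)) -> forall x, Q x.
Proof. exact: (bc_ind (cr_base_change F (dual_inh2 B))). Qed.

Lemma epart_swap (B : cris_ob iR) x :
  epart (epart (mapF (dual_swaph B) x)) = epart (epart x).
Proof.
have sS := cm_mapS F (dual_swaph B).
move: x; apply: dual2_ind => [|x y IHx IHy|c w].
- by rewrite (additive_map0 sS.1).
- by rewrite sS.1 !epartD IHx IHy.
by rewrite sS.2 -cm_map_comp dual_swap_in2 !epart2E.
Qed.
End Part.
End DualObject.

(** * The operators of a crystal *)

Section Theta.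
Variables (A : pdring) (R : comPzRingType) (iR : {rmorphism A -> R}) (C : chart iR).
Local Notation D := (ch_D C).
Local Notation point B := (thom D (thick_of B)).
Local Notation t := (ch_t (c := C)).
Local Notation der := (ch_der (c := C)).

Section DualPoint.
Variables (B : cris_ob iR) (w : point B) (i : 'I_(ch_d C)).
Let dw (x : D) : (B^o : lmodType B) := w (der i x).
Let dwD : additive_map dw.
Proof. by move=> x y; rewrite /dw ch_derD rmorphD. Qed.
Let dwM x y : dw (x * y) = w x *: dw y + w y *: dw x.
Proof. by rewrite /dw ch_derM rmorphD !rmorphM. Qed.

(* The point with coordinates [w t_k + (k == i) eps]. *)
Definition dual_point : point (dual_ob B).
Proof.
refine (@THom _ _ _ D (thick_of (dual_ob B)) (sqz_pairR dwD dwM) _ _ _).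
- move=> a; apply: sqz_ext; first exact: (tm_alg w).
  by rewrite /= /dw ch_derA rmorph0.
- by move=> x; apply: (tm_proj w).
- apply: sqz_pair_pd; first exact: (tm_pd w).
  move=> n x Jx; rewrite /dw ch_der_pd // rmorphM.
  by have [_ ->] := tm_pd w Jx.
Defined.
Lemma dual_pointE x : dual_point x = (w x, w (der i x)) :> dual B. Proof. by []. Qed.
End DualPoint.

Section Crystal.
Variable F : crystal iR.
Local Notation mapF := (@cm_map A R iR F _ _).
Local Notation M := (ctower C F).
Local Notation Mh := (lim_mod M).
Implicit Types m : Mh.

Definition theta_lev i k m : F (lev D k) := epart (ev (dual_point (lev_thom D k) i) m).
Fact theta_sub i m k : mt_map M k (theta_lev i k.+1 m) = theta_lev i k m.
Proof.
rewrite -[LHS](epart_nat (lev_tr D k)) ev_nat; congr (epart _); apply: ev_ext => x.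
by apply: sqz_ext; rewrite /= [Dtr _]Dtr_pi.
Qed.
Definition theta i m : Mh := mk_lim_mod (theta_sub i m).

Lemma theta_ev (B : cris_ob iR) (w : point B) i m :
  epart (ev (dual_point w i) m) = ev w (theta i m).
Proof.
rewrite {2}/ev -[X in mapF _ X]/(theta_lev i _ m) /theta_lev -epart_nat ev_nat.
congr (epart _); apply: ev_ext => x; apply: sqz_ext; rewrite /= factorE //.
Qed.

Lemma dual_fst_ev (B : cris_ob iR) (w : point B) i m :
  mapF (dual_fsth B) (ev (dual_point w i) m) = ev w m.
Proof. by rewrite ev_nat; apply: ev_ext. Qed.


Lemma thetaD i : additive_map (theta i).
Proof.
move=> x y; apply: mproj_inj => k; rewrite -[LHS]/(theta_lev i k _).
by rewrite /theta_lev evD epartD.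
Qed.

Lemma thetaM i a m : theta i (to_Dhat a *: m) = to_Dhat (der i a) *: m + to_Dhat a *: theta i m.
Proof.
apply: mproj_inj => k; rewrite -[LHS]/(theta_lev i k _) /theta_lev ev_slin epartZ addrC.
by rewrite dual_fst_ev ev_lev.
Qed.

Lemma theta_cont i k : exists K, forall m, mproj K m = 0 -> mproj k (theta i m) = 0.
Proof.
exists (depth (dual_ob (lev D k))) => m m0; rewrite -[LHS]/(theta_lev i k m) /theta_lev.
by rewrite (ev_ker _ m0) (additive_map0 (@epartD _ _ _ _ _)).
Qed.

(** Both sides are the coefficient of the product of the two infinitesimals at a point of the
    iterated dual numbers. The swap exchanges the two points, since their coordinates have no mixed
    term. *)
Lemma theta_comm i k m : theta i (theta k m) = theta k (theta i m).
Proof.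
apply: mproj_inj => n; set B := lev D n.
pose w i' := dual_point (lev_thom D n) i'.
have E i' k' : epart (epart (ev (dual_point (w i') k') m)) = mproj n (theta i' (theta k' m)).
  by rewrite theta_ev theta_ev ev_lev.
rewrite -!E.
have <- : mapF (dual_swaph B) (ev (dual_point (w k) i) m) = ev (dual_point (w i) k) m.
  rewrite ev_nat; apply: ev_ext; apply: ch_uniq => l.
  have der0 i' k' : der i' (der k' (t l)) = 0.
    by rewrite ch_der_t -(rmorph_nat (th_alg D)) ch_derA.
  apply: sqz_ext; apply: sqz_ext => //=.
  by rewrite !der0.
by rewrite epart_swap.
Qed.

End Crystal.
End Theta.

Lemma eventually_forall (Q : nat -> nat -> Prop) :
  (forall l, exists K0, forall K, (K0 <= K)%N -> Q l K) ->
  forall n, exists K0, forall K, (K0 <= K)%N -> forall l, (l < n)%N -> Q l K.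
Proof.
move=> ev; elim=> [|n [K0 IH]]; first by exists 0%N.
have [K1 H1] := ev n; exists (maxn K0 K1) => K; rewrite geq_max => /andP[h0 h1] l.
by rewrite ltnS leq_eqVlt => /predU1P[->|/IH]; [apply: H1 | apply].
Qed.

(** * Taylor expansion over divided power polynomials *)

Section Taylor.
Variables (A : pdring) (R : comPzRingType) (iR : {rmorphism A -> R}) (C : chart iR).
Local Notation D := (ch_D C).
Local Notation point B := (thom D (thick_of B)).
Local Notation t := (ch_t (c := C)).
Local Notation der := (ch_der (c := C)).

Definition pth : thick iR.
Proof.
refine (@Thick _ _ _ (ppd D) (pc D \o th_alg D) (th_proj D \o p0 D) _ _ _ _).
- by apply: ppd_compatible; apply: th_compatible.
- by move=> a; apply: th_projA.
- by move=> y; have [x <-] := th_surj D y; exists (pc D x).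
- by move=> x; rewrite ppd_idealE; apply: th_ker.
Defined.
Local Notation U := (lev pth).

Definition pcT : thom D pth.
Proof. by refine (@THom _ _ _ D pth (pc D) _ _ (@pc_pd _)). Defined.
Definition p0T : thom pth D.
Proof. by refine (@THom _ _ _ pth D (p0 D) _ _ (@p0_pd _)). Defined.

Definition cpt K : point (U K) := thom_comp (lev_thom pth K) pcT.
Definition xi K l : U K := lev_pi pth K (pxi D l).

Lemma tau_ex i K : exists u : point (U K), forall k, u (t k) = cpt K (t k) + xi K 1 *+ (k == i).
Proof.
apply: ch_point => k.
have E1 : co_proj (U K) (cpt K (t k)) = th_proj D (t k) := tm_proj (cpt K) (t k).
have E2 : co_proj (U K) (xi K 1) = 0.
  by rewrite [LHS](@lev_projE _ _ _ pth K); apply: (rmorph0 (th_proj D)).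
by rewrite rmorphD rmorphMn E1 E2 mul0rn addr0.
Qed.
Definition tau i K := projT1 (cid (tau_ex i K)).
Lemma tauE i K k : tau i K (t k) = cpt K (t k) + xi K 1 *+ (k == i).
Proof. exact: (projT2 (cid (tau_ex i K)) k). Qed.

Definition zfact K k (leK : (depth (lev D k) <= K)%N) : cris_hom (U K) (lev D k) :=
  projT1 (cid (fact_ex (thom_comp (lev_thom D k) p0T) leK)).
Lemma zfactE K k leK a : @zfact K k leK (lev_pi pth K a) = lev_pi D k (p0 D a).
Proof. exact: (projT2 (cid (fact_ex (thom_comp (lev_thom D k) p0T) leK)) a). Qed.

Definition trfact K k (leK : (depth (U k) <= K)%N) : cris_hom (U K) (U k) :=
  projT1 (cid (fact_ex (lev_thom pth k) leK)).
Lemma trfactE K k leK a : @trfact K k leK (lev_pi pth K a) = lev_pi pth k a.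
Proof. exact: (projT2 (cid (fact_ex (lev_thom pth k) leK)) a). Qed.

Section ShiftThom.
Variable k : nat.
Let sh (a : pth) : ((U k)^o : lmodType (U k)) := lev_pi pth k (psh a).
Let shD : additive_map sh.
Proof. by move=> a b; rewrite /sh pshD rmorphD. Qed.
Let shM a b : sh (a * b) = lev_pi pth k a *: sh b + lev_pi pth k b *: sh a.
Proof.
rewrite /sh pshM rmorphD !rmorphM addrC; congr (_ + _).
exact: mulrC.
Qed.

(** The substitution of [xi + eps] for [xi], sending [a] to [a + eps (da/dxi)]. Through it, [epart]
    differentiates elements of [F (U K)] with respect to [xi], at the price of a lower level. *)
Definition shT : thom pth (thick_of (dual_ob (U k))).
Proof.
refine (@THom _ _ _ pth (thick_of (dual_ob (U k))) (sqz_pairR shD shM) _ _ _).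
- by move=> a; apply: sqz_ext; rewrite //= /sh psh_pc rmorph0.
- by move=> x; apply: (lev_projE k).
- apply: sqz_pair_pd; first exact: lev_pi_pd.
  by move=> n x Jx; rewrite /sh psh_pow // rmorphM; have [_ ->] := lev_pi_pd k Jx.
Defined.
End ShiftThom.

Definition shfact K k (leK : (depth (dual_ob (U k)) <= K)%N) : cris_hom (U K) (dual_ob (U k)) :=
  projT1 (cid (fact_ex (shT k) leK)).
Lemma shfactE K k leK a :
  @shfact K k leK (lev_pi pth K a) = (lev_pi pth k a, lev_pi pth k (psh a)) :> dual (U k).
Proof. exact: (projT2 (cid (fact_ex (shT k) leK)) a). Qed.

Section Crystal.
Variable F : crystal iR.
Local Notation mapF := (@cm_map A R iR F _ _).
Local Notation M := (ctower C F).
Local Notation Mh := (lim_mod M).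
Local Notation th i := (@theta _ _ _ C F i).
Implicit Types (m : Mh) (mu : nat -> Mh).

(* The element [\sum_l mu_l xi^[l]] of [F (U K)]. *)
Definition ser K mu : F (U K) := esum (fun l => xi K l *: ev (cpt K) (mu l)).

Let ser_ev0 K mu : ev0 mu -> ev0 (fun l => xi K l *: ev (cpt K) (mu l)).
Proof.
move=> [L muL]; exists L => l /muL ->.
by rewrite (additive_map0 (@evD _ _ _ _ _ _ (cpt K))) scaler0.
Qed.

Lemma serD K mu mu' : ev0 mu -> ev0 mu' -> ser K (fun l => mu l + mu' l) = ser K mu + ser K mu'.
Proof.
move=> h h'; rewrite -esumD; try exact: ser_ev0.
by congr esum; apply: funext => l; rewrite evD scalerDr.
Qed.

(** [F (U K)] is the base change along [cpt K], and the [xi K l] generate [U K] over [D]. The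
    coefficients need not be unique, since they are only seen at finite level. *)
Lemma ser_surj K (y : F (U K)) : exists2 mu, ev0 mu & y = ser K mu.
Proof.
move: y; apply: (un_ind (ev_univ _ (cpt K)) (Q := fun y => exists2 mu, ev0 mu & y = ser K mu)) => [|x y [mu h ->] [mu' h' ->]|b m].
- exists (fun _ => 0); first by exists 0%N.
  rewrite /ser (additive_map0 (@evD _ _ _ _ _ _ (cpt K))).
  by rewrite -[LHS](esum0 (F (U K))); congr esum; apply: funext => l; rewrite scaler0.
- by exists (fun l => mu l + mu' l); [exact: ev0D | rewrite serD].
have [a <-] := lev_pi_surj b.
exists (fun l => to_Dhat (pv D a l) *: m).
  by have [L aL] := pv_fin a; exists L => l /aL ->; rewrite rmorph0 scale0r.
have [L aL] := pv_fin a; rewrite {1}(ppdE aL) rmorph_sum scaler_suml.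
rewrite /ser (@esumE _ _ L) => [|l /aL ->]; last first.
  by rewrite rmorph0 scale0r (additive_map0 (@evD _ _ _ _ _ _ (cpt K))) scaler0.
apply: eq_bigr => l _; rewrite ev_slin rmorphM scalerA; congr (_ *: _).
exact: mulrC.
Qed.

Section Shift.
Variables (K k : nat) (leK : (depth (dual_ob (U k)) <= K)%N).
Definition shn (x : F (U K)) : F (U k) := epart (mapF (shfact leK) x).
Lemma shnD : additive_map shn.
Proof. by move=> x y; rewrite /shn (cm_mapS F _).1 epartD. Qed.

(** Substituting [xi + eps] in the point [tau] moves its coordinate [i] by [eps], which gives the
    dual point of [tau] in direction [i]; [theta_ev] reads off the coefficient of [eps]. *)
Lemma shn_ev i m : shn (ev (tau i K) m) = ev (tau i k) (th i m).
Proof.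
rewrite /shn ev_nat -theta_ev; congr (epart _); apply: ev_ext; apply: ch_uniq => l.
rewrite dual_pointE ch_der_t rmorph_nat tauE.
have E k' : cpt k' (t l) + xi k' 1 *+ (l == i) =
    lev_pi pth k' (pc D (t l) + pxi D 1 *+ (l == i)) by rewrite rmorphD rmorphMn.
rewrite -[LHS]/(shfact leK (tau i K (t l))) tauE !E [LHS]shfactE; congr (_, _).
rewrite pshD (additive_mapMn (@pshD D)) psh_pc add0r psh_pxiS pxi0.
by rewrite rmorphMn rmorph1.
Qed.

Let shn_cpt l m : shn (xi K l *: ev (cpt K) m) =
  lev_pi pth k (psh (pxi D l)) *: ev (cpt k) m.
Proof.
rewrite /shn (cm_mapS F _).2 ev_nat.
have -> : ev (thom_comp (thom_of (shfact leK)) (cpt K)) m = mapF (dual_inh (U k)) (ev (cpt k) m).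
  rewrite ev_nat; apply: ev_ext => x; rewrite -[LHS]/(shfact leK (lev_pi pth K (pc D x))).
  by rewrite [LHS]shfactE psh_pc rmorph0.
by rewrite epartE [ch_map _ _]shfactE.
Qed.

Lemma shn_ser mu : ev0 mu -> shn (ser K mu) = ser k (fun l => mu l.+1).
Proof.
move=> h; rewrite /ser (esum_map shnD (ser_ev0 K h)) esumS; last first.
  by apply: (ev0_map _ (ser_ev0 K h)); apply: (additive_map0 shnD).
rewrite shn_cpt psh_pxi0 rmorph0 scale0r add0r; congr esum; apply: funext => l.
by rewrite shn_cpt psh_pxiS.
Qed.
End Shift.

Section Zero.
Variables (K k : nat) (leK : (depth (lev D k) <= K)%N).

Lemma zfact_tau i m : mapF (zfact leK) (ev (tau i K) m) = mproj k m.
Proof.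
rewrite ev_nat -ev_lev; apply: ev_ext; apply: ch_uniq => l.
rewrite -[LHS]/(zfact leK (tau i K (t l))) tauE.
have -> : cpt K (t l) + xi K 1 *+ (l == i) =
    lev_pi pth K (pc D (t l) + pxi D 1 *+ (l == i)) by rewrite rmorphD rmorphMn.
by rewrite [LHS]zfactE rmorphD rmorphMn [p0 D (pxi D 1)](p0_pxi D 0) mul0rn addr0.
Qed.

Let zfact_cpt l m : mapF (zfact leK) (xi K l *: ev (cpt K) m) = if l is 0%N then mproj k m else 0.
Proof.
rewrite (cm_mapS F _).2 [ch_map _ _]zfactE ev_nat.
have -> : ev (thom_comp (thom_of (zfact leK)) (cpt K)) m = mproj k m.
  by rewrite -ev_lev; apply: ev_ext => x; apply: (@zfactE K k leK (pc D x)).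
case: l => [|l]; first by rewrite pxi0 !rmorph1 scale1r.
by rewrite [p0 D _](p0_pxi D l) rmorph0 scale0r.
Qed.

Lemma zfact_ser mu : ev0 mu -> mapF (zfact leK) (ser K mu) = mproj k (mu 0%N).
Proof.
move=> h; have zD := (cm_mapS F (zfact leK)).1.
rewrite /ser (esum_map zD (ser_ev0 K h)) esumS; last first.
  by apply: (ev0_map _ (ser_ev0 K h)); apply: (additive_map0 zD).
rewrite zfact_cpt (_ : (fun l => _) = fun=> 0) ?esum0 ?addr0 //.
by apply: funext => l; rewrite zfact_cpt.
Qed.
End Zero.

Section Truncation.
Variables (K k : nat) (leK : (depth (U k) <= K)%N).

Lemma trfact_tau i m : mapF (trfact leK) (ev (tau i K) m) = ev (tau i k) m.
Proof.
rewrite ev_nat; apply: ev_ext; apply: ch_uniq => l.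
rewrite -[LHS]/(trfact leK (tau i K (t l))) !tauE rmorphD rmorphMn.
by rewrite [trfact _ (cpt _ _)]trfactE [trfact _ (xi _ _)]trfactE.
Qed.

Lemma trfact_ser mu : ev0 mu -> mapF (trfact leK) (ser K mu) = ser k mu.
Proof.
move=> h; rewrite /ser (esum_map (cm_mapS F (trfact leK)).1 (ser_ev0 K h)).
congr esum; apply: funext => l; rewrite (cm_mapS F _).2 ev_nat.
congr (_ *: _); first exact: trfactE.
by apply: ev_ext => x; apply: trfactE.
Qed.

Lemma trfact_surj : surjective (trfact leK).
Proof. by move=> y; have [a <-] := lev_pi_surj y; exists (lev_pi pth K a); apply: trfactE. Qed.

Lemma trfact_ker (x : F (U K)) : mapF (trfact leK) x = 0 -> exists y, x = y *+ (k.+1)`!.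
Proof.
move/(bc_ker (cr_base_change F (trfact leK)) trfact_surj).
elim=> [_ [b [w [b0 ->]]]||u v _ [y ->] _ [z ->]|b v _ [y ->]].
- have [a aE] := lev_pi_surj b; move: b0; rewrite -aE [ch_map _ _]trfactE.
  move/lev_pi0 => [c _ ->]; exists (lev_pi pth K c *: w).
  by rewrite rmorphMn -scaler_nat -mulr_natl -scalerA scaler_nat.
- by exists 0; rewrite mul0rn.
- by exists (y + z); rewrite mulrnDl.
- by exists (b *: y); rewrite scalerMnr.
Qed.
End Truncation.

Lemma iter_thetaS i l m : iter l.+1 (th i) m = iter l (th i) (th i m).
Proof. by rewrite iterSr. Qed.

(** Differentiate [l] times and put [xi = 0]: the value at [tau] becomes [iter l (th i) m], the
    series becomes [mu l]. Each differentiation asks for a larger [K], so the bound [K0] depends on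
    [l]. *)
Lemma taylor_coef i l k : exists K0, forall K, (K0 <= K)%N -> forall m mu, ev0 mu ->
  ev (tau i K) m = ser K mu -> mproj k (mu l) = mproj k (iter l (th i) m).
Proof.
elim: l => [|l [K1 IH]].
  exists (depth (lev D k)) => K leK m mu h E.
  by rewrite -(zfact_ser leK h) -E zfact_tau.
exists (depth (dual_ob (U K1))) => K leK m mu h E.
rewrite iter_thetaS -(IH K1 (leqnn _) (th i m) (fun l => mu l.+1)) //; first exact: ev0_shift.
by rewrite -(shn_ser leK h) -E shn_ev.
Qed.

(** Here [K0] does not depend on [l]. Differentiation goes from level [K] down to [n], and modulo
    $(n+1)!$ the result lifts back to level [K], because the kernel of the truncation of [F (U K)]
    to [F (U n)] consists of multiples of $(n+1)!$. *)
Lemma taylor_coef_mod i k : exists K0, forall K, (K0 <= K)%N -> forall m mu, ev0 mu ->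
  ev (tau i K) m = ser K mu ->
  forall l, exists y, mproj k (iter l (th i) m) = mproj k (mu l) + y *+ (k.+1)`!.
Proof.
pose n := maxn k (depth (lev D k)).
have kn : (k <= n)%N := leq_maxl _ _; have dn : (depth (lev D k) <= n)%N := leq_maxr _ _.
exists (maxn (depth (U n)) (depth (dual_ob (U n)))) => K.
rewrite geq_max => /andP[leU leS] m mu h E l.
have [y yE] : exists y : F (U n),
    ev (tau i n) (iter l (th i) m) = ser n (fun r => mu (l + r)%N) + y *+ (n.+1)`!.
  elim: l => [|l [y yE]].
    by exists 0; rewrite mul0rn addr0 -(trfact_ser leU h) -E trfact_tau.
  have h' : ev0 (fun r => mu (l + r)%N).
    by have [L muL] := h; exists L => r Lr; apply: muL; apply: leq_trans (leq_addl _ _).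
  (* The error [y] is lifted to level [K]. What remains there lies in the kernel of the truncation,
     so the next differentiation again starts from an identity at level [K]. *)
  have [y' y'E] := bc_surj (cr_base_change F (trfact leU)) (@trfact_surj _ _ leU) y.
  have trD := (cm_mapS F (trfact leU)).1.
  have [|z zE] := @trfact_ker K n leU
      (ev (tau i K) (iter l (th i) m) - ser K (fun r => mu (l + r)%N) - y' *+ (n.+1)`!).
    rewrite !(additive_mapB trD) (additive_mapMn trD) trfact_tau trfact_ser // yE y'E.
    by rewrite addrAC addrK subrr.
  exists (shn leS (z + y')); rewrite iterS -(shn_ev leS).
  have -> : ev (tau i K) (iter l (th i) m) =
      ser K (fun r => mu (l + r)%N) + (z + y') *+ (n.+1)`!.
    by rewrite mulrnDl -zE subrK addrC subrK.
  rewrite shnD (additive_mapMn (shnD leS)) shn_ser //; congr (_ + _); congr (ser _ _).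
  by apply: funext => r; rewrite addnS.
have h' : ev0 (fun r => mu (l + r)%N).
  by have [L muL] := h; exists L => r Lr; apply: muL; apply: leq_trans (leq_addl _ _).
have zD := (cm_mapS F (zfact dn)).1.
have := congr1 (mapF (zfact dn)) yE; rewrite zfact_tau zD (additive_mapMn zD) zfact_ser //.
rewrite addn0 => ->; have /dvdnP[c ->] : (k.+1`! %| n.+1`!)%N.
  by rewrite -(bin_fact (n := n.+1) (m := k.+1)) ?ltnS // dvdn_mull // dvdn_mulr.
by eexists; rewrite mulrnA.
Qed.

(** The coefficients [mu l] of an expansion vanish for large [l], and [iter l (th i) m] agrees with
    them modulo $(k+1)!$. *)
Lemma theta_nilp i m k : exists L, forall l, (L <= l)%N ->
  exists y, mproj k (iter l (th i) m) = y *+ (k.+1)`!.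
Proof.
have [K H] := taylor_coef_mod i k; have [mu h E] := ser_surj (ev (tau i K) m).
have [L muL] := h; exists L => l /muL mul; have [y ->] := H K (leqnn _) m mu h E l.
by exists y; rewrite mul add0r.
Qed.

Section Point.
Variables (B : cris_ob iR) (u v : point B) (i : 'I_(ch_d C)).
Hypothesis uv : forall k, k != i -> u (t k) = v (t k).
Let x := u (t i) - v (t i).

Let Ix : pd_ideal x.
Proof.
apply/(@th_ker _ _ _ (thick_of B)); rewrite rmorphB.
by rewrite [th_proj _ _](tm_proj u) [X in _ - X](tm_proj v) subrr.
Qed.

Definition taylor_thom : thom pth (thick_of B).
Proof.
refine (@THom _ _ _ pth (thick_of B) (@pevalR D B v x Ix) _ _ _).
- by move=> a; rewrite /= [LHS](@peval_pc D B v x Ix); apply: (tm_alg v).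
- pose rho := @pevalR D B v x Ix.
  suff H (a : ppd D) : co_proj B (rho a) = th_proj D (p0 D a) by move=> a; apply: H.
  elim/ppd_ind: a => [|a b Ha Hb|c l]; rewrite ?rmorph0 //.
    by rewrite (rmorphD rho) !rmorphD Ha Hb.
  rewrite (rmorphM rho) [rho (pc D c)]peval_pc [rho (pxi D l)]peval_pxi !rmorphM.
  rewrite [co_proj B (v c)](tm_proj v); congr (_ * _).
  case: l => [|l]; first by rewrite (pd_0 (pd_ax B)) // pxi0 !rmorph1.
  rewrite (_ : p0 D (pxi D l.+1) = 0) // rmorph0; apply/(@th_ker _ _ _ (thick_of B)).
  exact: (pd_stable (pd_ax B)).
- by apply: peval_pd; apply: tm_pd.
Defined.

(** Expand the value at [tau] as a series and specialize [xi] to [x] over [v]. With [k = depth B],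
    the coefficients with [l <= k] are exact by [taylor_coef]; those with [l > k] are known modulo
    $(k+1)!$, which suffices because $(k+1)! \delta_l(x) = 0$ in [B]. *)
Theorem taylor m : ev0 (fun l => pd_pow l x *: ev v (iter l (th i) m)) /\
  ev u m = esum (fun l => pd_pow l x *: ev v (iter l (th i) m)).
Proof.
pose k := depth B; have [K1 H1] := taylor_coef_mod i k.
have [K2 H2] := eventually_forall (fun l => taylor_coef i l k) k.+1.
pose K := maxn k (maxn K1 K2); have leB : (depth B <= K)%N := leq_maxl _ _.
have le1 : (K1 <= K)%N by rewrite /K leq_max leq_maxl orbT.
have le2 : (K2 <= K)%N by rewrite /K leq_max leq_maxr orbT.
have [mu h E] := ser_surj (ev (tau i K) m).
have [rho rhoE] := fact_ex taylor_thom leB.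
have rho_c a : rho (cpt K a) = v a by rewrite [LHS]rhoE; apply: peval_pc.
have rho_xi l : rho (xi K l) = pd_pow l x by rewrite [LHS]rhoE; apply: peval_pxi.
have termE l : pd_pow l x *: ev v (mu l) = mapF rho (xi K l *: ev (cpt K) (mu l)).
  rewrite (cm_mapS F _).2 [ch_map _ _]rho_xi ev_nat; congr (_ *: _).
  by apply: ev_ext => a; rewrite -rho_c.
have -> : (fun l => pd_pow l x *: ev v (iter l (th i) m)) = fun l => pd_pow l x *: ev v (mu l).
  apply: funext => l; apply/subr0_eq; rewrite -scalerBr -(additive_mapB (evD v)).
  case: (leqP l k) => [lk|kl].
    rewrite (ev_ker v) ?scaler0 // -[LHS]/(mproj k _ - mproj k _).
    by rewrite (H2 K le2 l _ m mu h E) ?subrr.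
  have [y yE] := H1 K le1 m mu h E l.
  have -> : ev v (iter l (th i) m - mu l) = mapF (factor v (leqnn _)) y *+ (k.+1)`!.
    rewrite /ev -[mproj _ _]/(mproj k (iter l (th i) m) - mproj k (mu l)) yE addrC addKr.
    by rewrite (additive_mapMn (cm_mapS F _).1).
  have x0 : pd_pow l x *+ (k.+1)`! = 0.
    apply: (depthP (leqnn (depth B))); exists (pd_pow l x) => //; apply: span_gen.
    exists [:: (l, x)]; rewrite /pd_prod !big_seq1 /=; split=> // p.
    by rewrite inE => /eqP ->.
  by rewrite -scaler_nat scalerA mulr_natr x0 scale0r.
split.
  rewrite (_ : (fun l => _) = fun l => mapF rho (xi K l *: ev (cpt K) (mu l))).
    by apply: (ev0_map _ (ser_ev0 K h)); apply: (additive_map0 (cm_mapS F rho).1).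
  exact: funext.
transitivity (mapF rho (ev (tau i K) m)).
  rewrite ev_nat; apply: ev_ext; apply: ch_uniq => l.
  rewrite -[RHS]/(rho (tau i K (t l))) tauE rmorphD rmorphMn rho_c rho_xi (pd_1 (pd_ax B)) //.
  case: eqP => [->|/eqP/uv ->]; last by rewrite mulr0n addr0.
  by rewrite mulr1n /x addrC subrK.
rewrite E /ser (esum_map (cm_mapS F rho).1 (ser_ev0 K h)); congr esum.
by apply: funext => l; rewrite termE.
Qed.
End Point.
End Crystal.
End Taylor.

(** * The Taylor formula for functions *)

Section StructureCrystal.
Variables (A : pdring) (R : comPzRingType) (iR : {rmorphism A -> R}).

Definition str_mod (X : cris_ob iR) : lmodType X := (X : comPzRingType)^o.
Definition str_map (X Y : cris_ob iR) (f : cris_hom X Y) (x : str_mod X) : str_mod Y := ch_map f x.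
Fact str_mapS (X Y : cris_ob iR) (f : cris_hom X Y) : semilinear (ch_map f) (str_map f).
Proof. by split=> x y; [apply: rmorphD | apply: rmorphM]. Qed.

Definition str_module : cris_module iR.
Proof. by refine (@CrisModule A R iR str_mod str_map str_mapS _ _). Defined.

Definition str_crystal : crystal iR.
Proof.
refine (@Crystal A R iR str_module _) => X Y f.
apply: is_base_change_intro; first exact: str_mapS.
  move=> Q _ _ Qg x; rewrite -[x](mulr1 (x : Y)) -(rmorph1 (ch_map f)); exact: (Qg x 1).
exists (fun y => tmk (ch_map f) (y : (Y : comPzRingType)^o) (1 : str_mod X)).
  by split=> [x y|b x]; rewrite ?tmkDl ?tmkZl.
move=> m; rewrite -{2}[m](mulr1 (m : X)) -[m * 1 : str_mod X]/(m *: (1 : str_mod X)) -tmk_bal.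
by congr tmk; rewrite [_ *: _]mulr1.
Defined.

Variable C : chart iR.
Local Notation D := (ch_D C).
Local Notation point B := (thom D (thick_of B)).
Local Notation t := (ch_t (c := C)).
Local Notation der := (ch_der (c := C)).
Local Notation M := (ctower C str_crystal).

Definition str_hat (a : D) : lim_mod M :=
  @mk_lim_mod _ M (fun k => lev_pi D k a) (fun k => Dtr_pi k a).

Lemma ev_hat (B : cris_ob iR) (u : point B) a : ev u (str_hat a) = u a.
Proof. exact: factorE. Qed.

Lemma epart_str (B : cris_ob iR) (z : dual_ob B) :
  @epart A R iR str_crystal B z = z.2.
Proof.
have E := @epartE A R iR str_crystal B z (1 : str_mod B).
have zE : z *: (str_map (dual_inh B) 1 : str_mod (dual_ob B)) = z.
  by rewrite /str_map rmorph1; apply: (mulr1 (z : dual_ob B)).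
by transitivity (z.2 *: (1 : str_mod B)); [rewrite -E; congr epart | apply: mulr1].
Qed.

Lemma theta_hat i a : theta i (str_hat a) = str_hat (der i a).
Proof.
apply: mproj_inj => k; rewrite -[LHS]/(theta_lev i k (str_hat a)) /theta_lev.
by rewrite [X in epart X]ev_hat [LHS]epart_str.
Qed.

Lemma iter_theta_hat i l a : iter l (theta i) (str_hat a) = str_hat (iter l (der i) a).
Proof. by elim: l => [//|l IH]; rewrite !iterS IH theta_hat. Qed.

(** The Taylor formula for the structure crystal, on which [theta i] is the derivation [der i]. It
    is what makes a transported map linear along the new point. *)
Lemma taylor_ring (B : cris_ob iR) (u v : point B) i (x := u (t i) - v (t i)) :
  (forall k, k != i -> u (t k) = v (t k)) -> forall a,
  ev0 (fun l => pd_pow l x * v (iter l (der i) a)) /\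
  u a = esum (fun l => pd_pow l x * v (iter l (der i) a)).
Proof.
move=> uv a; have [h E] := @taylor A R iR C str_crystal B u v i uv (str_hat a).
have termE : (fun l => pd_pow l x * v (iter l (der i) a)) =
    (fun l => pd_pow l x *: ev v (iter l (theta i) (str_hat a))) :> (nat -> str_mod B).
  by apply: funext => l; rewrite iter_theta_hat ev_hat.
split; first by rewrite termE.
by rewrite -[LHS]ev_hat E termE.
Qed.
End StructureCrystal.

(** * Transport between points *)

Section DoubleSums.
Variable N : zmodType.
Implicit Types (Phi : nat -> nat -> N).

Definition boxed Phi L := forall l k, (L <= l)%N || (L <= k)%N -> Phi l k = 0.

Lemma esum_boxed Phi L : boxed Phi L ->
  esum (fun l => esum (Phi l)) = \sum_(l < L) \sum_(k < L) Phi l k.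
Proof.
move=> box; rewrite (@esumE _ _ L) => [|l Ll].
  by apply: eq_bigr => l _; apply: esumE => k Lk; apply: box; rewrite Lk orbT.
rewrite (_ : Phi l = fun=> 0) ?esum0 //; apply: funext => k; apply: box; by rewrite Ll.
Qed.

Lemma esum_exchange Phi L : boxed Phi L ->
  esum (fun l => esum (Phi l)) = esum (fun k => esum (Phi^~ k)).
Proof.
move=> box; rewrite (esum_boxed box) (@esum_boxed (fun k l => Phi l k) L) => [|l k].
  exact: exchange_big.
by rewrite orbC => /box.
Qed.

Lemma esum_triangle Phi L : boxed Phi L ->
  esum (fun l => esum (Phi l)) = esum (fun n => \sum_(l < n.+1) Phi l (n - l)%N).
Proof.
pose tri Phi n := \sum_(l < n.+1) Phi l (n - l)%N.
(* Induction on a bound [l0] for the nonzero rows; the size [L'] of the box only serves finiteness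
   and stays fixed. *)
suff H l0 Phi' L' : boxed Phi' L' -> (forall l k, (l0 <= l)%N -> Phi' l k = 0) ->
    esum (fun l => esum (Phi' l)) = esum (tri Phi').
  by move=> box; apply: (H L Phi L) => // l k Ll; apply: box; rewrite Ll.
elim: l0 Phi' => [|l0 IH] Phi' box Phi0.
  rewrite (_ : (fun l => _) = fun=> 0) ?esum0; last first.
    apply: funext => l; rewrite (_ : Phi' l = fun=> 0) ?esum0 //.
    by apply: funext => k; apply: Phi0.
  rewrite (_ : tri Phi' = fun=> 0) ?esum0 //.
  by apply: funext => n; apply: big1 => l _; apply: Phi0.
have box' : boxed (fun l => Phi' l.+1) L'.
  move=> l k lk; apply: box; case/orP: lk => [/leqW ->//|->]; exact: orbT.
have fin0 : ev0 (Phi' 0%N) by exists L' => k Lk; apply: box; rewrite Lk orbT.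
pose G n := \sum_(l < n) Phi' l.+1 (n - l.+1)%N.
have GS n : G n.+1 = tri (fun l => Phi' l.+1) n.
  by apply: eq_bigr => l _; rewrite subSS.
have finG : ev0 G.
  exists (L' + L')%N => n nL; apply: big1 => l _; apply: box.
  case: (leqP L' l) => [/leqW ->//|lL]; apply/orP; right.
  by rewrite leq_subRL ?ltn_ord // (leq_trans _ nL) // leq_add2r.
rewrite esumS; last first.
  exists L' => l Ll; rewrite (_ : Phi' l = fun=> 0) ?esum0 //; apply: funext => k.
  by apply: box; rewrite Ll.
rewrite (IH _ box') => [|l k l0l]; last exact: Phi0.
rewrite (_ : tri Phi' = fun n => Phi' 0%N n + G n); last first.
  apply: funext => n; rewrite /tri big_ord_recl subn0; congr (_ + _).
rewrite esumD // [esum G]esumS // [G 0%N]big_ord0 add0r; congr (_ + _).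
Qed.

Lemma pascal_sum Phi n : \sum_(k < n.+2) Phi k (n.+1 - k)%N *+ 'C(n.+1, k) =
  \sum_(k < n.+1) Phi k.+1 (n - k)%N *+ 'C(n, k) +
  \sum_(k < n.+1) Phi k (n - k).+1 *+ 'C(n, k).
Proof.
rewrite big_ord_recl bin0; under eq_bigr => k _.
  rewrite lift0 binS mulrnDr subSS; over.
rewrite big_split /= addrA addrC; congr (_ + _).
rewrite big_ord_recr /= bin_small // mulr0n addr0 [RHS]big_ord_recl bin0 !subn0.
congr (_ + _); apply: eq_bigr => k _; rewrite lift0.
by rewrite subnSK.
Qed.
End DoubleSums.

(** * Taylor operators in one coordinate *)

Section Operators.
Variables (A : pdring) (R : comPzRingType) (iR : {rmorphism A -> R}) (C : chart iR).
Local Notation D := (ch_D C).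
Local Notation point B := (thom D (thick_of B)).
Local Notation t := (ch_t (c := C)).
Local Notation der := (ch_der (c := C)).

(** What a crystal and a module with connection have in common; Taylor operators, crystals and
    connections are all built from this. The Leibniz rule is stated over [D] and reaches the
    completion through [tm_cont]. *)
Record is_thmod (M : mod_tower (Dtower D)) (th : 'I_(ch_d C) -> lim_mod M -> lim_mod M) :=
  IsThmod {
    tm_bc : forall k, is_base_change (rt_map (Dtower D) k) (mt_map M k);
    tm_thD : forall i, additive_map (th i);
    tm_thM : forall i a m, th i (to_Dhat a *: m) = to_Dhat (der i a) *: m + to_Dhat a *: th i m;
    tm_cont : forall i k, exists K, forall m, mproj K m = 0 -> mproj k (th i m) = 0;
    tm_comm : forall i k m, th i (th k m) = th k (th i m);
    tm_nilp : forall i m k, exists L, forall l, (L <= l)%N ->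
      exists y, mproj k (iter l (th i) m) = y *+ (k.+1)`! }.

Lemma theta_thmod (F : crystal iR) : is_thmod (@theta _ _ _ C F).
Proof.
split.
- exact: ctower_bc.
- exact: thetaD.
- exact: thetaM.
- exact: theta_cont.
- exact: theta_comm.
- exact: theta_nilp.
Qed.

Variables (M : mod_tower (Dtower D)) (th : 'I_(ch_d C) -> lim_mod M -> lim_mod M).
Hypothesis thm : is_thmod th.
Local Notation Mh := (lim_mod M).
Let bc := tm_bc thm.
Let thD := tm_thD thm.

Lemma iter_thD i l : additive_map (iter l (th i)).
Proof. by elim: l => [//|l IH] x y; rewrite !iterS IH thD. Qed.

Lemma iter_th_cont i l k : exists K, forall m, mproj K m = 0 -> mproj k (iter l (th i) m) = 0.
Proof.
elim: l k => [|l IH] k; first by exists k.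
have [K1 H1] := tm_cont thm i k; have [K H] := IH K1.
by exists K => m /H/H1.
Qed.

Lemma th_iter_comm i k l m : th i (iter l (th k) m) = iter l (th k) (th i m).
Proof. by elim: l => [//|l IH]; rewrite !iterS (tm_comm thm) IH. Qed.

Lemma iter_iter_comm i k l r m :
  iter r (th i) (iter l (th k) m) = iter l (th k) (iter r (th i) m).
Proof. by elim: r => [//|r IH]; rewrite !iterS IH th_iter_comm. Qed.

Lemma div_lift k n (m : Mh) : (exists y, mproj k m = y *+ n) ->
  exists y : Mh, exists2 z : Mh, m = y *+ n + z & mproj k z = 0.
Proof.
move=> [y yE]; have [y' y'E] := lim_surj bc y; exists y', (m - y' *+ n).
  by rewrite addrC subrK.
have pD : additive_map (mproj k : Mh -> M k) by [].
by rewrite (additive_mapB pD) (additive_mapMn pD) y'E yE subrr.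
Qed.

(** The continuity bound of [iter l (th i)] depends on [l]. However, an element that dies at level
    [n] is a multiple of $(n+1)!$ modulo arbitrarily deep kernels, and divisibility survives every
    iterate. *)
Lemma iter_th_div i l k n (m : Mh) : mproj n m = 0 ->
  exists2 y : Mh, mproj k (iter l (th i) m) = mproj k y & exists z, y = z *+ (n.+1)`!.
Proof.
move=> m0; have [K HK] := iter_th_cont i l k.
have [y [z mE z0]] := div_lift (ker_div bc K m0).
exists (iter l (th i) y *+ (n.+1)`!); last by exists (iter l (th i) y).
by rewrite mE iter_thD (additive_mapMn (iter_thD i l)) -[LHS]/(mproj k _ + mproj k _) HK ?addr0.
Qed.

Section Base.
Variable B : cris_ob iR.

Lemma pd_pow_fact l n (x : B) : pd_ideal x -> (depth B <= n)%N -> (n < l)%N ->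
  pd_pow l x *+ (n.+1)`! = 0.
Proof.
move=> Ix dn nl; apply: (depthP dn); exists (pd_pow l x) => //; apply: span_gen.
exists [:: (l, x)]; rewrite /pd_prod !big_seq1 /=; split=> // p.
by rewrite inE => /eqP ->.
Qed.

Variable N : lmodType B.
Implicit Types g : Mh -> N.

(** Precomposition with $\sum_l \delta_l(x) \theta_i^l$, written on the maps [g] out of the limit
    because the scalars [pd_pow l x] act on the target only. *)
Definition opE i (x : B) g : Mh -> N :=
  fun m => esum (fun l => pd_pow l x *: g (iter l (th i) m)).

Lemma adm0_bound g : adm0 g -> exists2 n, (depth B <= n)%N & forall m, mproj n m = 0 -> g m = 0.
Proof.
move=> [_ [K gK]]; exists (maxn (depth B) K) => [|m m0]; first exact: leq_maxl.
by apply: gK; apply: mproj_le m0; apply: leq_maxr.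
Qed.

Lemma pd_pow_kill g n l (x : B) m : additive_map g -> (forall m, mproj n m = 0 -> g m = 0) ->
  pd_ideal x -> (depth B <= n)%N -> (n < l)%N ->
  (exists y, mproj n m = y *+ (n.+1)`!) -> pd_pow l x *: g m = 0.
Proof.
move=> gD gn Ix dn nl /div_lift[y [z mE z0]].
rewrite mE gD (gn z) // addr0 (additive_mapMn gD) -scaler_nat scalerA mulr_natr.
by rewrite pd_pow_fact ?scale0r.
Qed.

(** For large [l], uniformly in [r]: the finitely many [r <= n] are settled one by one by
    nilpotence; for [r > n] the factor [pd_pow r y] kills multiples of $(n+1)!$, and
    [iter l (th i) m] is one up to an element dying at level [n]. Large [r] is the same statement
    after commuting the operators. *)
Lemma opE_boxed g i k (x y : B) m : adm0 g -> pd_ideal x -> pd_ideal y ->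
  exists L, boxed (fun l r => pd_pow l x *: (pd_pow r y *: g (iter r (th k) (iter l (th i) m)))) L.
Proof.
move=> gadm Ix Iy; have gD := gadm.1; have [n dn gn] := adm0_bound gadm.
have half i' k' (x' y' : B) : pd_ideal x' -> pd_ideal y' -> exists L, forall l, (L <= l)%N ->
    forall r, pd_pow l x' *: (pd_pow r y' *: g (iter r (th k') (iter l (th i') m))) = 0.
  move=> Ix' Iy'; have [L0 HL0] := tm_nilp thm i' m n.
  have small r : exists L, forall l, (L <= l)%N ->
      pd_pow l x' *: (pd_pow r y' *: g (iter r (th k') (iter l (th i') m))) = 0.
    have [K HK] := iter_th_cont k' r n.
    have [L HL] := tm_nilp thm i' m (maxn K n).
    exists (maxn L (maxn K n).+1) => l; rewrite geq_max => /andP[/HL yl nl].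
    rewrite scalerA mulrC -scalerA.
    rewrite (@pd_pow_kill (fun m => g (iter r (th k') m)) (maxn K n)) ?scaler0 //.
    - by move=> u v; rewrite iter_thD gD.
    - by move=> m' m0; apply/gn/HK; apply: mproj_le m0; apply: leq_maxl.
    - by apply: leq_trans dn _; apply: leq_maxr.
  have [L HL] := eventually_forall small n.+1.
  exists (maxn L L0) => l; rewrite geq_max => /andP[lL lL0] r.
  case: (leqP r n) => [rn|nr]; first exact: HL.
  rewrite (@pd_pow_kill g n) ?scaler0 //.
  have [z [w mE w0]] := div_lift (HL0 l lL0).
  have [z' z'E [z'' z''E]] := iter_th_div k' r n w0.
  rewrite mE iter_thD (additive_mapMn (iter_thD k' r)).
  exists (mproj n (iter r (th k') z + z'')).
  have pD : additive_map (mproj n : Mh -> M n) by [].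
  by rewrite !pD mulrnDl z'E z''E !(additive_mapMn pD).
have [L1 H1] := half i k x y Ix Iy; have [L2 H2] := half k i y x Iy Ix.
exists (maxn L1 L2) => l r; rewrite !geq_max => /orP[/andP[h _]|/andP[_ h]].
  exact: H1.
by rewrite iter_iter_comm scalerA mulrC -scalerA; apply: H2.
Qed.

Lemma opE_fin g i (x : B) m : adm0 g -> pd_ideal x ->
  ev0 (fun l => pd_pow l x *: g (iter l (th i) m)).
Proof.
move=> gadm Ix; have [L box] := opE_boxed i i m gadm Ix (pdi0 B).
exists L => l Ll; have := box l 0%N; rewrite Ll => /(_ isT).
by rewrite (pd_0 (pd_ax B)) ?scale1r //; apply: pdi0.
Qed.

Lemma opE_adm0 g i (x : B) : adm0 g -> pd_ideal x -> adm0 (opE i x g).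
Proof.
move=> gadm Ix; have gD := gadm.1; split=> [u v|].
  rewrite -esumD; try exact: opE_fin.
  by congr esum; apply: funext => l; rewrite iter_thD gD scalerDr.
have [n dn gn] := adm0_bound gadm.
have [K HK] : exists K, forall l, (l < n.+1)%N -> forall m, mproj K m = 0 ->
    mproj n (iter l (th i) m) = 0.
  have [|K /(_ K (leqnn _)) HK] := @eventually_forall
      (fun l K => forall m, mproj K m = 0 -> mproj n (iter l (th i) m) = 0) _ n.+1.
    move=> l; have [K0 H0] := iter_th_cont i l n; exists K0 => K leK m m0.
    by apply: H0; apply: mproj_le m0.
  by exists K.
exists (maxn K n) => m m0.
rewrite -[RHS](esum0 N); congr esum; apply: funext => l.
case: (leqP l n) => [ln|nl].
  rewrite gn ?scaler0 //; apply: HK => //; apply: mproj_le m0; exact: leq_maxl.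
apply: (@pd_pow_kill g n) => //.
have [|y yE [z zE]] := @iter_th_div i l n n m; first by apply: mproj_le m0; apply: leq_maxr.
have pD : additive_map (mproj n : Mh -> M n) by [].
by exists (mproj n z); rewrite yE zE (additive_mapMn pD).
Qed.

Lemma opE_add g i (x y : B) : adm0 g -> pd_ideal x -> pd_ideal y ->
  opE i x (opE i y g) = opE i (x + y) g.
Proof.
move=> gadm Ix Iy; apply: funext => m; have [L box] := opE_boxed i i m gadm Ix Iy.
rewrite /opE; transitivity (esum (fun l => esum (fun r =>
    pd_pow l x *: (pd_pow r y *: g (iter r (th i) (iter l (th i) m)))))).
  congr esum; apply: funext => l; rewrite (esum_map (scalerDr _)) //.
  exact: opE_fin.
rewrite (esum_triangle box); congr esum; apply: funext => n.
rewrite (pd_D (pd_ax B)) // scaler_suml; apply: eq_bigr => l _.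
by rewrite scalerA -iterD subnK // -ltnS.
Qed.

Lemma opE_comm g i k (x y : B) : adm0 g -> pd_ideal x -> pd_ideal y ->
  opE i x (opE k y g) = opE k y (opE i x g).
Proof.
move=> gadm Ix Iy; apply: funext => m; have [L box] := opE_boxed i k m gadm Ix Iy.
transitivity (esum (fun l => esum (fun r =>
    pd_pow l x *: (pd_pow r y *: g (iter r (th k) (iter l (th i) m)))))).
  congr esum; apply: funext => l; rewrite (esum_map (scalerDr _)) //.
  exact: opE_fin.
rewrite (esum_exchange box); congr esum; apply: funext => r.
rewrite (esum_map (scalerDr _)); last exact: opE_fin.
congr esum; apply: funext => l.
by rewrite scalerA mulrC -scalerA iter_iter_comm.
Qed.

Lemma opE0 g i : opE i 0 g = g.
Proof.
apply: funext => m; rewrite /opE (@esumE _ _ 1) => [|[//|l] _].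
  by rewrite big_ord1 /= (pd_0 (pd_ax B)) ?scale1r //; apply: pdi0.
by rewrite pd_pow_0 // scale0r.
Qed.

(** [u a] is given by its Taylor series at [v]. Its product with the series of [m], regrouped by
    total degree, is the series of [a m] by the iterated Leibniz rule, since $\delta_k \delta_{n-k}
    = \binom{n}{k} \delta_n$. *)
Lemma opE_slin g i (u v : point B) : adm0 g -> slin v g ->
  (forall k, k != i -> u (t k) = v (t k)) -> pd_ideal (u (t i) - v (t i)) ->
  slin u (opE i (u (t i) - v (t i)) g).
Proof.
set x := _ - _ => gadm gS uv Ix a m; have gD := gadm.1.
have [[L1 H1] uE] := taylor_ring uv a; have [L2 H2] := opE_fin i m gadm Ix.
pose Phi l r := (pd_pow l x * v (iter l (der i) a)) *: (pd_pow r x *: g (iter r (th i) m)).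
have box : boxed Phi (maxn L1 L2).
  move=> l r; rewrite !geq_max => /orP[/andP[h _]|/andP[_ h]].
    by rewrite /Phi H1 // scale0r.
  by rewrite /Phi H2 // scaler0.
have leibniz l : g (iter l (th i) (to_Dhat a *: m)) =
    \sum_(k < l.+1) ('C(l, k)%:R * v (iter k (der i) a)) *: g (iter (l - k) (th i) m).
  have gMn n y : g (y *+ n) = g y *+ n := additive_mapMn gD y n.
  pose s n := \sum_(k < n.+1) (to_Dhat (iter k (der i) a) *: iter (n - k) (th i) m) *+ 'C(n, k).
  have sE n : iter n (th i) (to_Dhat a *: m) = s n.
    elim: n => [|n IH]; first by rewrite /s big_ord1.
    rewrite iterS IH (additive_map_sum (thD i)).
    under eq_bigr do rewrite (additive_mapMn (thD i)) (tm_thM thm) mulrnDl.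
    rewrite big_split /= /s (pascal_sum (fun k r => to_Dhat (iter k (der i) a) *: iter r (th i) m)).
    by [].
  rewrite sE (additive_map_sum gD); apply: eq_bigr => k _.
  by rewrite gMn gS -scalerA scaler_nat.
rewrite /opE uE (esum_map (h := fun b => b *: _) (fun b c => scalerDl _ b c)); last by exists L1.
transitivity (esum (fun l => esum (Phi l))); last first.
  congr esum; apply: funext => l; rewrite /Phi (esum_map (scalerDr _)) //; by exists L2.
rewrite (esum_triangle box); congr esum; apply: funext => n.
rewrite leibniz scaler_sumr; apply: eq_bigr => k _.
have kn : (k <= n)%N by rewrite -ltnS.
rewrite /Phi !scalerA; congr (_ *: _).
have := pd_M (pd_ax B) k (n - k)%N Ix; rewrite subnKC // => E.
by rewrite [RHS]mulrAC E mulrCA mulrA.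
Qed.
End Base.
End Operators.

(** * Taylor operators in all coordinates *)

Section Transport.
Variables (A : pdring) (R : comPzRingType) (iR : {rmorphism A -> R}) (C : chart iR).
Local Notation D := (ch_D C).
Local Notation point B := (thom D (thick_of B)).
Local Notation t := (ch_t (c := C)).
Local Notation d := (ch_d C).

Definition gap (B : cris_ob iR) (u v : point B) : 'I_d -> B := fun i => u (t i) - v (t i).

Lemma gap_ideal (B : cris_ob iR) (u v : point B) i : pd_ideal (gap u v i).
Proof.
apply/(@th_ker _ _ _ (thick_of B)); rewrite rmorphB.
by rewrite [th_proj _ _](tm_proj u) [X in _ - X](tm_proj v) subrr.
Qed.

(* Every point is reached from another by changing the coordinates one by one. *)
Lemma point_path (B : cris_ob iR) (u v : point B) (Q : seq 'I_d -> point B -> Prop) :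
  (forall w : point B, v =1 w -> Q [::] w) ->
  (forall i s (w w' : point B), i \notin s -> gap w w' i = gap u v i ->
     (forall k, k != i -> w (t k) = w' (t k)) -> Q s w' -> Q (i :: s) w) ->
  exists2 w, Q (enum 'I_d) w & w =1 u.
Proof.
move=> Q0 QS.
suff H (s : seq 'I_d) : uniq s -> exists2 w, Q s w &
    forall k, w (t k) = if k \in s then u (t k) else v (t k).
  have [w Qw wE] := H _ (enum_uniq 'I_d); exists w => //.
  by apply: ch_uniq => k; rewrite wE mem_enum.
elim: s => [_|i s IH /= /andP[is_ /IH[w' Qw' w'E]]].
  by exists v => //; apply: Q0.
have [|w wE] := @ch_point _ _ _ C B (fun k => if k \in i :: s then u (t k) else v (t k)).
  by move=> k; case: ifP => _; [apply: (tm_proj u) | apply: (tm_proj v)].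
exists w => //; apply: (QS _ _ _ w') => //.
  by rewrite /gap wE w'E mem_head (negbTE is_).
by move=> k ki; rewrite wE w'E inE (negbTE ki).
Qed.

Section Module.
Variables (M : mod_tower (Dtower D)) (th : 'I_d -> lim_mod M -> lim_mod M).
Hypothesis thm : is_thmod th.
Local Notation Mh := (lim_mod M).

Section Base.
Variables (B : cris_ob iR) (N : lmodType B).
Implicit Types (g : Mh -> N) (x y : 'I_d -> B) (s : seq 'I_d).

Definition opS s x g : Mh -> N := foldr (fun i => opE th i (x i)) g s.
Definition opA x g := opS (enum 'I_d) x g.

Lemma opS_adm0 s x g : adm0 g -> (forall i, pd_ideal (x i)) -> adm0 (opS s x g).
Proof. by move=> gadm Ix; elim: s => [//|i s IH]; apply: (opE_adm0 thm). Qed.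

Lemma opE_opS s x g i (y : B) : adm0 g -> (forall i, pd_ideal (x i)) -> pd_ideal y ->
  opE th i y (opS s x g) = opS s x (opE th i y g).
Proof.
move=> gadm Ix Iy; elim: s => [//|k s IH] /=; rewrite -IH.
by rewrite (opE_comm thm) //; apply: opS_adm0.
Qed.

Lemma opS_add s x y g : adm0 g -> (forall i, pd_ideal (x i)) -> (forall i, pd_ideal (y i)) ->
  opS s x (opS s y g) = opS s (fun i => x i + y i) g.
Proof.
move=> gadm Ix Iy; elim: s => [//|i s IH] /=.
rewrite -opE_opS //; last exact: opS_adm0.
rewrite (opE_add thm) //; last by apply: opS_adm0 => //; apply: opS_adm0.
by rewrite IH.
Qed.

Lemma opS0 s g : opS s (fun=> 0) g = g.
Proof. by elim: s => [//|i s IH] /=; rewrite opE0 IH. Qed.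

Lemma opA_slin (u v : point B) g : adm0 g -> slin v g -> slin u (opA (gap u v) g).
Proof.
move=> gadm gS.
have [||w wS wu] := @point_path B u v (fun s w => slin w (opS s (gap u v) g)).
- by move=> w vw a m; rewrite -vw; apply: gS.
- move=> i s w w' _ E ww' S'; rewrite /= -E.
  apply: (opE_slin thm) => //; first by apply: opS_adm0 => // k; apply: gap_ideal.
  exact: gap_ideal.
by move=> a m; rewrite /opA wS wu.
Qed.
End Base.

Lemma opE_nat (B B' : cris_ob iR) (chi : cris_hom B B') (N : lmodType B) (N' : lmodType B')
    (h : N -> N') (g : Mh -> N) i (x : B) : semilinear (ch_map chi) h -> adm0 g -> pd_ideal x ->
  h \o opE th i x g = opE th i (chi x) (h \o g).
Proof.
move=> [hD hZ] gadm Ix; apply: funext => m; rewrite /= /opE (esum_map hD).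
  congr esum; apply: funext => l; rewrite hZ.
  by have [_ ->] := ch_pd chi Ix.
exact: (opE_fin thm).
Qed.


Lemma opA_nat (B B' : cris_ob iR) (chi : cris_hom B B') (N : lmodType B) (N' : lmodType B')
    (h : N -> N') (g : Mh -> N) (x : 'I_d -> B) :
  semilinear (ch_map chi) h -> adm0 g -> (forall i, pd_ideal (x i)) ->
  h \o opA x g = opA (chi \o x) (h \o g).
Proof.
move=> hS gadm Ix; rewrite /opA; elim: (enum _) => [//|i s IH] /=.
by rewrite -IH (opE_nat _ hS) //; apply: opS_adm0.
Qed.
End Module.

Lemma ev_opA (F : crystal iR) (B : cris_ob iR) (u v : point B) :
  opA (@theta _ _ _ C F) (gap u v) (ev v) = ev u.
Proof.
have [||w wE wu] := @point_path B u v
  (fun s w => opS (@theta _ _ _ C F) s (gap u v) (ev v) = ev w).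
- by move=> w vw; apply: funext; apply: ev_ext.
- move=> i s w w' _ E ww' S'; rewrite /= S' -E; apply: funext => m; apply/esym.
  by have [_] := taylor ww' m.
by rewrite /opA wE; apply: funext; apply: ev_ext.
Qed.
End Transport.

(** * Connections in coordinates *)

Lemma alternating_sum (V : zmodType) d (f : 'I_d -> 'I_d -> V) :
  (forall i, f i i = 0) -> (forall i j, f i j = - f j i) -> \sum_i \sum_j f i j = 0.
Proof.
move=> f0 fN; pose lo := \sum_(i < d) \sum_(j < d | (j < i)%N) f i j.
have -> : \sum_i \sum_j f i j = lo + \sum_(i < d) \sum_(j < d | (i < j)%N) f i j.
  rewrite -big_split; apply: eq_bigr => i _ /=.
  rewrite (bigID (fun j : 'I_d => (j < i)%N)) /=; congr (_ + _).
  rewrite (bigD1 i) /= ?ltnn // f0 add0r; apply: eq_bigl => j.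
  by rewrite -leqNgt [RHS]ltn_neqAle andbC eq_sym.
rewrite [X in _ + X](exchange_big_dep xpredT) //= -big_split big1 // => i _.
rewrite -big_split big1 // => j _ /=; by rewrite fN addNr.
Qed.

Section Coordinates.
Variables (A : pdring) (R : comPzRingType) (iR : {rmorphism A -> R}) (C : chart iR).
Local Notation D := (ch_D C).
Local Notation iA := (th_alg D).
Local Notation t := (ch_t (c := C)).
Local Notation der := (ch_der (c := C)).
Local Notation d := (ch_d C).
Local Notation Om := (omega iA).
Local Notation nJ := (npd D).


(** The coefficient of [dt_i] in a form. It exists because [der i] satisfies the relations defining
    [omega]; with [omcE] it makes the [dt_i] a basis. *)
Definition omc i : Om -> D := plift (rel := omega_rel iA) (fun b x => b * der i x).

Section Omc.
Variable i : 'I_d.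
Let hD (b c x : D) : (b + c) * der i x = b * der i x + c * der i x.
Proof. exact: mulrDl. Qed.
Let hrel b s : omega_rel iA s -> \sum_(p <- s) (b * p.1) * der i p.2 = 0.
Proof.
move=> rs; suff E : \sum_(p <- s) p.1 * der i p.2 = 0.
  rewrite -[RHS](mulr0 b) -[in RHS]E mulr_sumr; apply: eq_bigr => p _; exact/esym/mulrA.
case: rs => [x y|x y|a|n x Ix]; rewrite !big_cons big_nil /= addr0 ?mul1r.
- by rewrite ch_derD !mulN1r -opprD subrr.
- by rewrite ch_derM !mulNr -opprD subrr.
- exact: ch_derA.
- by rewrite ch_der_pd // mulNr subrr.
Qed.
Lemma omcD : additive_map (omc i). Proof. exact: pliftD hD hrel. Qed.
Lemma omc_gen b x : omc i (b *: du iA x) = b * der i x. Proof. exact: (plift_gen hD hrel). Qed.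
End Omc.

Lemma omc_du i x : omc i (du iA x) = der i x.
Proof. by rewrite -[du _ _]scale1r omc_gen mul1r. Qed.

Lemma omcZ i b w : omc i (b *: w) = b * omc i w.
Proof.
elim/pres_ind: w => [|u v Hu Hv|c x].
- by rewrite scaler0 (additive_map0 (@omcD i)) mulr0.
- by rewrite scalerDr !omcD Hu Hv mulrDr.
- by rewrite scalerA !omc_gen mulrA.
Qed.

Lemma omcE w : w = \sum_i omc i w *: du iA (t i).
Proof.
elim/pres_ind: w => [|u v Hu Hv|c x].
- by rewrite big1 // => i _; rewrite (additive_map0 (@omcD i)) scale0r.
- by rewrite {1}Hu {1}Hv -big_split; apply: eq_bigr => i _; rewrite omcD scalerDl.
- rewrite -/(du iA x) {1}ch_omega scaler_sumr; apply: eq_bigr => i _.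
  by rewrite omc_gen scalerA.
Qed.

Lemma omc_npd i n v : span (smul_set (nJ n) (V := Om)) v -> ideal_gen (nJ n) (omc i v).
Proof.
elim=> [_ [b [w [nb ->]]]||u w _ Hu _ Hw|b w _ Hw].
- by rewrite omcZ mulrC; apply: ideal_genM; apply: span_gen.
- by rewrite (additive_map0 (@omcD i)); apply: span0.
- by rewrite omcD; apply: spanD.
- by rewrite omcZ; apply: ideal_genM.
Qed.

Lemma der_npd i n y : nJ n.+1 y -> nJ n (der i y).
Proof. by move=> ny; apply/npdP; rewrite -omc_du; apply: omc_npd; apply/du_nJ/span_gen. Qed.

Definition omcl k i : qmod (nJ k.+1) Om -> Dlev D k :=
  @zquot_map D D Om D^o (smul_set (nJ k.+1) (V := Om)) (nJ k.+1) (omc i).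
Lemma omcl_pi k i v : omcl i (mpi (nJ k.+1) v) = qpi (nJ k.+1) (omc i v).
Proof. exact: (@zquot_mapE D D Om D^o _ _ _ _ (@omcD i) (@omc_npd i k.+1)). Qed.
Lemma omclD k i : additive_map (@omcl k i).
Proof.
move=> x y; have [u ->] := mpi_surj x; have [v ->] := mpi_surj y.
by rewrite -mpiD !omcl_pi omcD rmorphD.
Qed.
Lemma omclZ k i b (w : qmod (nJ k.+1) Om) : omcl i (b *: w) = b * omcl i w.
Proof.
have [c ->] := qpi_surj b; have [v ->] := mpi_surj w.
by rewrite -mpiZ !omcl_pi omcZ rmorphM.
Qed.

Lemma hc_sub i (w : OmHat1 iA) k : rt_map (Dtower D) k (omcl i (mproj k.+1 w)) = omcl i (mproj k w).
Proof.
rewrite -(mproj_map k w); have [v ->] := mpi_surj (mproj k.+1 w).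
by rewrite [mt_map _ _ _]Vtr_pi !omcl_pi [LHS]Dtr_pi.
Qed.
Definition hc i (w : OmHat1 iA) : Dhat D := @mk_lim_ring (Dtower D) _ (hc_sub i w).
Lemma hcD i : additive_map (hc i).
Proof. by move=> x y; apply: rproj_inj => k; apply: omclD. Qed.
Lemma hcZ i f w : hc i (f *: w) = f * hc i w.
Proof. by apply: rproj_inj => k; apply: omclZ. Qed.

Definition dt i : OmHat1 iA := dhat iA (to_Dhat (t i)).

Lemma rproj_hc k i (f : Dhat D) a : rproj k.+1 f = qpi (nJ k.+2) a ->
  rproj k (hc i (dhat iA f)) = qpi (nJ k.+1) (der i a).
Proof. by move=> fE; rewrite -[LHS]/(omcl i (dlev _ (rproj k.+1 f))) fE dlev_pi omcl_pi omc_du. Qed.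

Lemma hc_dhat i a : hc i (dhat iA (to_Dhat a)) = to_Dhat (der i a).
Proof. by apply: rproj_inj => k; apply: rproj_hc. Qed.
Lemma hc_dt i k : hc i (dt k) = (k == i)%:R.
Proof. by rewrite hc_dhat ch_der_t rmorph_nat. Qed.

Lemma mproj_sum (T : ring_tower) (N : mod_tower T) k I (r : seq I) (F : I -> lim_mod N) :
  mproj k (\sum_(i <- r) F i) = \sum_(i <- r) mproj k (F i).
Proof. exact: (big_morph (mproj k : lim_mod N -> N k)). Qed.

Lemma hcE w : w = \sum_i hc i w *: dt i.
Proof.
apply: mproj_inj => k; rewrite mproj_sum.
have [v vE] := mpi_surj (mproj k w).
transitivity (\sum_i qpi (nJ k.+1) (omc i v) *: mpi (nJ k.+1) (du iA (t i))).
  rewrite {1}vE {1}(omcE v) (additive_map_sum (@mpiD _ _ _)).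
  by apply: eq_bigr => i _; rewrite mpiZ.
apply: eq_bigr => i _; rewrite -[RHS]/(omcl i (mproj k w) *: mproj k (dt i)).
by rewrite vE omcl_pi [mproj k (dt i)]dhat_nat.
Qed.

Section Contraction.
Variable M : mod_tower (Dtower D).
Local Notation Mh := (lim_mod M).
Local Notation T1 := (Mh ⊗[Dhat D] OmHat1 iA).

Definition ctr i : T1 -> Mh := tlift (fun (m : Mh) w => hc i w *: m).
Let c1 i (m m' : Mh) w : hc i w *: (m + m') = hc i w *: m + hc i w *: m'.
Proof. exact: scalerDr. Qed.
Let c2 i (m : Mh) w w' : hc i (w + w') *: m = hc i w *: m + hc i w' *: m.
Proof. by rewrite hcD scalerDl. Qed.
Let c3 i f (m : Mh) w : hc i w *: (idfun f *: m) = hc i (f *: w) *: m.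
Proof. by rewrite hcZ scalerA mulrC. Qed.
Lemma ctrD i : additive_map (ctr i). Proof. exact: (tliftD (@c1 i) (@c2 i) (@c3 i)). Qed.
Lemma ctr_mk i m w : ctr i (m ⊗ w) = hc i w *: m.
Proof. exact: (tlift_mk (@c1 i) (@c2 i) (@c3 i)). Qed.
Lemma ctrZ i f z : ctr i (f *: z) = f *: ctr i z.
Proof.
elim/tens_ind: z => [|u v Hu Hv|m w].
- by rewrite scaler0 (additive_map0 (@ctrD i)) scaler0.
- by rewrite scalerDr !ctrD Hu Hv scalerDr.
- by rewrite -tmkZl !ctr_mk scalerA mulrC -scalerA.
Qed.

Lemma tmk_sumr I (r : seq I) (m : Mh) (F : I -> OmHat1 iA) :
  m ⊗ (\sum_(i <- r) F i) = \sum_(i <- r) (m ⊗ F i) :> T1.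
Proof. by apply: (additive_map_sum (f := fun w => m ⊗ w : T1)) => x y; apply: tmkDr. Qed.

Lemma ctrE z : z = \sum_i (ctr i z ⊗ dt i).
Proof.
move: z; apply: (tens_ext (F := id)) => // [x y|m w].
  by rewrite -big_split; apply: eq_bigr => i _; rewrite ctrD tmkDl.
rewrite {1}(hcE w) tmk_sumr; apply: eq_bigr => i _.
by rewrite ctr_mk -tmk_bal.
Qed.

Definition ctrl k i : M k ⊗[Dlev D k] qmod (nJ k.+1) Om -> M k :=
  tlift (fun (m : M k) w => omcl i w *: m).
Section Level.
Variables (k : nat) (i : 'I_d).
Let c1l (m m' : M k) w : omcl i w *: (m + m') = omcl i w *: m + omcl i w *: m'.
Proof. exact: scalerDr. Qed.
Let c2l (m : M k) w w' : omcl i (w + w') *: m = omcl i w *: m + omcl i w' *: m.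
Proof. by rewrite omclD scalerDl. Qed.
Let c3l f (m : M k) w : omcl i w *: (idfun f *: m) = omcl i (f *: w) *: m.
Proof. by rewrite omclZ scalerA mulrC. Qed.
Let pS : semilinear (@rproj (Dtower D) k) (mproj k : Mh -> M k). Proof. exact: mprojS. Qed.
Let pS' : semilinear (@rproj (Dtower D) k) (mproj k : OmHat1 iA -> _). Proof. exact: mprojS. Qed.

Lemma ctrl_proj (z : T1) : ctrl i (tmap (mproj k) (mproj k) z) = mproj k (ctr i z).
Proof.
have lD := tliftD c1l c2l c3l.
move: z; apply: tens_ext => [x y|x y|m w].
- by rewrite (tmapD pS pS') [LHS]lD.
- by rewrite ctrD.
- by rewrite (tmap_mk pS pS') [LHS](tlift_mk c1l c2l c3l) ctr_mk.
Qed.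
End Level.
End Contraction.
End Coordinates.

(** * Integrability as commutation of the operators *)

Section FromConnection.
Variables (A : pdring) (R : comPzRingType) (iR : {rmorphism A -> R}) (C : chart iR).
Local Notation D := (ch_D C).
Local Notation iA := (th_alg D).
Local Notation t := (ch_t (c := C)).
Local Notation der := (ch_der (c := C)).
Local Notation d := (ch_d C).
Local Notation Om := (omega iA).
Local Notation nJ := (npd D).

Lemma dhat1_dt (i : 'I_d) : dhat1 (dt i) = 0.
Proof.
apply: mproj_inj => k; rewrite -[LHS]/(d1lev (mproj k.+1 (dt i))) [mproj _ _]dhat_nat d1lev_pi.
rewrite -[du iA _]scale1r du1_map_gen du1 -(scale0r (0 : Om)) wedgeZl scale0r.
exact: zpi0.
Qed.

Lemma hwedge_alt (v : OmHat1 iA) : hwedge v v = 0.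
Proof.
apply: mproj_inj => k; rewrite -[LHS]/(wedge_lev (mproj k v) (mproj k v)).
by have [a ->] := mpi_surj (mproj k v); rewrite wedge_lev_pi wedge_alt; apply: zpi0.
Qed.

Lemma hwedgeC (v w : OmHat1 iA) : hwedge v w = - hwedge w v.
Proof.
apply/eqP; rewrite -addr_eq0; apply/eqP.
by have := hwedge_alt (v + w); rewrite hwedgeDl !hwedgeDr !hwedge_alt add0r addr0.
Qed.

(* The coefficient of [dt_i /\ dt_k] of a form of degree two. *)
Section Coefficient.
Variables i k : 'I_d.
Definition om2 : ext2 Om -> D := plift (rel := ext2_rel (V := Om))
  (fun b p => b * (omc i p.1 * omc k p.2 - omc k p.1 * omc i p.2)).
Let hD (b c : D) (p : Om * Om) :
  (b + c) * (omc i p.1 * omc k p.2 - omc k p.1 * omc i p.2) =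
  b * (omc i p.1 * omc k p.2 - omc k p.1 * omc i p.2) +
  c * (omc i p.1 * omc k p.2 - omc k p.1 * omc i p.2).
Proof. exact: mulrDl. Qed.
Let hrel b s : ext2_rel (V := Om) s ->
  \sum_(q <- s) (b * q.1) * (omc i q.2.1 * omc k q.2.2 - omc k q.2.1 * omc i q.2.2) = 0.
Proof.
case=> [v v' w|v w w'|c v w|c v w|v]; rewrite !big_cons big_nil /= ?omcD ?omcZ; ring.
Qed.
Lemma om2D : additive_map om2. Proof. exact: pliftD hD hrel. Qed.
Lemma om2_gen b v w : om2 (b *: wedge v w) = b * (omc i v * omc k w - omc k v * omc i w).
Proof. exact: (plift_gen hD hrel). Qed.
Lemma om2Z b w : om2 (b *: w) = b * om2 w.
Proof.
elim/pres_ind: w => [|u v Hu Hv|c [x y]].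
- by rewrite scaler0 (additive_map0 om2D) mulr0.
- by rewrite scalerDr !om2D Hu Hv mulrDr.
- by rewrite scalerA -/(wedge x y) !om2_gen mulrA.
Qed.
Lemma om2_npd n v : span (smul_set (nJ n) (V := ext2 Om)) v -> ideal_gen (nJ n) (om2 v).
Proof.
elim=> [_ [b [w [nb ->]]]||u w _ Hu _ Hw|b w _ Hw].
- by rewrite om2Z mulrC; apply: ideal_genM; apply: span_gen.
- by rewrite (additive_map0 om2D); apply: span0.
- by rewrite om2D; apply: spanD.
- by rewrite om2Z; apply: ideal_genM.
Qed.
Definition om2l l : qmod (nJ l.+1) (ext2 Om) -> Dlev D l :=
  @zquot_map D D (ext2 Om) D^o (smul_set (nJ l.+1) (V := ext2 Om)) (nJ l.+1) om2.
Lemma om2l_pi l v : om2l (mpi (nJ l.+1) v) = qpi (nJ l.+1) (om2 v).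
Proof. exact: (@zquot_mapE D D (ext2 Om) D^o _ _ _ _ om2D (@om2_npd l.+1)). Qed.
Lemma hc2_sub (w : OmHat2 iA) l :
  rt_map (Dtower D) l (om2l (mproj l.+1 w)) = om2l (mproj l w).
Proof.
rewrite -(mproj_map l w); have [v ->] := mpi_surj (mproj l.+1 w).
by rewrite [mt_map _ _ _]Vtr_pi !om2l_pi [LHS]Dtr_pi.
Qed.
Definition hc2 (w : OmHat2 iA) : Dhat D := @mk_lim_ring (Dtower D) _ (hc2_sub w).
Lemma hc2D : additive_map hc2.
Proof.
move=> x y; apply: rproj_inj => l; rewrite -[LHS]/(om2l (mproj l x + mproj l y)).
rewrite -[RHS]/(om2l (mproj l x) + om2l (mproj l y)).
have [u ->] := mpi_surj (mproj l x); have [v ->] := mpi_surj (mproj l y).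
by rewrite -mpiD !om2l_pi om2D rmorphD.
Qed.
Lemma hc2Z f w : hc2 (f *: w) = f * hc2 w.
Proof.
apply: rproj_inj => l; rewrite -[LHS]/(om2l (rproj l f *: mproj l w)).
rewrite -[RHS]/(rproj l f * om2l (mproj l w)).
have [c ->] := qpi_surj (rproj l f); have [v ->] := mpi_surj (mproj l w).
by rewrite -mpiZ !om2l_pi om2Z rmorphM.
Qed.
Lemma hc2_hwedge v w : hc2 (hwedge v w) = hc i v * hc k w - hc k v * hc i w.
Proof.
apply: rproj_inj => l; rewrite -[LHS]/(om2l (wedge_lev (mproj l v) (mproj l w))).
rewrite -[RHS]/(omcl i (mproj l v) * omcl k (mproj l w) - omcl k (mproj l v) * omcl i (mproj l w)).
have [a ->] := mpi_surj (mproj l v); have [b ->] := mpi_surj (mproj l w).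
rewrite wedge_lev_pi om2l_pi !omcl_pi -!rmorphM -rmorphB; congr (qpi _ _).
by rewrite -[wedge a b]scale1r om2_gen mul1r.
Qed.
End Coefficient.

Section Nabla1.
Variables (M : mod_tower (Dtower D)) (nabla : lim_mod M -> lim_mod M ⊗[Dhat D] OmHat1 iA).
Local Notation Mh := (lim_mod M).
Hypothesis conn : is_connection (iD := iA) nabla.
Let th i m := ctr i (nabla m).

Let T2D : forall w w' : Mh ⊗[Dhat D] OmHat1 iA,
  nabla1 nabla (w + w') = nabla1 nabla w + nabla1 nabla w'.
Proof.
have [[nD _ nL] _] := conn.
have idS : semilinear (idfun : Dhat D -> Dhat D) (idfun : Mh -> Mh) by [].
have wS (w' : OmHat1 iA) : semilinear (idfun : Dhat D -> Dhat D)
    (fun v : OmHat1 iA => hwedge v w' : OmHat2 iA).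
  by split=> [u v|f v]; rewrite ?hwedgeDl ?hwedgeZl.
apply: tliftD => [m1 m2 w'|m' w1 w2|f m' w'].
- by rewrite tmkDl nD (tmapD idS (wS w')) addrACA.
- rewrite dhat1D tmkDr -!addrA; congr (_ + _).
  rewrite addrCA; congr (_ + _); move: (nabla m').
  apply: tens_ext => [||m3 v]; first exact: (tmapD idS (wS _)).
    by move=> u v; rewrite (tmapD idS (wS w1)) (tmapD idS (wS w2)) addrACA.
  by rewrite !(tmap_mk idS (wS _)) hwedgeDr tmkDr.
- rewrite nL (tmapD idS (wS w')) (tmap_mk idS (wS w')) (tmapS idS (wS w')).2.
  rewrite dhat1Z tmkDr -tmk_bal addrA -[RHS]addrA [_ + _ ⊗ _]addrC [RHS]addrA.
  have E : tmap (idfun : Mh -> Mh) (fun v => hwedge v (f *: w')) (nabla m') =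
    f *: tmap (idfun : Mh -> Mh) (fun v => hwedge v w') (nabla m').
    move: (nabla m'); apply: tens_ext => [||m3 v]; first exact: (tmapD idS (wS _)).
      by move=> u v; rewrite (tmapD idS (wS w')) scalerDr.
    by rewrite !(tmap_mk idS (wS _)) hwedgeZr -tmk_bal tmkZl.
  by rewrite E.
Qed.

(** The forms [dt j] are closed, so only the second derivatives of [m] remain. *)
Lemma nabla1_nabla m :
  nabla1 nabla (nabla m) = \sum_j \sum_l (th l (th j m) ⊗ hwedge (dt l) (dt j)).
Proof.
rewrite {1}(ctrE (nabla m)) (additive_map_sum T2D); apply: eq_bigr => j _.
have idS : semilinear (idfun : Dhat D -> Dhat D) (idfun : Mh -> Mh) by [].
have wS (w' : OmHat1 iA) : semilinear (idfun : Dhat D -> Dhat D)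
    (fun v : OmHat1 iA => hwedge v w' : OmHat2 iA).
  by split=> [u v|f v]; rewrite ?hwedgeDl ?hwedgeZl.
rewrite nabla1_mk // dhat1_dt -(scale0r (0 : OmHat2 iA)) -tmk_bal scale0r.
rewrite (_ : 0 ⊗ 0 = 0); last by rewrite -(scale0r (0 : Mh)) tmkZl scale0r.
rewrite add0r -/(th j m) {1}(ctrE (nabla (th j m))) (additive_map_sum (tmapD idS (wS _))).
by apply: eq_bigr => l _; rewrite (tmap_mk idS (wS _)).
Qed.

Let ctr2 i k := tlift (phi := idfun) (fun (m : Mh) (w : OmHat2 iA) => hc2 i k w *: m).

(** The coefficient of $dt_i \wedge dt_k$ in [nabla1_nabla] is the commutator of the two
    operators. *)
Lemma integrable_comm : conn_integrable nabla -> forall i k m, th i (th k m) = th k (th i m).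
Proof.
move=> integ i k m.
have c1 (m1 m2 : Mh) w : hc2 i k w *: (m1 + m2) = hc2 i k w *: m1 + hc2 i k w *: m2.
  exact: scalerDr.
have c2 (m1 : Mh) w w' : hc2 i k (w + w') *: m1 = hc2 i k w *: m1 + hc2 i k w' *: m1.
  by rewrite hc2D scalerDl.
have c3 f (m1 : Mh) w : hc2 i k w *: (idfun f *: m1) = hc2 i k (f *: w) *: m1.
  by rewrite hc2Z scalerA mulrC.
have cD : additive_map (ctr2 i k) := tliftD c1 c2 c3.
have := congr1 (ctr2 i k) (integ m); rewrite (additive_map0 cD) nabla1_nabla.
rewrite (additive_map_sum cD); under eq_bigr do rewrite (additive_map_sum cD).
have E j l : ctr2 i k (th l (th j m) ⊗ hwedge (dt l) (dt j)) =
    ((l == i)%:R * (j == k)%:R - (l == k)%:R * (j == i)%:R) *: th l (th j m).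
  by rewrite [LHS](tlift_mk c1 c2 c3) hc2_hwedge !hc_dt.
under eq_bigr do under eq_bigr do rewrite E scalerBl.
under eq_bigr do rewrite sumrB; rewrite sumrB.
have F a b : \sum_j \sum_l ((l == a)%:R * (j == b)%:R : Dhat D) *: th l (th j m) = th a (th b m).
  rewrite (bigD1 b) //= (bigD1 a) //= !eqxx mulr1 scale1r big1 ?addr0 => [|l /negbTE ->].
    rewrite big1 ?addr0 // => j /negbTE ->; apply: big1 => l _; by rewrite mulr0 scale0r.
  by rewrite mul0r scale0r.
by rewrite !F => /subr0_eq.
Qed.

Lemma comm_integrable : (forall i k m, th i (th k m) = th k (th i m)) -> conn_integrable nabla.
Proof.
move=> comm m; rewrite nabla1_nabla; apply: alternating_sum => [j|j l].
  by rewrite hwedge_alt -(scale0r (0 : OmHat2 iA)) -tmk_bal scale0r -(scale0r (0 : Mh)) tmkZl scale0r.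
rewrite comm hwedgeC; apply: (additive_mapN (f := fun w => _ ⊗ w)) => x y; exact: tmkDr.
Qed.
End Nabla1.

Local Notation conn_module := (conn_module iA t).

Definition cth (M : conn_module) i (m : lim_mod M) : lim_mod M := ctr i (cn_nabla m).

Lemma cn_nablaE (M : conn_module) (m : lim_mod M) : cn_nabla m = \sum_i (cth i m ⊗ dt i).
Proof. exact: ctrE. Qed.

Lemma cth_thmod (M : conn_module) : is_thmod (@cth M).
Proof.
have [[nD _ nL] cont] := cn_connection M; split.
- exact: cn_base_change.
- by move=> i x y; rewrite /cth nD ctrD.
- move=> i a m; rewrite /cth nL ctrD ctr_mk hc_dhat ctrZ //.
- move=> i k; have [l Hl] := cont 0 k; exists l => m m0.
  have := Hl m; rewrite m0 => /(_ erefl) => E.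
  rewrite /cth -ctrl_proj E ctrl_proj (additive_map0 nD) (additive_map0 (@ctrD _ _ _ _ _ i)) //.
- move=> i k m; apply: (integrable_comm (cn_connection M) (@cn_integrable _ _ _ _ _ M)).
move=> i m k; have [th' [th'E nil]] := cn_nilpotent M.
(* The operators witnessing quasi-nilpotence are the coordinates of the connection, because the
   [dt j] form a basis. *)
have E : th' i = cth i.
  apply: funext => x; rewrite /cth th'E (additive_map_sum (@ctrD _ _ _ _ _ i)) (bigD1 i) //=.
  rewrite ctr_mk -/(dt i) hc_dt eqxx scale1r big1 ?addr0 // => j ji.
  by rewrite ctr_mk -/(dt j) hc_dt (negbTE ji) scale0r.
by have [L HL] := nil m k i; exists L => l /HL; rewrite E.
Qed.
End FromConnection.

(** * From commuting operators to connections *)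

Section ToConnection.
Variables (A : pdring) (R : comPzRingType) (iR : {rmorphism A -> R}) (C : chart iR).
Local Notation D := (ch_D C).
Local Notation iA := (th_alg D).
Local Notation t := (ch_t (c := C)).
Local Notation der := (ch_der (c := C)).
Local Notation d := (ch_d C).
Local Notation Om := (omega iA).
Local Notation nJ := (npd D).
Local Notation pi k := (qpi (nJ k.+1)).

Lemma du_pi k x : du (iDlev iA k) (pi k x) = \sum_i pi k (der i x) *: du (iDlev iA k) (pi k (t i)).
Proof.
pose f := omega_map iA (iDlev iA k) (pi k : {rmorphism D -> Dlev D k}).
have fS : semilinear (pi k : D -> Dlev D k) f.
  by apply: omega_mapS => //; apply: qpi_pd_morph.
have fdu y : f (du iA y) = du (iDlev iA k) (pi k y).
  by apply: omega_map_du => //; apply: qpi_pd_morph.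
rewrite -fdu ch_omega (additive_map_sum fS.1); apply: eq_bigr => i _.
by rewrite fS.2 fdu.
Qed.

Lemma OmHat_lev_dt k i : OmHat_lev k (dt i) = du (iDlev iA k) (pi k (t i)).
Proof.
rewrite (@OmHat_levE _ _ iA k (du iA (t i)) (dt i)) ?dhat_nat //.
by apply: omega_map_du => //; apply: qpi_pd_morph.
Qed.

Lemma OmLev_tr_du k y : OmLev_tr (iD := iA) (du (iDlev iA k.+1) y) = du (iDlev iA k) (Dtr y).
Proof. by apply: omega_map_du; [move=> a; apply: Dtr_pi | apply: Dtr_pd_morph]. Qed.

Section Module.
Variables (M : mod_tower (Dtower D)) (th : 'I_d -> lim_mod M -> lim_mod M).
Hypothesis thm : is_thmod th.
Local Notation Mh := (lim_mod M).
Local Notation T1 := (Mh ⊗[Dhat D] OmHat1 iA).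
Let bc := tm_bc thm.
Let thD := tm_thD thm.

Definition nab (m : Mh) : T1 := \sum_i (th i m ⊗ dt i).

(** By continuity [f] may be replaced by an element [a] of [D] agreeing with it at level [K']. This
    level is at least the continuity bound, and at least [k.+1], which determines [dhat] at level
    [k]. *)
Lemma th_hat i (f : Dhat D) m : th i (f *: m) = hc i (dhat iA f) *: m + f *: th i m.
Proof.
apply: mproj_inj => k; have [K HK] := tm_cont thm i k.
pose K' := maxn K k.+1; have [a aE] := qpi_surj (rproj K' f).
have low n : (n <= K')%N -> rproj n f = pi n a.
  move=> /subnKC E; move: aE; rewrite -E; elim: (K' - n)%N => [|r IH]; first by rewrite addn0.
  by rewrite addnS => aE; apply: IH; rewrite -(rproj_map (n + r) f) aE [LHS]Dtr_pi.
have kK' : (k.+1 <= K')%N := leq_maxr _ _.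
have E : mproj k (th i ((f - to_Dhat a) *: m)) = 0.
  apply: HK; apply: (@mproj_le _ _ K K'); first exact: leq_maxl.
  rewrite -[LHS]/((rproj K' f - rproj K' (to_Dhat a)) *: mproj K' m).
  by rewrite aE subrr scale0r.
have fE : f *: m = to_Dhat a *: m + (f - to_Dhat a) *: m by rewrite -scalerDl addrC subrK.
rewrite fE thD (tm_thM thm) -[LHS]/(mproj k _ + mproj k _ + mproj k _) E addr0.
rewrite -[RHS]/(rproj k (hc i (dhat iA f)) *: mproj k m + rproj k f *: mproj k (th i m)).
by rewrite (rproj_hc i (low _ kK')) (low k (ltnW kK')).
Qed.

Lemma nabD : additive_map nab.
Proof.
by move=> x y; rewrite /nab -big_split; apply: eq_bigr => i _; rewrite thD tmkDl.
Qed.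

Lemma nabM (f : Dhat D) m : nab (f *: m) = m ⊗ dhat iA f + f *: nab m.
Proof.
rewrite [X in m ⊗ X](hcE (dhat iA f)) tmk_sumr scaler_sumr -big_split.
apply: eq_bigr => i _; rewrite th_hat tmkDl tmkZl /=; congr (_ + _); last by rewrite tmkZl.
by rewrite -tmk_bal tmkZl.
Qed.

Lemma ctr_nab i m : ctr i (nab m) = th i m.
Proof.
rewrite /nab (additive_map_sum (@ctrD _ _ _ _ _ i)) (bigD1 i) //= ctr_mk hc_dt eqxx scale1r.
by rewrite big1 ?addr0 // => k ki; rewrite ctr_mk hc_dt (negbTE ki) scale0r.
Qed.

Lemma cont_all k : exists K, forall i m, mproj K m = 0 -> mproj k (th i m) = 0.
Proof.
have H (i : nat) : exists K0, forall K, (K0 <= K)%N -> forall lt_i : (i < d)%N,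
    forall m, mproj K m = 0 -> mproj k (th (Ordinal lt_i) m) = 0.
  case: (pselect (is_true (i < d)%N)) => [lt_i|n_i]; last first.
    by exists 0%N => K _ lt_i; have := n_i lt_i.
  have [K0 H0] := tm_cont thm (Ordinal lt_i) k; exists K0 => K leK lt_i' m m0.
  by rewrite (bool_irrelevance lt_i' lt_i); apply: H0; apply: mproj_le m0.
have [K HK] := eventually_forall H d; exists K => i m m0.
have := HK K (leqnn _) i (ltn_ord i) (ltn_ord i) m m0.
by congr (mproj k (th _ m) = 0); apply: val_inj.
Qed.

Lemma nab_connection : is_connection (iD := iA) nab.
Proof.
split; first split.
- exact: nabD.
- move=> a m; rewrite -[(to_Dhat (D := D) \o iA) a]/(to_Dhat (iA a)) nabM.
  rewrite (_ : dhat iA (to_Dhat (iA a)) = 0).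
    by rewrite -(scale0r (0 : OmHat1 iA)) -tmk_bal tmkZl scale0r add0r.
  rewrite (hcE (dhat iA _)) big1 // => i _.
  by rewrite hc_dhat ch_derA rmorph0 scale0r.
- exact: nabM.
move=> m k; have [K HK] := cont_all k; exists K => m' mm'.
have pS : semilinear (@rproj (Dtower D) k) (mproj k : Mh -> M k) by exact: mprojS.
have pS' : semilinear (@rproj (Dtower D) k) (mproj k : OmHat1 iA -> _) by exact: mprojS.
rewrite /nab !(additive_map_sum (tmapD pS pS')); apply: eq_bigr => i _.
rewrite !(tmap_mk pS pS'); congr (_ ⊗ _); apply/subr0_eq.
rewrite -[LHS]/(mproj k (th i m' - th i m)) -(additive_mapB (thD i)); apply: HK.
by rewrite -[LHS]/(mproj K m' - mproj K m) mm' subrr.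
Qed.

Section Level.
Variable k : nat.
Local Notation T1k := (M k ⊗[Dlev D k] OmLev iA k).
Definition nabl_hat (m : Mh) : T1k := \sum_i (mproj k (th i m) ⊗ du (iDlev iA k) (pi k (t i))).

Lemma nabl_hatD : additive_map nabl_hat.
Proof.
move=> x y; rewrite /nabl_hat -big_split; apply: eq_bigr => i _.
by rewrite thD -[mproj k _]/(mproj k _ + mproj k _) tmkDl.
Qed.

Lemma nabl_hatM a m : nabl_hat (to_Dhat a *: m) =
  mproj k m ⊗ du (iDlev iA k) (pi k a) + pi k a *: nabl_hat m.
Proof.
rewrite du_pi (additive_map_sum (f := fun w => mproj k m ⊗ w : T1k)); last first.
  by move=> x y; apply: tmkDr.
rewrite scaler_sumr -big_split; apply: eq_bigr => i _.
rewrite (tm_thM thm) -[mproj k _]/(pi k (der i a) *: mproj k m + pi k a *: mproj k (th i m)).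
by rewrite tmkDl !tmkZl -tmk_bal tmkZl.
Qed.

(** Up to a deep kernel, such [m] are sums of products [x m'] with [x] in $(k+1)! J^{[k+1]}$.
    Leibniz' rule leaves [m'] tensored with [dx], and [dx] vanishes in the differentials of the
    level [k] quotient. This makes the connection cartesian although the individual operators [th i]
    are only continuous. *)
Lemma nabl_hat_ker m : mproj k m = 0 -> nabl_hat m = 0.
Proof.
have [K HK] := cont_all k.
have kK : (k <= maxn k K)%N := leq_maxl _ _.
move: m; apply: (ker_ind bc kK) => [u v Hu Hv|x m nx|m m0].
- by rewrite nabl_hatD Hu Hv addr0.
- have x0 : pi k x = 0 by apply/qpi0P/span_gen.
  rewrite nabl_hatM x0 scale0r addr0 (additive_map0 (duD _)).
  by rewrite -(scale0r (0 : OmLev iA k)) -tmk_bal tmkZl scale0r.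
- rewrite /nabl_hat big1 // => i _; rewrite HK; last by apply: mproj_le m0; apply: leq_maxr.
  by rewrite -(scale0r (0 : M k)) tmkZl scale0r.
Qed.

Definition nabl (x : M k) : T1k := nabl_hat (lim_lift bc x).
Lemma nablE m : nabl (mproj k m) = nabl_hat m.
Proof.
apply/subr0_eq; rewrite -(additive_mapB nabl_hatD); apply: nabl_hat_ker.
by rewrite -[LHS]/(mproj k _ - mproj k m) lim_liftK subrr.
Qed.
End Level.

Lemma nabl_limit : is_limit_connection (iD := iA) nab nabl.
Proof.
split=> [k|k x|k m].
- split=> [x y|a x|f x].
  + rewrite -(lim_liftK bc x) -(lim_liftK bc y) -[_ + _]/(mproj k (_ + _)).
    by rewrite !nablE nabl_hatD.
  + rewrite -(lim_liftK bc x) -[_ *: _]/(mproj k (to_Dhat (iA a) *: _)) !nablE nabl_hatM.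
    by rewrite [du _ _](duA (iDlev iA k) a) -(scale0r (0 : OmLev iA k)) -tmk_bal tmkZl scale0r add0r.
  + have [a ->] := qpi_surj f.
    rewrite -(lim_liftK bc x) -[_ *: _]/(mproj k (to_Dhat a *: _)) !nablE nabl_hatM //.
- rewrite -(lim_liftK bc x) mproj_map !nablE.
  have mS := mt_mapS M k; have oS := OmLev_trS iA k.
  rewrite /nabl_hat (additive_map_sum (tmapD mS oS)); apply: eq_bigr => i _.
  by rewrite (tmap_mk mS oS) mproj_map OmLev_tr_du Dtr_pi.
rewrite nablE /nab /nabl_hat.
have pS : semilinear (@rproj (Dtower D) k) (mproj k : Mh -> M k) by exact: mprojS.
have oS := OmHat_levS iA k.
rewrite (additive_map_sum (tmapD pS oS)); apply: eq_bigr => i _.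
by rewrite (tmap_mk pS oS) OmHat_lev_dt.
Qed.

Definition mk_conn : conn_module iA t.
Proof.
refine (@ConnModule _ D iA d t M bc nab nab_connection _ _ _).
- by exists nabl; apply: nabl_limit.
- apply: (comm_integrable nab_connection) => i k m; rewrite !ctr_nab; exact: (tm_comm thm).
- by exists th; split=> // m k j; apply: (tm_nilp thm).
Defined.

Lemma cth_mk_conn i m : cth (M := mk_conn) i m = th i m.
Proof. exact: ctr_nab. Qed.
End Module.

Definition is_thhom (M M' : mod_tower (Dtower D)) (th : 'I_d -> lim_mod M -> lim_mod M)
    (th' : 'I_d -> lim_mod M' -> lim_mod M') (f : lim_mod M -> lim_mod M') :=
  [/\ additive_map f, forall a m, f (to_Dhat a *: m) = to_Dhat a *: f m,
      forall k m, mproj k m = 0 -> mproj k (f m) = 0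
    & forall i m, f (th i m) = th' i (f m)].

Section LevelCoordinates.
Variables (k : nat) (i : 'I_d).

Definition derl : Dlev D k.+1 -> Dlev D k :=
  @zquot_map D D D^o D^o (nJ k.+2) (nJ k.+1) (der i).
Lemma derl_pi x : derl (pi k.+1 x) = pi k (der i x).
Proof.
have dS y : ideal_gen (nJ k.+2) y -> ideal_gen (nJ k.+1) (der i y).
  by move/npdP=> ny; apply: span_gen; apply: der_npd.
exact: (@zquot_mapE D D D^o D^o _ _ _ _ (@ch_derD _ _ _ C i) dS).
Qed.

(** [derl] lowers the level by one, so the coefficient of [dt_i] in a form on level [k.+1] is taken
    in [Dlev D k]. *)
Definition oml : OmLev iA k.+1 -> Dlev D k :=
  plift (rel := omega_rel (iDlev iA k.+1)) (fun b x => Dtr b * derl x).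
Let hD (b c x : Dlev D k.+1) : Dtr (b + c) * derl x = Dtr b * derl x + Dtr c * derl x.
Proof. by rewrite rmorphD mulrDl. Qed.
Let hrel b s : omega_rel (iDlev iA k.+1) s -> \sum_(p <- s) Dtr (b * p.1) * derl p.2 = 0.
Proof.
move=> rs; suff E : \sum_(p <- s) Dtr p.1 * derl p.2 = 0.
  rewrite -[RHS](mulr0 (Dtr b)) -[in RHS]E mulr_sumr; apply: eq_bigr => p _.
  by rewrite rmorphM mulrA.
case: rs => [x y|x y|a|n _ [x Jx ->]]; rewrite !big_cons big_nil /= addr0 ?rmorphN ?rmorph1 ?mul1r.
- have [a ->] := qpi_surj x; have [c ->] := qpi_surj y.
  by rewrite -rmorphD !derl_pi ch_derD rmorphD !mulN1r -opprD subrr.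
- have [a ->] := qpi_surj x; have [c ->] := qpi_surj y.
  rewrite -rmorphM !derl_pi /= !Dtr_pi ch_derM rmorphD !rmorphM !mulNr -opprD.
  by rewrite subrr.
- by rewrite [derl _]derl_pi ch_derA rmorph0.
- by rewrite /= !qpd_powE // !derl_pi Dtr_pi ch_der_pd // rmorphM mulNr subrr.
Qed.
Lemma omlD : additive_map oml. Proof. exact: pliftD hD hrel. Qed.
Lemma oml_gen b x : oml (b *: du (iDlev iA k.+1) x) = Dtr b * derl x.
Proof. exact: (plift_gen hD hrel). Qed.
Lemma omlZ b w : oml (b *: w) = Dtr b * oml w.
Proof.
elim/pres_ind: w => [|u v Hu Hv|c x].
- by rewrite scaler0 (additive_map0 omlD) mulr0.
- by rewrite scalerDr !omlD Hu Hv mulrDr.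
- by rewrite scalerA !oml_gen rmorphM mulrA.
Qed.

Variable M : mod_tower (Dtower D).
Definition ctrm : M k.+1 ⊗[Dlev D k.+1] OmLev iA k.+1 -> M k :=
  tlift (fun (m : M k.+1) w => oml w *: mt_map M k m).
Let c1 (m m' : M k.+1) w :
  oml w *: mt_map M k (m + m') = oml w *: mt_map M k m + oml w *: mt_map M k m'.
Proof. by rewrite (mt_mapS M k).1 scalerDr. Qed.
Let c2 (m : M k.+1) w w' :
  oml (w + w') *: mt_map M k m = oml w *: mt_map M k m + oml w' *: mt_map M k m.
Proof. by rewrite omlD scalerDl. Qed.
Let c3 f (m : M k.+1) w : oml w *: mt_map M k (idfun f *: m) = oml (f *: w) *: mt_map M k m.
Proof. by rewrite omlZ (mt_mapS M k).2 scalerA mulrC. Qed.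
Lemma ctrmD : additive_map ctrm. Proof. exact: (tliftD c1 c2 c3). Qed.
Lemma ctrm_mk m w : ctrm (m ⊗ w) = oml w *: mt_map M k m. Proof. exact: (tlift_mk c1 c2 c3). Qed.
End LevelCoordinates.

Section Homs.
Variables M M' : conn_module iA t.

(** The level connections come from an arbitrary choice, but the projections from the limit are
    surjective, so the limit connection determines them. *)
Lemma cn_nabla_levE (N : conn_module iA t) k (m : lim_mod N) : cn_nabla_lev (mproj k m) =
  \sum_i (mproj k (cth i m) ⊗ du (iDlev iA k) (pi k (t i))).
Proof.
rewrite /cn_nabla_lev; case: cid => nabk /= [_ _ ->].
have pS : semilinear (@rproj (Dtower D) k) (mproj k : lim_mod N -> N k) by exact: mprojS.
have oS := OmHat_levS iA k.
rewrite {1}(cn_nablaE m) (additive_map_sum (tmapD pS oS)); apply: eq_bigr => i _.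
by rewrite (tmap_mk pS oS) OmHat_lev_dt.
Qed.

(** Compatibility with the connection at level [k.+1], contracted by [ctrm], gives commutation with
    the operators at level [k]; all levels together give it on the limit. *)
Lemma conn_hom_thhom (f : lim_mod M -> lim_mod M') : is_conn_hom f ->
  is_thhom (@cth _ _ _ C M) (@cth _ _ _ C M') f.
Proof.
move=> [[fD fZ] [fn [fnS fnT fnP fnN]]]; split=> // [k m m0|i m].
- by rewrite fnP m0 (additive_map0 (fnS k).1).
apply: mproj_inj => k; apply/esym.
have E := fnN k.+1 (mproj k.+1 m).
have idS : semilinear (idfun : Dlev D k.+1 -> Dlev D k.+1) (idfun : OmLev iA k.+1 -> _) by [].
move: E; rewrite -fnP !cn_nabla_levE (additive_map_sum (tmapD (fnS k.+1) idS)).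
under [in RHS]eq_bigr do rewrite (tmap_mk (fnS k.+1) idS) -fnP.
move/(congr1 (@ctrm k i M')); rewrite !(additive_map_sum (@ctrmD k i M')).
have F (x : 'I_d -> lim_mod M') :
    \sum_l ctrm i (mproj k.+1 (x l) ⊗ du (iDlev iA k.+1) (pi k.+1 (t l))) = mproj k (x i).
  rewrite (bigD1 i) //= ctrm_mk -[du _ _]scale1r oml_gen derl_pi ch_der_t eqxx !rmorph1 mulr1.
  rewrite scale1r mproj_map big1 ?addr0 // => l li.
  rewrite ctrm_mk -[du _ _]scale1r oml_gen derl_pi ch_der_t (negbTE li) rmorph0 mulr0 scale0r //.
by rewrite (F (fun l => cth l (f m))) (F (fun l => f (cth l m))).
Qed.

Lemma thhom_conn_hom (f : lim_mod M -> lim_mod M') :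
  is_thhom (@cth _ _ _ C M) (@cth _ _ _ C M') f -> is_conn_hom f.
Proof.
move=> [fD fZ fk fth]; have bc := cn_base_change M.
pose fn k (x : M k) := mproj k (f (lim_lift bc x)).
have fnE k m : fn k (mproj k m) = mproj k (f m).
  apply/subr0_eq; rewrite -[LHS]/(mproj k (f _ - f m)) -(additive_mapB fD); apply: fk.
  by rewrite -[LHS]/(mproj k _ - mproj k m) lim_liftK subrr.
have fnS k : semilinear idfun (@fn k).
  split=> [x y|b x].
    rewrite -(lim_liftK bc x) -(lim_liftK bc y) -[_ + _]/(mproj k (_ + _)).
    by rewrite !fnE fD.
  have [a ->] := qpi_surj b; rewrite -(lim_liftK bc x).
  by rewrite -[_ *: _]/(mproj k (to_Dhat a *: _)) !fnE fZ.
split.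
  split=> // g x; apply: mproj_inj => k; have [a aE] := qpi_surj (rproj k g).
  rewrite -fnE -[mproj k _]/(rproj k g *: mproj k x) (fnS k).2 fnE //.
exists fn; split=> // [k x|k x].
  by rewrite -(lim_liftK bc x) mproj_map !fnE mproj_map.
rewrite -(lim_liftK bc x) fnE !cn_nabla_levE.
have idS : semilinear (idfun : Dlev D k -> Dlev D k) (idfun : OmLev iA k -> _) by [].
rewrite (additive_map_sum (tmapD (fnS k) idS)); apply: eq_bigr => i _.
by rewrite (tmap_mk (fnS k) idS) fnE fth.
Qed.
End Homs.
End ToConnection.

(** * The crystal of a module with connection *)

Lemma esum_closed (N : zmodType) (Q : N -> Prop) F : Q 0 -> (forall x y, Q x -> Q y -> Q (x + y)) ->
  (forall l, Q (F l)) -> Q (esum F).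
Proof.
move=> Q0 QD QF; case: (pselect (ev0 F)) => [[L FL]|nF].
  by rewrite (esumE FL); apply: big_ind.
by rewrite /esum; case: pselect => // H; case: nF.
Qed.

Lemma tens_base_change (B B' : comPzRingType) (phi : {rmorphism B -> B'}) (M : lmodType B) :
  is_base_change phi (fun m : M => tmk phi (1 : B'^o) m : tens phi B'^o M).
Proof.
exists idfun; split=> [c m|].
  by transitivity (tmk phi (c *: (1 : B'^o)) m); [congr (tmk _ _ _); exact/esym/mulr1 | exact: tmkZl].
by exists id.
Qed.

Section TowerCrystal.
Variables (A : pdring) (R : comPzRingType) (iR : {rmorphism A -> R}) (C : chart iR).
Local Notation D := (ch_D C).
Local Notation point B := (thom D (thick_of B)).
Local Notation t := (ch_t (c := C)).
Local Notation d := (ch_d C).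

Lemma pt_ex (B : cris_ob iR) : exists u : point B, True.
Proof.
pose b i := projT1 (cid (@co_surj _ _ _ B (th_proj D (t i)))).
have [i|u _] := @ch_point _ _ _ C B b; last by exists u.
by rewrite /b; case: cid.
Qed.
Definition pt (B : cris_ob iR) : point B := projT1 (cid (pt_ex B)).

Section Module.
Variables (M : mod_tower (Dtower D)) (th : 'I_d -> lim_mod M -> lim_mod M).
Hypothesis thm : is_thmod th.
Local Notation Mh := (lim_mod M).

Lemma opA_span (B : cris_ob iR) (N : lmodType B) (Q : N -> Prop) x (g : Mh -> N) :
  Q 0 -> (forall y z, Q y -> Q z -> Q (y + z)) -> (forall b m, Q (b *: g m)) ->
  forall b m, Q (b *: opA th x g m).
Proof.
move=> Q0 QD Qg; rewrite /opA; elim: (enum _) => [//|i s IH] b m.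
move: b; apply: (esum_closed (Q := fun y => forall b, Q (b *: y))) => [b|y z Qy Qz b|l b].
- by rewrite scaler0.
- by rewrite scalerDr; apply: QD.
- rewrite scalerA; exact: IH.
Qed.

Lemma opA_gap_trans (B : cris_ob iR) (u v w : point B) (N : lmodType B) (g : Mh -> N) : adm0 g ->
  opA th (gap u v) (opA th (gap v w) g) = opA th (gap u w) g.
Proof.
move=> gadm; rewrite [LHS](opS_add thm) //; try exact: gap_ideal.
by congr (opS th _ _ g); apply: funext => i; rewrite /gap addrA subrK.
Qed.

Lemma opA_gap_refl (B : cris_ob iR) (u v : point B) (N : lmodType B) (g : Mh -> N) : u =1 v ->
  opA th (gap u v) g = g.
Proof.
move=> uv; rewrite -[RHS](opS0 th (enum 'I_d)); congr (opS th _ _ g).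
by apply: funext => i; rewrite /gap uv subrr.
Qed.

(** The tower is taken at level [depth B], through which the chosen point [pt B] factors. *)
Definition tc_ob (B : cris_ob iR) : lmodType B :=
  tens (ch_map (factor (pt B) (leqnn _)) : {rmorphism Dlev D (depth B) -> B}) B^o (M (depth B)).
Definition tc_e (B : cris_ob iR) (m : Mh) : tc_ob B := tmk _ (1 : B^o) (mproj (depth B) m).

Lemma tc_univ (B : cris_ob iR) : is_univ (pt B) (@tc_e B).
Proof.
by apply: (base_change_univ (tm_bc thm) (factorE (pt B) (leqnn _))); apply: tens_base_change.
Qed.
Let eadm (B : cris_ob iR) : adm0 (@tc_e B) := un_adm0 (tc_univ B).

Definition tc_ev (B : cris_ob iR) (w : point B) : Mh -> tc_ob B := opA th (gap w (pt B)) (@tc_e B).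

Lemma tc_ev_adm0 (B : cris_ob iR) (w : point B) : adm0 (tc_ev w).
Proof. by apply: (opS_adm0 thm) => // i; apply: gap_ideal. Qed.
Lemma tc_ev_slin (B : cris_ob iR) (w : point B) : slin w (tc_ev w).
Proof. by apply: (opA_slin thm) => //; apply: (un_slin (tc_univ B)). Qed.
Lemma tc_ev_ext (B : cris_ob iR) (w w' : point B) : w =1 w' -> tc_ev w = tc_ev w'.
Proof. by move=> ww; congr (opA th _ _); apply: funext => i; rewrite /gap ww. Qed.

Lemma tc_ev_pt (B : cris_ob iR) : tc_ev (pt B) = @tc_e B.
Proof. exact: opA_gap_refl. Qed.

Lemma tc_ev_trans (B : cris_ob iR) (u v : point B) : opA th (gap u v) (tc_ev v) = tc_ev u.
Proof. exact: opA_gap_trans. Qed.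

Section Map.
Variables (B B' : cris_ob iR) (chi : cris_hom B B').

Lemma tc_map_ex : exists2 h : tc_ob B -> tc_ob B', semilinear (ch_map chi) h &
  forall m, h (tc_e B m) = tc_ev (thom_comp (thom_of chi) (pt B)) m.
Proof.
apply: (un_ex (tc_univ B)); first exact: tc_ev_adm0.
exact: tc_ev_slin.
Qed.
Definition tc_map := s2val (cid2 tc_map_ex).
Lemma tc_mapS : semilinear (ch_map chi) tc_map. Proof. exact: (s2valP (cid2 tc_map_ex)). Qed.
Lemma tc_map_e m : tc_map (tc_e B m) = tc_ev (thom_comp (thom_of chi) (pt B)) m.
Proof. exact: (s2valP' (cid2 tc_map_ex)). Qed.

(** Naturality moves [chi] past the Taylor operator. Then the increment from [pt B] to [w], pushed
    to [B'], and the increment from [pt B'] to the image of [pt B] add up. *)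
Lemma tc_map_ev (w : point B) m : tc_map (tc_ev w m) = tc_ev (thom_comp (thom_of chi) w) m.
Proof.
rewrite -[LHS]/((tc_map \o opA th (gap w (pt B)) (@tc_e B)) m).
rewrite (opA_nat thm tc_mapS (eadm B)); last exact: gap_ideal.
have -> : tc_map \o @tc_e B = tc_ev (thom_comp (thom_of chi) (pt B)).
  by apply: funext => x; apply: tc_map_e.
rewrite -(tc_ev_trans (thom_comp (thom_of chi) w) (thom_comp (thom_of chi) (pt B))).
by congr (opA th _ _ m); apply: funext => i; rewrite /gap /= rmorphB.
Qed.
End Map.

Lemma tc_map_id (B : cris_ob iR) x : tc_map (cris_id B) x = x.
Proof.
apply: (un_uniq (tc_univ B) (tc_mapS (cris_id B))) => // m.
by rewrite tc_map_e -[in RHS]tc_ev_pt (@tc_ev_ext _ _ (pt B)).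
Qed.

Lemma tc_map_comp (X Y Z : cris_ob iR) (f : cris_hom Y Z) (g : cris_hom X Y) x :
  tc_map (cris_comp f g) x = tc_map f (tc_map g x).
Proof.
apply: (un_uniq (tc_univ X) (h' := tc_map f \o tc_map g) (tc_mapS (cris_comp f g))) => [|m].
  split=> [y z|b y]; first by rewrite /= (tc_mapS g).1 (tc_mapS f).1.
  by rewrite /= (tc_mapS g).2 (tc_mapS f).2.
by rewrite /= !tc_map_e tc_map_ev; congr (_ m); apply: tc_ev_ext.
Qed.

Definition tc_module : cris_module iR := CrisModule tc_mapS tc_map_id tc_map_comp.

(** The image [cp] of the chosen point of [B] need not be the chosen point of [B']. Transport
    between the two is invertible, so the universal property at [pt B'] serves for [cp] as well. *)
Lemma tc_base_change (B B' : cris_ob iR) (chi : cris_hom B B') :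
  is_base_change (ch_map chi) (tc_map chi).
Proof.
pose cp := thom_comp (thom_of chi) (pt B).
have e'E : opA th (gap (pt B') cp) (tc_ev cp) = @tc_e B' by rewrite tc_ev_trans tc_ev_pt.
apply: is_base_change_intro; first exact: tc_mapS.
  move=> Q Q0 QD Qf; apply: (un_ind (tc_univ B')) => // b m; rewrite -e'E.
  apply: opA_span => // {}b {}m; rewrite -tc_map_e; exact: Qf.
pose e1 m := tmk (ch_map chi) (1 : B'^o) (tc_e B m).
have e1adm : adm0 e1.
  have [eD [k ek]] := eadm B; split=> [x y|]; first by rewrite /e1 eD tmkDr.
  by exists k => m /ek m0; rewrite /e1 m0 -(scale0r (0 : tc_ob B)) -tmk_bal rmorph0 tmkZl scale0r.
have e1S : slin cp e1.
  by move=> a m; rewrite /e1 (un_slin (tc_univ B)) -tmk_bal tmkZl.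
have [||h hS hE] := un_ex (tc_univ B') (chi := idfun) (g := opA th (gap (pt B') cp) e1).
- by apply: (opS_adm0 thm) => // i; apply: gap_ideal.
- exact: (opA_slin thm).
exists h => // x; move: x.
apply: (un_uniq (tc_univ B) (chi := ch_map chi) (h := h \o tc_map chi)) => [||m].
- by split=> [x y|b x]; rewrite /= ?(tc_mapS chi).1 ?hS.1 ?(tc_mapS chi).2 ?hS.2.
- by split=> [x y|b x]; rewrite ?tmkDr // -tmk_bal tmkZl.
rewrite /= tc_map_e -[LHS]/((h \o tc_ev cp) m).
rewrite (@opA_nat _ _ _ _ _ _ thm B' B' (cris_id B')) //; last exact: gap_ideal.
have -> : h \o @tc_e B' = opA th (gap (pt B') cp) e1 by apply: funext.
by rewrite [X in X m](opA_gap_trans cp (pt B') cp e1adm) opA_gap_refl.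
Qed.

Definition tower_crystal : crystal iR := @Crystal _ _ _ tc_module tc_base_change.

Lemma tc_ev_ex (B : cris_ob iR) (w : point B) (N : lmodType B) (g : Mh -> N) :
  adm0 g -> slin w g ->
  exists2 h : tc_ob B -> N, semilinear idfun h & forall m, h (tc_ev w m) = g m.
Proof.
move=> gadm gS.
have [||h hS hE] := un_ex (tc_univ B) (chi := idfun) (g := opA th (gap (pt B) w) g).
- by apply: (opS_adm0 thm) => // i; apply: gap_ideal.
- exact: (opA_slin thm).
exists h => // m; rewrite -[LHS]/((h \o opA th (gap w (pt B)) (@tc_e B)) m).
rewrite (@opA_nat _ _ _ _ _ _ thm B B (cris_id B)) //; last exact: gap_ideal.
have -> : h \o @tc_e B = opA th (gap (pt B) w) g by apply: funext.
by rewrite [X in X m](opA_gap_trans w (pt B) w gadm) opA_gap_refl.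
Qed.

(** Transport from the tautological point to the chosen one keeps the generated submodule, and
    scalars at level [k] lift to [D]. *)
Lemma tc_ev_surj k : surjective (tc_ev (lev_thom D k)).
Proof.
have [eD eS] := (proj1 (tc_ev_adm0 (lev_thom D k)), tc_ev_slin (lev_thom D k)).
have E : opA th (gap (pt (lev D k)) (lev_thom D k)) (tc_ev (lev_thom D k)) = @tc_e (lev D k).
  by rewrite tc_ev_trans tc_ev_pt.
apply: (un_ind (tc_univ (lev D k))) => [|x y [m <-] [m' <-]|b m].
- by exists 0; rewrite (additive_map0 eD).
- by exists (m + m').
rewrite -E; move: b m.
apply: (opA_span (Q := fun x => exists m, tc_ev (lev_thom D k) m = x)) => [|x y [m <-] [m' <-]|b m].
- by exists 0; rewrite (additive_map0 eD).
- by exists (m + m').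
by have [a <-] := lev_pi_surj b; exists (to_Dhat a *: m); rewrite eS.
Qed.
End Module.
End TowerCrystal.

(** * The equivalence *)

Lemma sig_ext (T : Type) (P : T -> Prop) (x y : {z | P z}) : sval x = sval y -> x = y.
Proof. by case: x y => x Px [y Py] /= xy; apply: eq_exist. Qed.

(** * Quasi-inverse of a fully faithful, essentially surjective functor *)

Section FullyFaithful.
Variables (X Y : category) (F : functor X Y).
Hypothesis F_faithful : forall (a b : X) (f g : hom a b), fmap F f = fmap F g -> f = g.
Hypothesis F_full : forall (a b : X) (g : hom (F a) (F b)), exists f, fmap F f = g.
Hypothesis F_ess : forall y : Y, exists (x : X) (f : hom (F x) y), is_iso f.

Let pre (a b : X) (g : hom (F a) (F b)) : hom a b := projT1 (cid (F_full g)).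
Let preE a b (g : hom (F a) (F b)) : fmap F (pre g) = g.
Proof. by rewrite /pre; case: cid. Qed.
Let pre_comp a b c (g : hom (F b) (F c)) (g' : hom (F a) (F b)) :
  pre (compm g g') = compm (pre g) (pre g').
Proof. by apply: F_faithful; rewrite fmap_comp !preE. Qed.
Let pre_id a : pre (idm (F a)) = idm a.
Proof. by apply: F_faithful; rewrite fmap_id preE. Qed.

Let G0 (y : Y) : X := projT1 (cid (F_ess y)).
Let eps_ex (y : Y) : exists p : hom (F (G0 y)) y * hom y (F (G0 y)),
  compm p.2 p.1 = idm _ /\ compm p.1 p.2 = idm _.
Proof. by rewrite /G0; case: cid => x /= [f [g fg]]; exists (f, g). Qed.
Let eps y := (projT1 (cid (eps_ex y))).1.
Let eta y := (projT1 (cid (eps_ex y))).2.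
Let etaK y : compm (eta y) (eps y) = idm _.
Proof. by rewrite /eta /eps; case: cid => p /= []. Qed.
Let epsK y : compm (eps y) (eta y) = idm _.
Proof. by rewrite /eta /eps; case: cid => p /= []. Qed.

Let G1 (a b : Y) (f : hom a b) : hom (G0 a) (G0 b) := pre (compm (eta b) (compm f (eps a))).
Let G1_id a : G1 (idm a) = idm (G0 a).
Proof. by rewrite /G1 comp1m etaK pre_id. Qed.
Let G1_comp (a b c : Y) (f : hom b c) (g : hom a b) : G1 (compm f g) = compm (G1 f) (G1 g).
Proof.
rewrite /G1 -pre_comp; congr pre.
by rewrite -!compmA [compm (eps b) _]compmA epsK comp1m.
Qed.

Lemma equivalence_of_ff_ess : is_equivalence F.
Proof.
exists (Functor G1_id G1_comp); split.
  exists (fun x => pre (eps (F x))); split=> [a b f|a] /=.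
    by apply: F_faithful; rewrite !fmap_comp !preE !compmA epsK comp1m.
  by exists (pre (eta (F a))); split; rewrite -pre_comp ?etaK ?epsK pre_id.
exists eps; split=> [a b f|a] /=; last by exists (eta a).
by rewrite preE !compmA epsK comp1m.
Qed.
End FullyFaithful.

(** * From crystals to modules with connection *)

Section Functor.
Variables (A : pdring) (R : comPzRingType) (iR : {rmorphism A -> R}) (C : chart iR).
Local Notation D := (ch_D C).
Local Notation iA := (th_alg D).
Local Notation point B := (thom D (thick_of B)).
Local Notation t := (ch_t (c := C)).
Local Notation d := (ch_d C).
Local Notation mapF F := (@cm_map A R iR F _ _).

Definition cr_conn (F : crystal iR) : conn_module iA t := mk_conn (theta_thmod C F).

Lemma epart_hom (F G : crystal iR) (phi : forall X, F X -> G X) (B : cris_ob iR) x :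
  is_crystal_hom phi -> epart (phi (dual_ob B) x) = phi B (epart x).
Proof.
move=> [phiS phiN]; rewrite {1}(epart_decomp x) (phiS _).1 (phiS _).2 !phiN epartD.
by rewrite epart_in add0r epart_eps.
Qed.

Section Hom.
Variables (F G : crystal iR) (phi : crystal_hom F G).
Local Notation MF := (lim_mod (ctower C F)).
Local Notation MG := (lim_mod (ctower C G)).

Let lim_sub (m : MF) k :
  mt_map (ctower C G) k (sval phi _ (mproj k.+1 m)) = sval phi (lev D k) (mproj k m).
Proof. by case: phi => f [fS fN] /=; rewrite -fN; congr (f _ _); apply: ctower_map. Qed.
Definition lim_hom (m : MF) : MG := mk_lim_mod (lim_sub m).

Lemma lim_hom_ev (B : cris_ob iR) (w : point B) m : ev w (lim_hom m) = sval phi B (ev w m).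
Proof.
rewrite /ev -[mproj _ (lim_hom m)]/(sval phi (lev D _) (mproj _ m)).
by case: phi => f [fS fN] /=; rewrite fN.
Qed.

Lemma lim_homP : is_conn_hom (M := cr_conn F) (M' := cr_conn G) lim_hom.
Proof.
apply: thhom_conn_hom; split=> [x y|a x|k m m0|i m].
- by apply: mproj_inj => k; apply: (proj1 (proj2_sig phi) _).1.
- by apply: mproj_inj => k; apply: (proj1 (proj2_sig phi) _).2.
- rewrite -[LHS]/(sval phi (lev D k) (mproj k m)) [mproj k m]m0.
  exact: (additive_map0 (proj1 (proj2_sig phi) _).1).
rewrite !cth_mk_conn; apply: mproj_inj => k.
rewrite -[LHS](ev_lev k (lim_hom _)) -[RHS]ev_lev lim_hom_ev -!theta_ev lim_hom_ev.
by rewrite -(epart_hom _ (proj2_sig phi)).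
Qed.
Definition cr_conn_hom : conn_hom (cr_conn F) (cr_conn G) := exist _ lim_hom lim_homP.
End Hom.

Lemma cr_conn_id (F : crystal iR) : cr_conn_hom (crystal_id F) = conn_id (cr_conn F).
Proof. by apply: sig_ext; apply: funext => m; apply: mproj_inj. Qed.
Lemma cr_conn_comp (F G H : crystal iR) (f : crystal_hom G H) (g : crystal_hom F G) :
  cr_conn_hom (crystal_comp f g) = conn_comp (cr_conn_hom f) (cr_conn_hom g).
Proof. by apply: sig_ext; apply: funext => m; apply: mproj_inj. Qed.

Definition crystal_functor : functor (crystal_cat iR) (conn_cat iA t) :=
  @Defs.Functor (crystal_cat iR) (conn_cat iA t) cr_conn cr_conn_hom cr_conn_id cr_conn_comp.

Lemma crystal_functor_faithful (F G : crystal iR) (f g : crystal_hom F G) :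
  cr_conn_hom f = cr_conn_hom g -> f = g.
Proof.
move=> E; apply: sig_ext; apply: functional_extensionality_dep => B; apply: funext.
apply: (un_uniq (ev_univ F (pt C B)) (proj1 (proj2_sig f) B) (proj1 (proj2_sig g) B)) => m.
by rewrite -!lim_hom_ev; congr (ev _ _); apply: (congr1 (fun h => sval h m) E).
Qed.

Section Full.
Variables (F G : crystal iR) (f : conn_hom (cr_conn F) (cr_conn G)).
Local Notation MF := (lim_mod (ctower C F)).
Local Notation MG := (lim_mod (ctower C G)).
Let f0 : MF -> MG := sval f.

Let fP : is_thhom (@theta _ _ _ C F) (@theta _ _ _ C G) f0.
Proof.
have [fD fZ fk fth] := conn_hom_thhom (proj2_sig f); split=> // i m.
by have := fth i m; rewrite !cth_mk_conn.
Qed.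

Let evf (B : cris_ob iR) (w : point B) : MF -> G B := ev w \o f0.
Let evf_adm0 (B : cris_ob iR) (w : point B) : adm0 (evf w).
Proof.
have [fD fZ fk fth] := fP; have [eD [k ek]] := ev_adm0 G w.
split=> [x y|]; first by rewrite /evf /= fD eD.
by exists k => m /fk /ek.
Qed.
Let evf_slin (B : cris_ob iR) (w : point B) : slin w (evf w).
Proof. by have [fD fZ fk fth] := fP; move=> a m; rewrite /evf /= fZ ev_slin. Qed.

Let phi_ex (B : cris_ob iR) : exists2 h : F B -> G B, semilinear idfun h &
  forall m, h (ev (pt C B) m) = evf (pt C B) m.
Proof. by apply: (un_ex (ev_univ F (pt C B)) (chi := idfun)); [exact: evf_adm0 | exact: evf_slin]. Qed.
Let phi (B : cris_ob iR) : F B -> G B := s2val (cid2 (phi_ex B)).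
Let phiS (B : cris_ob iR) : semilinear idfun (@phi B) := s2valP (cid2 (phi_ex B)).
Let phiE (B : cris_ob iR) m : phi (ev (pt C B) m) = evf (pt C B) m.
Proof. exact: (s2valP' (cid2 (phi_ex B))). Qed.

Let opE_f (B : cris_ob iR) (N : lmodType B) (g : MG -> N) i x :
  opE (@theta _ _ _ C G) i x g \o f0 = opE (@theta _ _ _ C F) i x (g \o f0).
Proof.
have [fD fZ fk fth] := fP; apply: funext => m; rewrite /opE /=; congr esum.
apply: funext => l; congr (_ *: g _).
by elim: l => [//|l IH]; rewrite !iterS IH fth.
Qed.
Let opA_f (B : cris_ob iR) (N : lmodType B) (g : MG -> N) x :
  opA (@theta _ _ _ C G) x g \o f0 = opA (@theta _ _ _ C F) x (g \o f0).
Proof.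
by rewrite /opA; elim: (enum _) => [//|i s IH] /=; rewrite opE_f IH.
Qed.

(** [phi] is defined through the chosen point only. The Taylor formulas of [F] and [G] reach every
    other point, because [f0] commutes with the operators. *)
Let phi_ev (B : cris_ob iR) (w : point B) m : phi (ev w m) = ev w (f0 m).
Proof.
rewrite -(ev_opA F w (pt C B)) -[LHS]/((@phi B \o opA (@theta _ _ _ C F) (gap w (pt C B)) (ev (pt C B))) m).
rewrite (@opA_nat _ _ _ _ _ _ (theta_thmod C F) B B (cris_id B)) //;
  [|exact: ev_adm0|exact: gap_ideal].
rewrite -(ev_opA G w (pt C B)) -[RHS]/((opA _ _ _ \o f0) m) opA_f.
by congr (opA _ _ _ m); apply: funext => x; apply: phiE.
Qed.

Let phiP : is_crystal_hom phi.
Proof.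
split=> // B B' chi; apply: (un_uniq (ev_univ F (pt C B)) (h := fun x => phi (mapF F chi x))
  (h' := fun x => mapF G chi (phi x)) (chi := ch_map chi)) => [||m].
- by split=> [x y|b x]; rewrite ?(cm_mapS F chi).1 ?(phiS B').1 ?(cm_mapS F chi).2 ?(phiS B').2.
- by split=> [x y|b x]; rewrite ?(phiS B).1 ?(cm_mapS G chi).1 ?(phiS B).2 ?(cm_mapS G chi).2.
by rewrite ev_nat !phi_ev ev_nat.
Qed.

Lemma crystal_functor_full : exists g : crystal_hom F G, cr_conn_hom g = f.
Proof.
exists (exist _ phi phiP : crystal_hom F G); apply: sig_ext; apply: funext => m.
apply: mproj_inj => k.
by rewrite -[LHS]/(phi (mproj k m)) -[mproj k m]ev_lev phi_ev ev_lev.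
Qed.
End Full.

Section EssentiallySurjective.
Variable M : conn_module iA t.
Local Notation Mh := (lim_mod M).
Local Notation th := (@cth _ _ _ C M).
Let thm : is_thmod th := cth_thmod M.
Local Notation F := (tower_crystal thm).
Local Notation MF := (lim_mod (ctower C F)).
Local Notation tev := (tc_ev th).

Let beta_sub m k :
  mt_map (ctower C F) k (tev (lev_thom D k.+1) m) = tev (lev_thom D k) m.
Proof.
have E : tev (thom_comp (thom_of (lev_tr D k)) (lev_thom D k.+1)) = tev (lev_thom D k).
  by apply: tc_ev_ext => x; apply: Dtr_pi.
by rewrite -E -(tc_map_ev thm (lev_tr D k)).
Qed.
(** The comparison with the tower of the new crystal: [m] is evaluated at the tautological point of
    each level. *)
Let beta (m : Mh) : MF := @mk_lim_mod _ (ctower C F) _ (beta_sub m).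

Let ev_beta (B : cris_ob iR) (w : point B) m : ev w (beta m) = tev w m.
Proof.
rewrite /ev -[mproj _ (beta m)]/(tev (lev_thom D _) m).
rewrite [LHS](tc_map_ev thm); congr (_ m).
by apply: tc_ev_ext => x; apply: factorE.
Qed.

Lemma opS_single (B : cris_ob iR) (N : lmodType B) s i (x : 'I_d -> B) (g : Mh -> N) :
  uniq s -> (forall k, k != i -> x k = 0) ->
  opS th s x g = if i \in s then opE th i (x i) g else g.
Proof.
move=> + x0; elim: s => [//|k s IH] /= /andP[ks /IH ->]; rewrite inE eq_sym.
case: eqVneq => [<-|ki]; first by rewrite (negbTE ks).
by rewrite x0 // opE0.
Qed.

(** All [delta_l(eps)] with [l >= 2] vanish, so the Taylor series stops after its linear term. *)
Lemma opE_eps (B : cris_ob iR) (N : lmodType (dual_ob B)) i (g : Mh -> N) m :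
  opE th i (dual_eps B : dual_ob B) g m = g m + (dual_eps B : dual_ob B) *: g (th i m).
Proof.
have I0 : pd_ideal (dual_eps B : dual_ob B) by apply: pdi0.
rewrite /opE (@esumE _ _ 2) => [|[|[|l]] // _].
  rewrite !big_ord_recl big_ord0 addr0; congr (_ + _); last by congr (_ *: _); apply: (pd_1 (pd_ax _)).
  by rewrite -[RHS]scale1r; congr (_ *: _); apply: (pd_0 (pd_ax _)).
rewrite (_ : pd_pow l.+2 _ = 0) ?scale0r //.
have p0 n : pd_pow n.+1 (0 : B) = 0 by apply: pd_pow_0.
by apply: sqz_ext => /=; rewrite p0 // scale0r.
Qed.

(** The dual point differs from [w] by [eps] in the single coordinate [i]. Reading off the
    coefficient of [eps] identifies the operators [theta] of the new crystal with [th]. *)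
Let tev_dual (B : cris_ob iR) (w : point B) i m : tev (dual_point w i) m =
  mapF F (dual_inh B) (tev w m) + (dual_eps B : dual_ob B) *: mapF F (dual_inh B) (tev w (th i m)).
Proof.
set v := thom_comp (thom_of (dual_inh B)) w.
have vE n : mapF F (dual_inh B) (tev w n) = tev v n by apply: (tc_map_ev thm).
rewrite !vE -(tc_ev_trans thm (dual_point w i) v) /opA (@opS_single _ _ _ i) ?enum_uniq //.
  rewrite mem_enum inE.
  have -> : gap (dual_point w i) v i = dual_eps B.
    by apply: sqz_ext; rewrite /= ?subrr // ch_der_t eqxx rmorph1 subr0.
  exact: opE_eps.
move=> k ki; apply: sqz_ext; rewrite /= ?subrr // ch_der_t.
by rewrite (negbTE ki) rmorph0 subr0.
Qed.

Let beta_theta i m : beta (th i m) = theta i (beta m).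
Proof.
apply: mproj_inj => k; rewrite -[RHS]ev_lev -theta_ev ev_beta tev_dual epartD epart_in.
by rewrite add0r epart_eps.
Qed.
Let beta_kill k m : mproj k m = 0 -> tev (lev_thom D k) m = 0.
Proof.
apply: (slin_ker (tm_bc thm) (tc_ev_adm0 thm _) (tc_ev_slin thm _)) => x nx.
by apply/lev_pi0.
Qed.
Let tevD k : additive_map (tev (lev_thom D k)) := (tc_ev_adm0 thm (lev_thom D k)).1.
Let betaD : additive_map beta.
Proof. by move=> x y; apply: mproj_inj => k; apply: tevD. Qed.
Let betaP : is_thhom th (@theta _ _ _ C F) beta.
Proof.
split=> [|a m|k m m0|i m]; [exact: betaD | | exact: beta_kill | exact: beta_theta].
by apply: mproj_inj => k; apply: (tc_ev_slin thm).
Qed.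

(** The inverse of [beta] at level [k]: the projection of the limit to [M k] is continuous and
    linear along the tautological point, so it factors through the value of the new crystal. *)
Let gam_ex k : exists2 h : F (lev D k) -> M k, semilinear idfun h &
  forall m, h (tev (lev_thom D k) m) = mproj k m.
Proof. by apply: (tc_ev_ex thm); [split=> //; exists k | ]. Qed.
Let gam k : F (lev D k) -> M k := s2val (cid2 (gam_ex k)).
Let gamS k : semilinear idfun (@gam k) := s2valP (cid2 (gam_ex k)).
Let gamE k m : gam (tev (lev_thom D k) m) = mproj k m.
Proof. exact: (s2valP' (cid2 (gam_ex k))). Qed.

Let alpha_sub (y : MF) k : mt_map M k (gam (mproj k.+1 y)) = gam (mproj k y).
Proof.
rewrite -(mproj_map k y); have [m <-] := tc_ev_surj thm (mproj k.+1 y).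
by rewrite gamE mproj_map [mt_map _ _ _](beta_sub m k) gamE.
Qed.
Let alpha (y : MF) : Mh := mk_lim_mod (alpha_sub y).

Let betaK : cancel beta alpha.
Proof. by move=> m; apply: mproj_inj => k; apply: gamE. Qed.
Let alphaK : cancel alpha beta.
Proof.
move=> y; apply: mproj_inj => k; have [m mE] := tc_ev_surj thm (mproj k y).
rewrite -mE; apply/subr0_eq; rewrite -[mproj k (beta _)]/(tev _ _) -(additive_mapB (tevD k)).
apply: beta_kill; rewrite -[LHS]/(gam (mproj k y) - mproj k m).
by rewrite -mE gamE subrr.
Qed.
Let alphaP : is_thhom (@theta _ _ _ C F) th alpha.
Proof.
split=> [x y|a y|k y y0|i y].
- by apply: mproj_inj => k; apply: (gamS k).1.
- by apply: mproj_inj => k; apply: (gamS k).2.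
- by rewrite -[LHS]/(gam (mproj k y)) y0 (additive_map0 (gamS k).1).
by rewrite -{1}(alphaK y) -beta_theta betaK.
Qed.

Lemma crystal_functor_ess : exists (G : crystal iR) (f : conn_hom (cr_conn G) M),
  is_iso (C := conn_cat iA t) f.
Proof.
have a_hom : is_conn_hom (M := cr_conn F) (M' := M) alpha.
  apply: thhom_conn_hom; have [aD aZ ak ath] := alphaP; split=> // i m.
  by rewrite cth_mk_conn.
have b_hom : is_conn_hom (M := M) (M' := cr_conn F) beta.
  apply: thhom_conn_hom; have [bD bZ bk bth] := betaP; split=> // i m.
  by rewrite cth_mk_conn.
exists F, (exist _ alpha a_hom), (exist _ beta b_hom).
by split; apply: sig_ext; apply: funext; [exact: alphaK | exact: betaK].
Qed.
End EssentiallySurjective.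

Theorem crystal_functor_equivalence : is_equivalence crystal_functor.
Proof.
apply: equivalence_of_ff_ess; last exact: crystal_functor_ess.
  exact: crystal_functor_faithful.
exact: crystal_functor_full.
Qed.
End Functor.

Theorem proposition3p2p8
  (A : pdring) (R : comPzRingType) (iR : {rmorphism A -> R})
  (R_ft : finite_type iR) (eta_R : pd_extends_to iR)
  (P : comPzRingType) (iP : {rmorphism A -> P}) (P_smooth : smooth iP)
  (j : {rmorphism P -> R}) (jA : j \o iP =1 iR) (j_surj : surjective j)
  (d : nat) (T : comPzRingType) (iT : {rmorphism A -> T}) (X : 'I_d -> T)
  (T_poly : is_poly_alg iT X)
  (q : {rmorphism T -> P}) (qA : q \o iT =1 iP) (q_etale : etale q)
  (D : pdring) (iD : {rmorphism P -> D})
  (D_env : is_pd_envelope iP (fun x => j x = 0%R) iD) :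
  exists F : functor (crystal_cat iR) (conn_cat (iD \o iP) (fun i => iD (q (X i)))),
    is_equivalence F.
Proof.
pose C := env_chart eta_R jA j_surj T_poly qA q_etale D_env.
by exists (crystal_functor C); exact: (crystal_functor_equivalence C).
Qed.
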